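(* For every $0\le\eta<\frac16$ there exists an oblate uniaxial critical point of $J(\cdot,\eta)$. Furthermore, if $\eta_j\to\frac16$ from below, $Q_j$ are oblate uniaxial critical points of $J(\cdot,\eta_j)$ and $f_j$ is the optimal energy distribution for $(Q_j,\eta_j)$, then for a fixed $e\in\mathbb{S}^2$ there exist rotations $R_j\in\mathrm{SO}(3)$ such that $[R_jf_j]\overset{*}{\rightharpoonup}\frac1{2\pi}\mathcal{H}^1|_{\{p\in\mathbb{S}^2:e\cdot p=0\}}$ in $C(\mathbb{S}^2)^*$, where $\mathcal{H}^1|_{\{p\in\mathbb{S}^2:e\cdot p=0\}}$ is the 1-dimensional Hausdorff measure restricted to the great circle orthogonal to $e$.
   Context: $\mathbb{S}^2\subset\mathbb{R}^3$ is the unit sphere and $dp$ is the 2-dimensional Hausdorff measure on it. $\mathrm{Sym}_0(3)$ is the space of traceless symmetric real $3\times3$ matrices; $\mathcal{Q}=\{Q\in\mathrm{Sym}_0(3):v_{\min}(Q)>-\frac13\}$, $v_{\min}$ denoting the smallest eigenvalue. $\mathcal{P}(\mathbb{S}^2)=\{f\in L^1(\mathbb{S}^2): f\ge 0 \text{ a.e.},\ \int_{\mathbb{S}^2}f\,dp=1\}$. For $Q\in\mathcal{Q}$, $A(Q)=\{f\in\mathcal{P}(\mathbb{S}^2):\int_{\mathbb{S}^2}(p\otimes p-\frac13I)f(p)\,dp=Q\}$, and $$J(Q,\eta)=\inf_{f\in A(Q)}\int_{\mathbb{S}^2}f(p)\ln f(p)-f(p)\ln(Qp\cdot p-\eta)\,dp,$$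 where $-\ln$ is extended by $+\infty$ for non-positive arguments, $0\times(+\infty)=0$, $0\ln0=0$. For fixed $\eta$, the set $\mathrm{dom}(J)=\{Q\in\mathcal{Q}:J(Q,\eta)<+\infty\}$ is open in $\mathrm{Sym}_0(3)$ and $J$ is $C^1$ there; a critical point is $Q\in\mathrm{dom}(J)$ with $\frac{\partial J}{\partial Q}(Q,\eta)=0$ (as a derivative over all of $\mathrm{Sym}_0(3)$). For $Q\in\mathrm{dom}(J)$ the infimum is attained at a unique element of $A(Q)$, the optimal energy distribution. $Q$ is oblate uniaxial if $Q=S(e'\otimes e'-\frac13I)$ with $e'\in\mathbb{S}^2$, $S\in(-\frac12,0)$. For $R\in\mathrm{SO}(3)$, $[Rf](p)=f(Rp)$. *)

(* Defs.v *)
From HB Require Import structures.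
From mathcomp Require Import all_boot all_order all_algebra.
From mathcomp Require Import all_classical all_reals all_analysis.
Set Implicit Arguments.
Unset Strict Implicit.
Unset Printing Implicit Defensive.
Import Order.TTheory GRing.Theory Num.Theory.
Import numFieldNormedType.Exports.
Local Open Scope classical_set_scope.
Local Open Scope ring_scope.

(* The norm that the library puts on matrices is the sup norm, hence the
   explicit Euclidean structure on R^d, represented by column vectors. *)
Definition dot (R : realType) (d : nat) (u v : 'cV[R]_d) : R :=
  (u^T *m v) 0 0.

Definition enorm (R : realType) (d : nat) (u : 'cV[R]_d) : R :=
  Num.sqrt (dot u u).

(* Volume of the unit ball of R^n, pi^(n/2) / Gamma(n/2 + 1), through the
   recurrence V_(n+2) = 2 pi / (n+2) V_n. *)
Fixpoint unit_ball_volume (R : realType) (n : nat) : R :=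
  match n with
  | 0 => 1
  | 1 => 2
  | k.+2 => 2 * pi / k.+2%:R * unit_ball_volume R k
  end.

(* The diameter of the empty set is -oo. *)
Definition diam (R : realType) (d : nat) (C : set 'cV[R]_d) : \bar R :=
  ereal_sup [set (enorm (x - y))%:E | x in C & y in C].

(* The case distinction only matters for n = 0 and for the value -oo above:
   empty members of a cover contribute 0. *)
Definition hausdorff_gauge (R : realType) (d n : nat) (C : set 'cV[R]_d) :
    \bar R :=
  if C == set0 then 0%E
  else ((unit_ball_volume R n)%:E * (diam C * (2^-1)%:E) ^+ n)%E.

Definition hausdorff_content (R : realType) (d n : nat) (delta : R)
    (A : set 'cV[R]_d) : \bar R :=
  ereal_inf [set (\sum_(i <oo) hausdorff_gauge n (C i))%E
    | C in [set C : (set 'cV[R]_d)^nat |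
        (forall i, (diam (C i) <= delta%:E)%E) /\ A `<=` \bigcup_i C i]].

(* n-dimensional Hausdorff outer measure on R^d, normalized so as to agree
   with Lebesgue measure when n = d. *)
Definition hausdorff (R : realType) (d n : nat) (A : set 'cV[R]_d) : \bar R :=
  ereal_sup [set hausdorff_content n delta A | delta in [set x : R | 0 < x]].

Section hausdorff_outer_measure.
Variables (R : realType) (d n : nat).
Local Open Scope ereal_scope.

Let all_sets : set (set 'cV[R]_d) := setT.
Let T := g_sigma_algebraType all_sets.

Let gauge (delta : R) (C : set T) : \bar R :=
  if `[< diam (C : set 'cV[R]_d) <= delta%:E >] then
    hausdorff_gauge n (C : set 'cV[R]_d) else +oo.

Lemma unit_ball_volume_ge0 : (0 <= unit_ball_volume R n)%R.
Proof.
suff [] : (0 <= unit_ball_volume R n)%R /\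
          (0 <= unit_ball_volume R n.+1)%R by [].
elim: n => [|m [ih1 ih2]]; first by split=> /=; rewrite ?ler01 ?ler0n.
split; first exact: ih2.
rewrite [unit_ball_volume _ _]/= mulr_ge0// divr_ge0 ?ler0n// mulr_ge0 ?ler0n//.
exact: pi_ge0.
Qed.

Lemma hausdorff_gauge_ge0 (C : set 'cV[R]_d) : 0 <= hausdorff_gauge n C.
Proof.
rewrite /hausdorff_gauge; case: ifPn => // /set0P[x Cx].
rewrite mule_ge0 ?lee_fin ?unit_ball_volume_ge0// expe_ge0// mule_ge0//.
apply: (@le_trans _ _ (enorm (x - x))%:E); first by rewrite lee_fin sqrtr_ge0.
by apply: ereal_sup_ubound; exists x => //; exists x.
Qed.

Let gauge_ge0 delta C : 0 <= gauge delta C.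
Proof. by rewrite /gauge; case: ifP => // _; exact: hausdorff_gauge_ge0. Qed.

Let gauge0 delta : gauge delta set0 = 0.
Proof.
rewrite /gauge /hausdorff_gauge eqxx.
rewrite (_ : `[< _ >] = true)//; apply/asboolP.
by apply: ge_ereal_sup => _ [x []].
Qed.

Let hausdorff_contentE delta A :
  hausdorff_content n delta A = mu_ext (gauge delta) A.
Proof.
apply/eqP; rewrite eq_le; apply/andP; split.
  apply: le_ereal_inf_tmp => _ [C [_ AC] <-].
  have [sm|] := pselect (forall i, diam (C i : set 'cV[R]_d) <= delta%:E).
    apply: ereal_inf_lbound; exists C; first by split.
    apply: eq_eseriesr => i _; rewrite /gauge.
    by have /asboolP -> := sm i.
  move=> /existsNP[i /asboolPn/negbTE Ci].
  rewrite (@eseries_pinfty _ _ _ i) ?leey//.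
    by move=> k _; rewrite -ltNye (lt_le_trans _ (gauge_ge0 _ _)).
  by rewrite /gauge Ci.
apply: le_ereal_inf_tmp => _ [C [sm AC] <-].
apply: ereal_inf_lbound; exists C.
  by split => // i; exact: sub_sigma_algebra.
apply: eq_eseriesr => i _; rewrite /gauge.
by have /asboolP -> := sm i.
Qed.

Lemma hausdorff0 : hausdorff n (set0 : set 'cV[R]_d) = 0.
Proof.
apply/eqP; rewrite eq_le; apply/andP; split.
  apply: ge_ereal_sup => _ [e _ <-]; rewrite hausdorff_contentE.
  by rewrite (mu_ext0 (gauge0 e) (gauge_ge0 e)).
apply: ereal_sup_ubound; exists 1%R => /=; first exact: ltr01.
by rewrite hausdorff_contentE (mu_ext0 (gauge0 1%R) (gauge_ge0 1%R)).
Qed.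

Lemma hausdorff_ge0 (A : set 'cV[R]_d) : 0 <= hausdorff n A.
Proof.
apply: (@le_trans _ _ (hausdorff_content n 1 A)).
  by rewrite hausdorff_contentE (mu_ext_ge0 (gauge_ge0 1%R)).
by apply: ereal_sup_ubound; exists 1%R => //=; exact: ltr01.
Qed.

Lemma le_hausdorff :
  {homo (@hausdorff R d n) : A B / A `<=` B >-> A <= B}.
Proof.
move=> A B AB; apply: ge_ereal_sup => _ [e /= e0 <-].
apply: (@le_trans _ _ (hausdorff_content n e B)).
  by rewrite !hausdorff_contentE; exact: le_mu_ext.
by apply: ereal_sup_ubound; exists e.
Qed.

Lemma hausdorff_sigma_subadditive : sigma_subadditive (@hausdorff R d n).
Proof.
move=> F; apply: ge_ereal_sup => _ [e /= e0 <-]; rewrite hausdorff_contentE.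
apply: (le_trans (mu_ext_sigma_subadditive (gauge_ge0 e) F)).
apply: lee_nneseries => [i _ _|i _]; first exact: (mu_ext_ge0 (gauge_ge0 e)).
by rewrite -hausdorff_contentE; apply: ereal_sup_ubound; exists e.
Qed.

HB.instance Definition _ := isOuterMeasure.Build R 'cV[R]_d
  (@hausdorff R d n)
  hausdorff0 hausdorff_ge0 le_hausdorff hausdorff_sigma_subadditive.

End hausdorff_outer_measure.

(* R^3 with the sigma-algebra of Caratheodory H^n-measurable sets, which
   contains the Borel sets, and H^n as a measure on it. *)
Definition space3 (R : realType) (n : nat) :=
  caratheodory_type (@hausdorff R 3 n).

HB.instance Definition _ (R : realType) (n : nat) :=
  Measurable.on (space3 R n).

Definition Hmeas (R : realType) (n : nat) : set (space3 R n) -> \bar R :=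
  @hausdorff R 3 n.
Arguments Hmeas : clear implicits.

HB.instance Definition _ (R : realType) (n : nat) :=
  isMeasure.Build _ _ _ (Hmeas R n)
    (@caratheodory_measure0 R _ (@hausdorff R 3 n))
    (@caratheodory_measure_ge0 R _ (@hausdorff R 3 n))
    (@caratheodory_measure_sigma_additive R _ (@hausdorff R 3 n)).

Definition sphere (R : realType) : set 'cV[R]_3 := [set p | enorm p = 1].
Arguments sphere : clear implicits.

Definition SO3 (R : realType) : set 'M[R]_3 :=
  [set A | A^T *m A = 1%:M /\ \det A = 1].
Arguments SO3 : clear implicits.

Definition Sym0 (R : realType) : set 'M[R]_3 :=
  [set Q | Q^T = Q /\ \tr Q = 0].
Arguments Sym0 : clear implicits.

Definition vmin (R : realType) (Q : 'M[R]_3) : R :=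
  inf [set a : R | eigenvalue Q a].

Definition calQ (R : realType) : set 'M[R]_3 :=
  [set Q | Sym0 R Q /\ - (3^-1) < vmin Q].

(* Elements of L^1(S^2) are represented by functions on R^3, of which only the
   values on the sphere matter. *)
Definition calP (R : realType) : set ('cV[R]_3 -> R) :=
  [set f | [/\ (Hmeas R 2).-integrable (sphere R) (fun p => (f p)%:E),
     {ae Hmeas R 2, forall p, sphere R p -> 0 <= f p} &
     (\int[Hmeas R 2]_(p in sphere R) f p = 1)%R]].

(* p (x) p - I / 3 *)
Definition deviator (R : realType) (p : 'cV[R]_3) : 'M[R]_3 :=
  p *m p^T - (3^-1)%:M.

Definition admissible (R : realType) (Q : 'M[R]_3) : set ('cV[R]_3 -> R) :=
  [set f | calP f /\
    Q = \matrix_(i, j) \int[Hmeas R 2]_(p in sphere R) (deviator p i j * f p)].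

Definition neg_ln (R : realType) (x : R) : \bar R :=
  if 0 < x then (- ln x)%:E else +oo%E.

(* The conventions 0 * (+oo) = 0 and 0 ln 0 = 0 are those of the library. *)
Definition energy (R : realType) (Q : 'M[R]_3) (eta : R)
    (f : 'cV[R]_3 -> R) : \bar R :=
  (\int[Hmeas R 2]_(p in sphere R)
     ((f p * ln (f p))%:E + (f p)%:E * neg_ln (dot (Q *m p) p - eta)))%E.

Definition J (R : realType) (Q : 'M[R]_3) (eta : R) : \bar R :=
  ereal_inf [set energy Q eta f | f in admissible Q].

Definition domJ (R : realType) (eta : R) : set 'M[R]_3 :=
  [set Q | calQ Q /\ (J Q eta < +oo)%E].

(* G is the Frechet gradient at Q of J(., eta) as a function on Sym_0(3), for
   the Frobenius inner product. *)
Definition is_gradientJ (R : realType) (eta : R) (Q G : 'M[R]_3) : Prop :=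
  Sym0 R G /\
  forall eps : R, 0 < eps ->
    \forall H \near within (Sym0 R) (nbhs (0 : 'M[R]_3)),
      domJ eta (Q + H) /\
      `|fine (J (Q + H) eta) - fine (J Q eta) - \tr (G^T *m H)|
        <= eps * `|H|.

Definition critical_point (R : realType) (eta : R) (Q : 'M[R]_3) : Prop :=
  domJ eta Q /\ is_gradientJ eta Q 0.

Definition oblate_uniaxial (R : realType) (Q : 'M[R]_3) : Prop :=
  exists (e : 'cV[R]_3) (S : R),
    [/\ sphere R e, - (2^-1) < S < 0 & Q = S *: deviator e].

Definition optimal_energy_distribution (R : realType) (Q : 'M[R]_3) (eta : R)
    (f : 'cV[R]_3 -> R) : Prop :=
  admissible Q f /\ energy Q eta f = J Q eta.

Definition rotate (R : realType) (A : 'M[R]_3) (f : 'cV[R]_3 -> R) :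
  'cV[R]_3 -> R := fun p => f (A *m p).

Definition great_circle (R : realType) (e : 'cV[R]_3) : set 'cV[R]_3 :=
  [set p | sphere R p /\ dot e p = 0].

(* Elements of the dual of C(S^2), as functionals on functions R^3 -> R that
   are only tested against functions continuous on the sphere. *)
Definition density_functional (R : realType) (f g : 'cV[R]_3 -> R) : R :=
  \int[Hmeas R 2]_(p in sphere R) (g p * f p).

Definition circle_functional (R : realType) (e : 'cV[R]_3)
    (g : 'cV[R]_3 -> R) : R :=
  (2 * pi)^-1 * \int[Hmeas R 1]_(p in great_circle e) g p.

Definition weak_star_cvg (R : realType)
    (phi : nat -> ('cV[R]_3 -> R) -> R) (psi : ('cV[R]_3 -> R) -> R) : Prop :=
  forall g : 'cV[R]_3 -> R, {within sphere R, continuous g} ->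
    (fun j => phi j g) @ \oo --> psi g.

(* Main.v *)
(** For an oblate Q = - sig (e (x) e - I / 3) the weight Qp.p - eta is
    sig (alp - (e.p)^2) with alp = 1/3 - eta / sig, and Gibbs' inequality singles
    out the density proportional to the positive part of the weight times
    exp (lam (e.p)^2).  Such a Q is critical as soon as two scalar equations in
    (sig, alp, lam) hold.  For each alp in (0, 1/3] they have a solution that
    depends continuously on alp, because x |-> (1 - x) e^x decreases on [0, +oo),
    and the intermediate value theorem in alp reaches every eta in [0, 1/6).
    That the gradient vanishes is proved by two bounds of J (Q + H) that agree up
    to o(|H|): from below by Gibbs' inequality with the unperturbed multiplier,
    from above by a competitor corrected so as to satisfy the moment constraint.

    For the concentration, the minimizer is unique by strict convexity, hence
    invariant under the rotations fixing e.  Having finite energy it vanishes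
    where the weight is negative, so the mean of the weight is nonnegative; this
    forces S to be close to - 1/2 and the second moment of e.p to tend to 0.
    Replacing a test function by its average over finitely many rotations about e
    changes neither its integral against the minimizer nor its mean over the
    equator, and this average is nearly constant close to the equator. *)
Require Import Defs.
From HB Require Import structures.
From mathcomp Require Import all_boot all_order all_algebra.
From mathcomp Require Import all_classical all_reals all_analysis.
From mathcomp Require Import measurable_realfun.
From mathcomp Require Import ring lra zify.
Import Order.TTheory GRing.Theory Num.Theory.
Import numFieldNormedType.Exports.
Set Implicit Arguments.
Unset Strict Implicit.
Unset Printing Implicit Defensive.
Local Open Scope classical_set_scope.
Local Open Scope ring_scope.

(** * Euclidean space *)

(** J is never differentiated in general: it is only bracketed near the constructed Q. The lower
    bracket keeps the unperturbed factor [k] because ln k is affine in z^2, so admissibility alone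
    evaluates its mean; the price is [rho H], the mass error of the perturbed positive part. For
    traceless H and an axisymmetric density the derivative of [rho] is a multiple of H 2 2, which is
    why one multiplier [lam] suffices. The obstacle is the edge where the weight vanishes: there the
    positive part is not differentiable and the entropy relative to the weight degenerates. Hence
    the use of null parallels and of a corrector confined to a strip where the weight is bounded
    below. The bound alp <= 1/3, that is eta >= 0, makes 1 - 3 z^2 nonnegative on the support, and
    monotonicity in the multiplier then replaces an implicit function theorem. No sphere integral is
    computed in coordinates: finite area, null parallels, open pieces of positive area and
    orthogonal invariance suffice. Only the length of a great circle is needed exactly. *)

Section Euclid.
Variable R : realType.
Implicit Types (u v w p q : 'cV[R]_3) (A M : 'M[R]_3).

Lemma sum3 (F : 'I_3 -> R) : \sum_i F i = F 0 + F 1 + F 2.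
Proof.
rewrite !big_ord_recl big_ord0 addr0 addrA; congr (_ + F _ + F _);
  exact: val_inj.
Qed.

Lemma forall3 (P : 'I_3 -> Prop) : P 0 -> P 1 -> P 2 -> forall i, P i.
Proof.
move=> P0 P1 P2 i.
case: i => -[|[|[|//]]] h.
- by have -> : Ordinal h = 0 by exact: val_inj.
- by have -> : Ordinal h = 1 by exact: val_inj.
- by have -> : Ordinal h = 2 by exact: val_inj.
Qed.

Lemma dotE u v : dot u v = u 0 0 * v 0 0 + u 1 0 * v 1 0 + u 2 0 * v 2 0.
Proof. by rewrite /dot mxE sum3 !mxE. Qed.

Definition col3 (x y z : R) : 'cV[R]_3 := \col_i [:: x; y; z]`_i.

Lemma col3_eta u : u = col3 (u 0 0) (u 1 0) (u 2 0).
Proof. by apply/colP; apply: forall3; rewrite !mxE. Qed.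

Lemma col30 x y z : col3 x y z 0 0 = x. Proof. by rewrite mxE. Qed.
Lemma col31 x y z : col3 x y z 1 0 = y. Proof. by rewrite mxE. Qed.
Lemma col32 x y z : col3 x y z 2 0 = z. Proof. by rewrite mxE. Qed.
Definition col3E := (col30, col31, col32).

Lemma colBE u v i : (u - v) i 0 = u i 0 - v i 0.
Proof. by rewrite !mxE. Qed.

Lemma dot_ge0 u : 0 <= dot u u.
Proof. by rewrite dotE -!expr2 !addr_ge0 ?sqr_ge0. Qed.

Lemma enorm_ge0 u : 0 <= enorm u.
Proof. exact: sqrtr_ge0. Qed.

Lemma sqr_enorm u : enorm u ^+ 2 = dot u u.
Proof. by rewrite sqr_sqrtr// dot_ge0. Qed.

Lemma enorm0 : enorm (0 : 'cV[R]_3) = 0.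
Proof. by rewrite /enorm dotE !mxE !mulr0 !addr0 sqrtr0. Qed.

Lemma enormN u : enorm (- u) = enorm u.
Proof. by rewrite /enorm !dotE !mxE !mulrNN. Qed.

Lemma enormC u v : enorm (u - v) = enorm (v - u).
Proof. by rewrite -opprB enormN. Qed.

Lemma dot_sym u v : dot u v = dot v u.
Proof. by rewrite !dotE; ring. Qed.

Lemma dot_le_enorm u v : `|dot u v| <= enorm u * enorm v.
Proof.
rewrite -(@ler_pXn2r _ 2) ?nnegrE ?mulr_ge0 ?enorm_ge0//.
rewrite exprMn !sqr_enorm -normrX ger0_norm ?sqr_ge0// !dotE.
rewrite -subr_ge0.
rewrite [leRHS](_ : _ = (u 0 0 * v 1 0 - u 1 0 * v 0 0) ^+ 2 +
  (u 0 0 * v 2 0 - u 2 0 * v 0 0) ^+ 2 +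
  (u 1 0 * v 2 0 - u 2 0 * v 1 0) ^+ 2); last by ring.
by rewrite !addr_ge0 ?sqr_ge0.
Qed.

Lemma enormD u v : enorm (u + v) <= enorm u + enorm v.
Proof.
rewrite -(@ler_pXn2r _ 2) ?nnegrE ?addr_ge0 ?enorm_ge0//.
rewrite sqrrD !sqr_enorm.
have -> : dot (u + v) (u + v) = dot u u + dot u v *+ 2 + dot v v.
  by rewrite !dotE !mxE; ring.
rewrite lerD2r lerD2l ler_pMn2r//.
by rewrite (le_trans (ler_norm _))// dot_le_enorm.
Qed.

Lemma enorm_dist u v w : enorm (u - w) <= enorm (u - v) + enorm (v - w).
Proof. by rewrite -[u - w](subrKA v) enormD. Qed.

Lemma coord_le_enorm u i : `|u i 0| <= enorm u.
Proof.
rewrite -(@ler_pXn2r _ 2) ?nnegrE ?enorm_ge0//.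
rewrite sqr_enorm -normrX ger0_norm ?sqr_ge0// dotE -!expr2.
have := sqr_ge0 (u 0 0); have := sqr_ge0 (u 1 0); have := sqr_ge0 (u 2 0).
by move: i; apply: forall3; lra.
Qed.

Lemma enorm_le_sum u : enorm u <= `|u 0 0| + `|u 1 0| + `|u 2 0|.
Proof.
rewrite -(@ler_pXn2r _ 2) ?nnegrE ?addr_ge0 ?enorm_ge0//.
rewrite sqr_enorm dotE -!expr2 -(real_normK (num_real (u 0 0))).
rewrite -(real_normK (num_real (u 1 0))) -(real_normK (num_real (u 2 0))).
have := normr_ge0 (u 0 0); have := normr_ge0 (u 1 0).
have := normr_ge0 (u 2 0).
set a := `|u 0 0|; set b := `|u 1 0|; set c := `|u 2 0|.
by move=> c0 b0 a0; nra.
Qed.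

Lemma mx_norm_leP m n (M : 'M[R]_(m, n)) (c : R) : 0 <= c ->
  (forall i j, `|M i j| <= c) <-> `|M| <= c.
Proof.
move=> c0; rewrite [`|M|]/Num.norm /= mx_normrE; split=> [Mc|].
  by apply/bigmax_leP; split => // -[i j] _; exact: Mc.
by move=> /bigmax_leP[_ Mc] i j; exact: (Mc (i, j)).
Qed.

Lemma norm_le_enorm u : `|u| <= enorm u.
Proof.
apply/mx_norm_leP; first exact: enorm_ge0.
by move=> i j; rewrite (ord1 j) coord_le_enorm.
Qed.

Lemma coord_le_norm m n (M : 'M[R]_(m, n)) i j : `|M i j| <= `|M|.
Proof. by have [_] := mx_norm_leP M (normr_ge0 M); apply. Qed.

Lemma enorm_le_norm u : enorm u <= 3 * `|u|.
Proof.
apply: (le_trans (enorm_le_sum u)).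
have := coord_le_norm u 0 0; have := coord_le_norm u 1 0.
by have := coord_le_norm u 2 0; lra.
Qed.

Lemma sphereP p :
  sphere R p <-> p 0 0 ^+ 2 + p 1 0 ^+ 2 + p 2 0 ^+ 2 = 1.
Proof.
rewrite /sphere /= !expr2 -dotE; split=> [p1|p1].
  by rewrite -sqr_enorm p1 expr1n.
by rewrite /enorm p1 sqrtr1.
Qed.

Lemma sphere_dot p : sphere R p -> dot p p = 1.
Proof. by move=> p1; rewrite -sqr_enorm p1 expr1n. Qed.

Lemma sphere_le1 p i : sphere R p -> `|p i 0| <= 1.
Proof. by move=> <-; exact: coord_le_enorm. Qed.

Lemma dot_mul A u v : dot (A *m u) (A *m v) = dot u (A^T *m A *m v).
Proof. by rewrite /dot trmx_mul -!mulmxA. Qed.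

Lemma dot_trmx A u v : dot (A *m u) v = dot u (A^T *m v).
Proof. by rewrite /dot trmx_mul -!mulmxA. Qed.

Lemma enorm_orth A u : A^T *m A = 1%:M -> enorm (A *m u) = enorm u.
Proof. by move=> A1; rewrite /enorm dot_mul A1 mul1mx. Qed.

Lemma sphere_orth A u : A^T *m A = 1%:M -> sphere R (A *m u) <-> sphere R u.
Proof. by move=> A1; rewrite /sphere /= enorm_orth. Qed.

Lemma orth_trmx A : A^T *m A = 1%:M -> A *m A^T = 1%:M.
Proof. exact: mulmx1C. Qed.

End Euclid.

(** * Borel sets are measurable for Hausdorff measures *)

Section Hausdorff.
Variables (R : realType) (n : nat).
Implicit Types (A B C : set 'cV[R]_3) (delta : R).
Local Notation mu := (@hausdorff R 3 n).
Local Open Scope ereal_scope.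

Lemma diam_ub C (x y : 'cV[R]_3) : C x -> C y -> (enorm (x - y))%:E <= diam C.
Proof. by move=> Cx Cy; apply: ereal_sup_ubound; exists x => //; exists y. Qed.

Lemma diam_le C (d : R) :
  (forall x y, C x -> C y -> enorm (x - y) <= d)%R -> diam C <= d%:E.
Proof.
by move=> Cd; apply: ge_ereal_sup => _ [x Cx [y Cy <-]]; rewrite lee_fin Cd.
Qed.

Lemma diam0 : diam (set0 : set 'cV[R]_3) = -oo.
Proof.
by apply/eqP; rewrite -leeNy_eq; apply: ge_ereal_sup => _ [x []].
Qed.

Lemma hausdorff_gauge0 : hausdorff_gauge n (set0 : set 'cV[R]_3) = 0.
Proof. by rewrite /hausdorff_gauge eqxx. Qed.

Lemma content_le_hausdorff delta A : (0 < delta)%R ->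
  hausdorff_content n delta A <= mu A.
Proof. by move=> d0; apply: ereal_sup_ubound; exists delta. Qed.

Lemma content_antitone (d d' : R) A : (d <= d')%R ->
  hausdorff_content n d' A <= hausdorff_content n d A.
Proof.
move=> dd'; apply: le_ereal_inf_tmp => _ [C [Cd AC] <-].
apply: ereal_inf_lbound; exists C => //; split => // i.
by rewrite (le_trans (Cd i))// lee_fin.
Qed.

Lemma content_ge0 delta A : 0 <= hausdorff_content n delta A.
Proof.
apply: le_ereal_inf_tmp => _ [C _ <-].
by apply: nneseries_ge0 => i _ _; exact: hausdorff_gauge_ge0.
Qed.

(** A member of a cover has diameter at most delta < d, so it cannot meet both sets. Giving to A the
    members that meet it, and the others to B, splits the cover without changing its total gauge, as
    the empty set costs 0. *)
Lemma content_sepU delta (d : R) A B : (delta < d)%R ->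
  (forall a b, A a -> B b -> d <= enorm (a - b))%R ->
  hausdorff_content n delta A + hausdorff_content n delta B <=
  hausdorff_content n delta (A `|` B).
Proof.
move=> dd AB; apply: le_ereal_inf_tmp => _ [C [Cd ABC] <-].
pose m i := `[< C i `&` A !=set0 >].
pose C1 i := if m i then C i else set0.
pose C2 i := if m i then set0 else C i.
have -> : \sum_(i <oo) hausdorff_gauge n (C i) =
    \sum_(i <oo) hausdorff_gauge n (C1 i) +
    \sum_(i <oo) hausdorff_gauge n (C2 i).
  rewrite -nneseriesD => [|i _ _|i _ _]; try exact: hausdorff_gauge_ge0.
  apply: eq_eseriesr => i _; rewrite /C1 /C2.
  by case: (m i); rewrite hausdorff_gauge0 ?adde0 ?add0e.
apply: leeD; apply: ereal_inf_lbound.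
- exists C1 => //; split=> [i|x Ax].
    by rewrite /C1; case: (m i) => //; rewrite diam0 leNye.
  have [i _ Cix] := ABC _ (or_introl Ax).
  exists i => //; rewrite /C1 /m; case: asboolP => // ne; exfalso.
  by apply: ne; exists x.
- exists C2 => //; split=> [i|x Bx].
    by rewrite /C2; case: (m i) => //; rewrite diam0 leNye.
  have [i _ Cix] := ABC _ (or_intror Bx).
  exists i => //; rewrite /C2 /m; case: asboolP => // -[y [Ciy Ay]].
  have := AB _ _ Ay Bx; have := le_trans (diam_ub Ciy Cix) (Cd i).
  by rewrite lee_fin => h1 h2; move: (le_lt_trans (le_trans h2 h1) dd); rewrite ltxx.
Qed.

Lemma hausdorff_sepU (d : R) A B : (0 < d)%R ->
  (forall a b, A a -> B b -> d <= enorm (a - b))%R ->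
  mu A + mu B <= mu (A `|` B).
Proof.
move=> d0 AB.
have [->|] := eqVneq (mu (A `|` B)) +oo; first by rewrite leey.
rewrite -ltey => fin.
have fA : mu A < +oo.
  by apply: le_lt_trans fin; apply: le_outer_measure; exact: subsetUl.
have fB : mu B < +oo.
  by apply: le_lt_trans fin; apply: le_outer_measure; exact: subsetUr.
have finB : mu B \is a fin_num by rewrite ge0_fin_numE// outer_measure_ge0.
rewrite -leeBrDr//.
apply: ge_ereal_sup => _ [d1 /= d10 <-].
have c1 : hausdorff_content n d1 A \is a fin_num.
  rewrite ge0_fin_numE ?content_ge0//; apply: le_lt_trans fA.
  exact: content_le_hausdorff.
rewrite leeBrDr// addeC -leeBrDr//.
apply: ge_ereal_sup => _ [d2 /= d20 <-].
rewrite leeBrDr// addeC.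
(* Finer than both scales and strictly below the gap, so that covers split. *)
pose m : R := (Num.min (Num.min d1 d2) (d / 2))%R.
have m0 : (0 < m)%R by rewrite !lt_min d10 d20 divr_gt0.
apply: (@le_trans _ _ (hausdorff_content n m (A `|` B))); last first.
  exact: content_le_hausdorff.
apply: (@le_trans _ _ (hausdorff_content n m A + hausdorff_content n m B)).
  by apply: leeD; apply: content_antitone; rewrite !ge_min lexx ?orbT.
apply: (@content_sepU _ d) => //.
by rewrite /m gt_min; apply/orP; right; lra.
Qed.

(** Caratheodory's criterion for metric outer measures: cut the positivity set into layers according
    to the size of F. Layers that are not adjacent lie at positive distance, so their measures have
    a finite sum and the layers close to F = 0 contribute a vanishing tail. *)
Lemma lipschitz_caratheodory (F : 'cV[R]_3 -> R) :
  (forall p q, F p - F q <= enorm (p - q))%R ->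
  mu.-caratheodory [set p | (0 < F p)%R].
Proof.
move=> FL; set U := [set p | _]; apply: le_caratheodory_measurable => X.
change (mu (X `&` U) + mu (X `&` ~` U) <= mu X).
have [->|] := eqVneq (mu X) +oo; first by rewrite leey.
rewrite -ltey => fX.
pose r k : R := (k.+1%:R^-1)%R.
have r0 k : (0 < r k)%R by rewrite invr_gt0.
have rS k : (r k.+1 < r k)%R by rewrite ltf_pV2 ?posrE// ltr_nat.
pose V k := X `&` [set p | (r k <= F p)%R].
pose S k := X `&` [set p | (r k.+1 <= F p < r k)%R].
have VX k : mu (V k) <= mu X by apply: le_outer_measure; exact: subIsetl.
(* The skipped layer between the two sets has thickness r k - r k.+1, which bounds their distance
   from below since F is 1-Lipschitz. *)
have VS k : mu (S k.+1) + mu (V k) <= mu (V k.+2).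
  have := @hausdorff_sepU (r k - r k.+1) (S k.+1) (V k).
  rewrite subr_gt0 => /(_ (rS k)) h.
  apply: le_trans (h _) _.
    move=> a b [_ /= /andP[_ a1]] [_ /= b1]; rewrite enormC.
    by apply: le_trans (FL _ _); lra.
  apply: le_outer_measure => p [[Xp /= /andP[p1 _]]|[Xp /= p1]]; split => //=.
  by rewrite (le_trans _ p1)// (le_trans (ltW (rS _)))// ltW.
(* [VS] advances the index of V by two; carrying two consecutive sets V telescopes along even and
   odd indices at once. *)
have sumS N : \sum_(0 <= k < N) mu (S k.+1) + (mu (V 0%N) + mu (V 1%N)) <=
    mu (V N) + mu (V N.+1).
  elim: N => [|N ih]; first by rewrite big_geq// add0e.
  rewrite big_nat_recr//= -addeA [X in _ + X]addeC addeA.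
  apply: (le_trans (leeD2r _ ih)).
  by rewrite addeC addeA [leLHS]addeC leeD2l// VS.
have sumfin : \sum_(0 <= k <oo) mu (S k.+1) < +oo.
  apply: (@le_lt_trans _ _ (mu X + mu X)); last by rewrite lte_add_pinfty.
  apply: lime_le.
    by apply: is_cvg_nneseries => k _ _; exact: outer_measure_ge0.
  apply: nearW => N; apply: (le_trans _ (leeD (VX N) (VX N.+1))).
  apply: (le_trans _ (sumS N)); rewrite leeDl// adde_ge0//;
    exact: outer_measure_ge0.
have tail := nneseries_tail_cvg sumfin (fun _ _ => outer_measure_ge0 mu _).
have key K : mu (X `&` U) + mu (X `&` ~` U) <=
    mu X + \sum_(K <= k <oo) mu (S k.+1).
  have h1 : mu (X `&` U) <= mu (V K.+1) + \sum_(K <= k <oo) mu (S k.+1).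
    pose SS i := S (i + K)%N.+1.
    apply: (@le_trans _ _ (mu (V K.+1 `|` \bigcup_i SS i))).
      apply: le_outer_measure => p [Xp /= Fp].
      have [|FpK] := leP (r K.+1) (F p); first by move=> ?; left.
      right.
      (* The least such j puts p in the layer S j.-1, and j > K + 1 places this layer in the
         tail. *)
      have ex : exists j, (r j <= F p)%R.
        exists (Num.bound (F p)^-1); rewrite -[leRHS]invrK lef_pV2 ?posrE ?invr_gt0//.
        rewrite (le_trans (ltW (archi_boundP _)))// ?ler_nat// invr_ge0.
        exact: ltW.
      case: (ex_minnP ex) => j jF jmin.
      have rle a b : (a <= b)%N -> (r b <= r a)%R.
        by move=> ab; rewrite lef_pV2 ?posrE// ler_nat.
      have Kj : (K.+1 < j)%N.
        rewrite ltnNge; apply/negP => /rle rj.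
        by move: (lt_le_trans FpK (le_trans rj jF)); rewrite ltxx.
      exists (j - K.+2)%N => //; rewrite /SS /S; split => //=.
      have -> : (j - K.+2 + K).+1 = j.-1 by lia.
      have -> : j.-1.+1 = j by lia.
      rewrite jF /= ltNge; apply/negP => /jmin; lia.
    apply: (le_trans (outer_measureU2 _ _ _)); rewrite leeD2l//.
    rewrite -(nneseries_addn (f := fun k => mu (S k.+1))); last first.
      by move=> i; exact: outer_measure_ge0.
    exact: outer_measure_sigma_subadditive.
  have h2 : mu (V K.+1) + mu (X `&` ~` U) <= mu X.
    apply: (le_trans (@hausdorff_sepU (r K.+1) _ _ (r0 _) _)).
      move=> a b [_ /= ra] [_ /= /negP]; rewrite -leNgt => Fb.
      by apply: le_trans (FL _ _); lra.
    by apply: le_outer_measure => p [[]|[]].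
  apply: (le_trans (leeD2r _ h1)); rewrite addeAC; exact: leeD2r.
have c : (mu X + \sum_(K <= k <oo) mu (S k.+1)) @[K --> \oo] --> mu X + 0.
  apply: cvgeD => //; last exact: cvg_cst.
  by rewrite adde_defC fin_num_adde_defr.
rewrite -[leRHS]adde0; apply: (cvge_ge _ c); exact: nearW.
Qed.

End Hausdorff.

(** * Integrals of bounded measurable functions *)

Section BoundedMeasurable.
Context d (T : measurableType d) (R : realType).
Variables (mu : {measure set T -> \bar R}) (D : set T).
Hypotheses (mD : measurable D) (finD : (mu D < +oo)%E).
Implicit Types f g : T -> R.

Definition bounded_measurable (D : set T) f :=
  measurable_fun D f /\ exists M, forall x, D x -> `|f x| <= M.
Local Notation bm := (bounded_measurable D).
Local Notation L1 f := (mu.-integrable D (fun x => (f x)%:E)).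
Local Notation I f := (\int[mu]_(x in D) f x).

Lemma bm_cst c : bm (fun=> c).
Proof. by split; [exact: measurable_cst|exists `|c|]. Qed.

Lemma bmN f : bm f -> bm (fun x => - f x).
Proof.
move=> [mf [M fM]]; split; first exact: measurableT_comp.
by exists M => x Dx; rewrite normrN fM.
Qed.

Lemma bmD f g : bm f -> bm g -> bm (fun x => f x + g x).
Proof.
move=> [mf [M fM]] [mg [N gN]]; split; first exact: measurable_funD.
by exists (M + N) => x Dx; rewrite (le_trans (ler_normD _ _))// lerD ?fM ?gN.
Qed.

Lemma bmM f g : bm f -> bm g -> bm (fun x => f x * g x).
Proof.
move=> [mf [M fM]] [mg [N gN]]; split; first exact: measurable_funM.
by exists (M * N) => x Dx; rewrite normrM ler_pM ?fM ?gN.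
Qed.

Lemma bmX f n : bm f -> bm (fun x => f x ^+ n).
Proof.
move=> mf; elim: n => [|n ih]; first exact: bm_cst.
under [X in bm X]funext do rewrite exprS.
exact: bmM.
Qed.

Lemma bm_sum (J : Type) (s : seq J) (F : J -> T -> R) :
  (forall i, bm (F i)) -> bm (fun x => \sum_(i <- s) F i x).
Proof.
move=> bF; elim: s => [|i s ih].
  by under [X in bm X]funext do rewrite big_nil; exact: bm_cst.
by under [X in bm X]funext do rewrite big_cons; exact: bmD.
Qed.

Lemma bm_comp (h : R -> R) f : continuous h -> bm f -> bm (fun x => h (f x)).
Proof.
move=> ch [mf [M fM]]; split.
  by apply: measurableT_comp => //; exact: continuous_measurable_fun.
have /compact_bounded[N [_ hN]] : compact (h @` `[- M, M]).
  apply: continuous_compact; last exact: segment_compact.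
  exact: continuous_subspaceT.
exists (N + 1) => x Dx; apply: hN; first by rewrite ltrDl.
by exists (f x) => //=; rewrite in_itv /= -ler_norml fM.
Qed.

Lemma bm_indic f (A : set T) : measurable A -> bm f ->
  bm (fun x => if x \in A then f x else 0).
Proof.
move=> mA [mf [M fM]]; split; last first.
  exists `|M| => x Dx; case: ifP => _; last by rewrite normr0.
  by rewrite (le_trans (fM _ Dx))// ler_norm.
rewrite (_ : (fun x => _) = f \* \1_A); first exact: measurable_funM.
by apply/funext => x; rewrite /= indicE; case: (x \in A); rewrite /= ?mulr1 ?mulr0.
Qed.

Lemma bm_int f : bm f -> L1 f.
Proof.
move=> [mf [M fM]]; apply: measurable_bounded_integrable => //.
by exists M; split => [|x Mx y Dy]; rewrite ?num_real//= (le_trans (fM _ Dy))// ltW.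
Qed.

Lemma bm_int_mul f g : bm f -> L1 g -> L1 (fun x => f x * g x).
Proof.
move=> [mf [M fM]] ig.
apply: (@integrableMr _ _ _ mu _ mD f (fun x => (g x)%:E)) => //.
by exists M; split => [|x Mx y Dy]; rewrite ?num_real//= (le_trans (fM _ Dy))// ltW.
Qed.

Lemma L1D f g : L1 f -> L1 g -> L1 (fun x => f x + g x).
Proof.
by move=> lf lg; exact: (@integrableD _ _ _ mu D mD (EFin \o f) (EFin \o g)).
Qed.

Lemma L1N f : L1 f -> L1 (fun x => - f x).
Proof. by move=> lf; exact: (@integrableN _ _ _ mu D (EFin \o f)). Qed.

Lemma L1Z c f : L1 f -> L1 (fun x => c * f x).
Proof. by move=> lf; exact: (@integrableZl _ _ _ mu D mD c (EFin \o f)). Qed.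

Lemma L1_sum (J : Type) (s : seq J) (F : J -> T -> R) :
  (forall i, L1 (F i)) -> L1 (fun x => \sum_(i <- s) F i x).
Proof.
move=> bF; elim: s => [|i s ih].
  by under [X in integrable _ _ X]funext do rewrite big_nil; exact: bm_int (bm_cst _).
by under [X in integrable _ _ X]funext do rewrite big_cons; exact: L1D.
Qed.

Lemma intD f g : L1 f -> L1 g -> I (fun x => f x + g x) = I f + I g.
Proof. exact: RintegralD. Qed.

Lemma intZ c f : L1 f -> I (fun x => c * f x) = c * I f.
Proof. exact: RintegralZl. Qed.

Lemma intN f : L1 f -> I (fun x => - f x) = - I f.
Proof.
move=> i; rewrite -mulN1r -intZ//; apply: eq_Rintegral => x _.
by rewrite mulN1r.
Qed.

Lemma intB f g : L1 f -> L1 g -> I (fun x => f x - g x) = I f - I g.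
Proof. by move=> ? ?; rewrite intD ?intN//; exact: L1N. Qed.

Lemma int_sum (J : Type) (s : seq J) (F : J -> T -> R) :
  (forall i, L1 (F i)) ->
  I (fun x => \sum_(i <- s) F i x) = \sum_(i <- s) I (F i).
Proof.
move=> bF; elim: s => [|i s ih].
  rewrite big_nil; under eq_Rintegral do rewrite big_nil.
  by rewrite Rintegral_cst// mul0r.
under eq_Rintegral do rewrite big_cons.
by rewrite big_cons intD ?ih//; exact: L1_sum.
Qed.

Lemma int_cst c : I (fun=> c) = c * fine (mu D).
Proof. exact: Rintegral_cst. Qed.

Lemma int_le f g : L1 f -> L1 g -> (forall x, D x -> f x <= g x) -> I f <= I g.
Proof. by move=> *; exact: le_Rintegral. Qed.

Lemma int_ge0 f : (forall x, D x -> 0 <= f x) -> 0 <= I f.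
Proof. exact: Rintegral_ge0. Qed.

Lemma int_abs_le f g : L1 f -> L1 g -> (forall x, D x -> `|f x| <= g x) ->
  `|I f| <= I g.
Proof.
move=> lf lg fg; apply: (le_trans (le_normr_Rintegral _ _)) => //.
by apply: int_le => //; exact: integrable_norm.
Qed.

Lemma int_EFin f : L1 f -> (\int[mu]_(x in D) (f x)%:E)%E = (I f)%:E.
Proof. by move=> lf; rewrite /Rintegral fineK// integrable_fin_num. Qed.

Lemma ae_eq_int f g : measurable_fun D f -> measurable_fun D g ->
  {ae mu, forall x, D x -> f x = g x} -> I f = I g.
Proof.
move=> mf mg fg; congr fine; apply: ae_eq_integral => //.
- exact/measurable_EFinP.
- exact/measurable_EFinP.
- by apply: filterS fg => x fg Dx; rewrite fg.
Qed.

Lemma ae_int_ge0 f : L1 f -> {ae mu, forall x, D x -> 0 <= f x} -> 0 <= I f.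
Proof.
move=> lf f0; have mf : measurable_fun D f.
  by apply/measurable_EFinP; exact: (measurable_int _ lf).
rewrite (@ae_eq_int _ (fun x => `|f x|)) => //.
- by apply: int_ge0.
- exact: measurableT_comp.
- by apply: filterS f0 => x f0 Dx; rewrite ger0_norm// f0.
Qed.

Lemma int_eq0_ae f : L1 f -> (forall x, D x -> 0 <= f x) -> I f <= 0 ->
  {ae mu, forall x, D x -> f x = 0}.
Proof.
move=> lf f0 If.
have mf := measurable_int _ lf.
have : (\int[mu]_(x in D) `|(f x)%:E| = 0)%E.
  rewrite (_ : (\int[mu]_(x in D) `|(f x)%:E|)%E = (\int[mu]_(x in D) (f x)%:E)%E).
    rewrite int_EFin//; congr EFin; apply/eqP.
    by rewrite eq_le If int_ge0.
  by apply: eq_integral => x /set_mem Dx; rewrite /= ger0_norm// f0.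
move=> /(ae_eq_integral_abs mu mD mf); apply: filterS => x h Dx.
by have /= [] := h Dx.
Qed.

Lemma bounded_cvg (F : nat -> T -> R) f M :
  (forall n, measurable_fun D (F n)) -> measurable_fun D f ->
  (forall n x, D x -> `|F n x| <= M) ->
  {ae mu, forall x, D x -> F n x @[n --> \oo] --> f x} ->
  I (F n) @[n --> \oo] --> I f.
Proof.
move=> mF mf FM Ff.
have [] := @dominated_convergence _ _ _ mu D mD (fun n x => (F n x)%:E)
  (fun x => (f x)%:E) (fun=> M%:E).
- by move=> n; exact/measurable_EFinP.
- exact/measurable_EFinP.
- by apply: filterS Ff => x h Dx; apply: cvg_EFin; [exact: nearW|exact: h].
- by apply: bm_int (bm_cst _).
- by apply: aeW => x n Dx; rewrite lee_fin; exact: FM.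
move=> lf _ h; apply: fine_cvg; rewrite fineK// integrable_fin_num//.
Qed.

End BoundedMeasurable.

(** * Open sets and continuous functions are measurable *)

Section Borel.
Variables (R : realType) (n : nat).
Implicit Types (U : set 'cV[R]_3).

(** The distance to the complement is 1-Lipschitz and U is its positivity set. *)
Lemma open_measurable_H U : open U -> measurable (U : set (space3 R n)).
Proof.
(* With an empty complement the infimum would take its default value 0. *)
move=> oU; have [UT|UT] := pselect (U = setT).
  by rewrite UT; exact: measurableT.
have [c0 c0U] : exists c, ~ U c.
  by apply/existsNP => h; apply: UT; apply/seteqP; split.
pose S p := [set enorm (p - q) | q in ~` U].
have S0 p : S p !=set0 by exists (enorm (p - c0)), c0.
have Slb p : has_lbound (S p) by exists 0 => _ [q _ <-]; exact: enorm_ge0.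
pose F p := inf (S p).
have -> : U = [set p | 0 < F p].
  apply/seteqP; split=> [p Up|p /= Fp].
    have /nbhs_ballP[e /= e0 eU] : nbhs p U by exact: open_nbhs_nbhs.
    apply: (lt_le_trans e0); apply: lb_le_inf => // _ [q qU <-].
    rewrite leNgt; apply/negP => lte; apply: qU; apply: eU.
    rewrite mx_norm_ball /ball_ /=.
    by rewrite (le_lt_trans (norm_le_enorm _)).
  apply: contrapT => nUp; move: Fp; apply/negP; rewrite -leNgt.
  by apply: ge_inf => //; exists p => //; rewrite subrr enorm0.
apply: lipschitz_caratheodory => p q.
rewrite lerBlDr -lerBlDl; apply: lb_le_inf => // _ [c cU <-].
rewrite lerBlDl; apply: le_trans (enorm_dist p q c).
by apply: ge_inf => //; exists c.
Qed.

Lemma continuous_within_measurable_H (D : set 'cV[R]_3) (g : 'cV[R]_3 -> R) :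
  measurable (D : set (space3 R n)) -> {within D, continuous g} ->
  measurable_fun (D : set (space3 R n)) g.
Proof.
move=> mD /continuousP cg.
apply: (measurability _ (RGenOpens.measurableE R)) => //.
move=> _ [_ [a [b ->] <-]].
have /cg/open_subspaceP[V oV VD] : open `]a, b[%classic by exact: interval_open.
rewrite [X in measurable X]setIC -VD; apply: measurableI => //.
exact: open_measurable_H.
Qed.

Lemma continuous_measurable_H (D : set 'cV[R]_3) (g : 'cV[R]_3 -> R) :
  continuous g -> measurable_fun (D : set (space3 R n)) g.
Proof.
move=> cg; apply: measurable_funTS; apply: continuous_within_measurable_H.
  exact: measurableT.
exact: continuous_subspaceT.
Qed.

End Borel.

(** * Invariance under orthogonal matrices *)

Section Invariance.
Variables (R : realType) (n : nat).
Implicit Types (C X : set 'cV[R]_3) (A : 'M[R]_3).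
Local Open Scope ereal_scope.

Lemma lee_pexpn (a b : \bar R) (k : nat) : 0 <= a -> a <= b -> a ^+ k <= b ^+ k.
Proof.
move=> a0 ab; elim: k => [|k ih]; first by rewrite !expe0.
by rewrite !expeS lee_pmul// expe_ge0.
Qed.

Lemma diam_ge0 C : C !=set0 -> 0 <= diam C.
Proof.
move=> [x Cx]; apply: (le_trans _ (diam_ub Cx Cx)).
by rewrite lee_fin enorm_ge0.
Qed.

Lemma gauge_le C (d : R) : (0 <= d)%R -> diam C <= d%:E ->
  hausdorff_gauge n C <= (unit_ball_volume R n * (d / 2) ^+ n)%:E.
Proof.
move=> d0 Cd; rewrite /hausdorff_gauge; case: ifPn => [_|/set0P C0].
  by rewrite lee_fin mulr_ge0 ?unit_ball_volume_ge0// exprn_ge0// divr_ge0.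
rewrite EFinM lee_wpmul2l ?lee_fin ?unit_ball_volume_ge0// EFin_expe.
apply: lee_pexpn; first by rewrite mule_ge0 ?diam_ge0.
by rewrite EFinM lee_wpmul2r ?lee_fin.
Qed.

(** An inequality only, because phi need not be onto; for orthogonal matrices the reverse comes from
    the transpose. *)
Lemma gauge_preimage_le C (phi : 'cV[R]_3 -> 'cV[R]_3) :
  (forall x y, enorm (phi x - phi y) = enorm (x - y)) ->
  hausdorff_gauge n (phi @^-1` C) <= hausdorff_gauge n C.
Proof.
move=> iso; rewrite {1}/hausdorff_gauge; case: ifPn => [_|/set0P [x Cx]].
  exact: hausdorff_gauge_ge0.
rewrite /hausdorff_gauge ifF; last first.
  by apply/negbTE/set0P; exists (phi x).
rewrite lee_wpmul2l ?lee_fin ?unit_ball_volume_ge0//.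
apply: lee_pexpn; first by rewrite mule_ge0 ?diam_ge0//; exists x.
rewrite lee_wpmul2r ?lee_fin//.
apply: ge_ereal_sup => _ [y Cy [z Cz <-]].
by rewrite -iso; exact: diam_ub.
Qed.

Lemma hausdorff_preimage_le X (phi : 'cV[R]_3 -> 'cV[R]_3) :
  (forall x y, enorm (phi x - phi y) = enorm (x - y))%R ->
  hausdorff n (phi @^-1` X) <= hausdorff n X.
Proof.
move=> iso; apply: ge_ereal_sup => _ [d /= d0 <-].
apply: (le_trans _ (content_le_hausdorff _ _ d0)).
apply: le_ereal_inf_tmp => _ [C [Cd XC] <-].
apply: (@le_trans _ _ (\sum_(i <oo) hausdorff_gauge n (phi @^-1` (C i)))).
  apply: ereal_inf_lbound; exists (fun i => phi @^-1` (C i)) => //; split.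
    move=> i; apply: le_trans (Cd i).
    apply: ge_ereal_sup => _ [y Cy [z Cz <-]].
    by rewrite -iso; exact: diam_ub.
  by move=> x /XC [i _ Ci]; exists i.
apply: lee_nneseries => [i _ _|i _]; first exact: hausdorff_gauge_ge0.
exact: gauge_preimage_le.
Qed.

Lemma orth_isometry A : A^T *m A = 1%:M ->
  forall x y, (enorm (A *m x - A *m y) = enorm (x - y))%R.
Proof. by move=> A1 x y; rewrite -mulmxBr enorm_orth. Qed.

Lemma mulmx_orthK A (x : 'cV[R]_3) : A^T *m A = 1%:M -> A^T *m (A *m x) = x.
Proof. by move=> A1; rewrite mulmxA A1 mul1mx. Qed.

Lemma mulmx_orthVK A (x : 'cV[R]_3) : A^T *m A = 1%:M -> A *m (A^T *m x) = x.
Proof. by move=> A1; rewrite mulmxA orth_trmx// mul1mx. Qed.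

Lemma orthV A : A^T *m A = 1%:M -> A^T^T *m A^T = 1%:M.
Proof. by move=> A1; rewrite trmxK orth_trmx. Qed.

Lemma hausdorff_orth A X : A^T *m A = 1%:M ->
  hausdorff n (mulmx A @^-1` X) = hausdorff n X.
Proof.
move=> A1; apply/eqP; rewrite eq_le hausdorff_preimage_le ?andTb; last first.
  exact: orth_isometry.
have {1}-> : X = mulmx A^T @^-1` (mulmx A @^-1` X).
  by apply/seteqP; split=> x /=; rewrite mulmx_orthVK.
by apply: hausdorff_preimage_le; apply: orth_isometry; exact: orthV.
Qed.

(** Every test set of the Caratheodory condition is itself a preimage under A, so the condition
    transfers through [hausdorff_orth]. *)
Lemma measurable_orth A : A^T *m A = 1%:M ->
  measurable_fun (setT : set (space3 R n)) (mulmx A : space3 R n -> space3 R n).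
Proof.
move=> A1 _ Y mY; rewrite setTI.
apply: le_caratheodory_measurable => X.
have [X' ->] : exists X' : set 'cV[R]_3, X = mulmx A @^-1` X'.
  exists (mulmx A^T @^-1` X).
  by apply/seteqP; split=> x /=; rewrite mulmx_orthK.
have hE Z : hausdorff n (mulmx A @^-1` Z) = hausdorff n Z := hausdorff_orth Z A1.
change (hausdorff n (mulmx A @^-1` (X' `&` Y)) +
  hausdorff n (mulmx A @^-1` (X' `&` ~` Y)) <= hausdorff n (mulmx A @^-1` X')).
rewrite !hE.
have h : hausdorff n X' = hausdorff n (X' `&` Y) + hausdorff n (X' `&` ~` Y).
  exact: mY.
by rewrite [leRHS]h.
Qed.

Lemma ge0_integralT_orth A (f : 'cV[R]_3 -> \bar R) : A^T *m A = 1%:M ->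
  measurable_fun (setT : set (space3 R n)) (f : space3 R n -> _) ->
  (forall p, 0 <= f p) ->
  \int[Hmeas R n]_p f (A *m p) = \int[Hmeas R n]_p f p.
Proof.
move=> A1 mf f0.
have := @ge0_integral_pushforward _ _ _ _ R _ (measurable_orth A1) (Hmeas R n)
  setT f measurableT mf (fun p _ => f0 p).
have -> : mulmx A @^-1` (setT : set (space3 R n)) = setT by exact: preimage_setT.
move=> <-.
pose m1 : {measure set (space3 R n) -> \bar R} :=
  measure_function_pushforward__canonical__measure_function_Measure
    (Hmeas R n) (measurable_orth A1).
apply: (@eq_measure_integral _ (space3 R n) R setT (Hmeas R n) m1 f) => X mX _.
exact: (hausdorff_orth X A1).
Qed.

Lemma integralT_orth A (f : 'cV[R]_3 -> \bar R) : A^T *m A = 1%:M ->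
  measurable_fun (setT : set (space3 R n)) (f : space3 R n -> _) ->
  \int[Hmeas R n]_p f (A *m p) = \int[Hmeas R n]_p f p.
Proof.
move=> A1 mf; rewrite integralE [RHS]integralE.
have h (g : 'cV[R]_3 -> \bar R) :
    measurable_fun (setT : set (space3 R n)) (g : space3 R n -> _) ->
    (forall p, 0 <= g p) ->
    \int[Hmeas R n]_p g (A *m p) = \int[Hmeas R n]_p g p.
  by move=> *; exact: ge0_integralT_orth.
have e1 : \int[Hmeas R n]_p (fun p => f (A *m p))^\+ p =
    \int[Hmeas R n]_p f^\+ (A *m p).
  by apply: eq_integral => p _; rewrite !funeposE.
have e2 : \int[Hmeas R n]_p (fun p => f (A *m p))^\- p =
    \int[Hmeas R n]_p f^\- (A *m p).
  by apply: eq_integral => p _; rewrite !funenegE.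
by rewrite e1 e2 (h _ (measurable_funepos mf) (funepos_ge0 f))
  (h _ (measurable_funeneg mf) (funeneg_ge0 f)).
Qed.

Lemma integral_orth A (D : set (space3 R n)) (f : 'cV[R]_3 -> \bar R) :
  A^T *m A = 1%:M -> measurable D -> measurable_fun D (f : space3 R n -> _) ->
  \int[Hmeas R n]_(p in mulmx A @^-1` D) f (A *m p) =
  \int[Hmeas R n]_(p in D) f p.
Proof.
move=> A1 mD mf; rewrite integral_mkcond [RHS]integral_mkcond.
have mfD : measurable_fun (setT : set (space3 R n)) (f \_ D : space3 R n -> _).
  by have [h _] := measurable_restrictT (f : space3 R n -> \bar R) mD; exact: h.
rewrite -(integralT_orth A1 mfD).
by apply: eq_integral => p _; rewrite !patchE.
Qed.

Lemma Rintegral_orth A (D : set (space3 R n)) (f : 'cV[R]_3 -> R) :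
  A^T *m A = 1%:M -> measurable D -> measurable_fun D (f : space3 R n -> _) ->
  (\int[Hmeas R n]_(p in mulmx A @^-1` D) f (A *m p) =
   \int[Hmeas R n]_(p in D) f p)%R.
Proof.
move=> A1 mD mf; congr fine.
have h : measurable_fun D ((fun p => (f p)%:E) : space3 R n -> _).
  by apply/measurable_EFinP; exact: mf.
exact: (integral_orth A1 mD h).
Qed.

Lemma measurable_fun_orth d' (T' : measurableType d') A (D : set (space3 R n))
    (f : 'cV[R]_3 -> T') :
  A^T *m A = 1%:M -> measurable D -> mulmx A @^-1` D = D ->
  measurable_fun D (f : space3 R n -> _) ->
  measurable_fun D ((fun p => f (A *m p)) : space3 R n -> _).
Proof.
move=> A1 mD AD mf; apply: (@measurable_comp _ _ _ _ _ _ D) => //.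
  by move=> _ [p Dp <-]; move: Dp; rewrite -{1}AD.
exact: measurable_funTS (measurable_orth A1).
Qed.

Lemma ae_orth A (P : 'cV[R]_3 -> Prop) : A^T *m A = 1%:M ->
  {ae Hmeas R n, forall p, P p} -> {ae Hmeas R n, forall p, P (A *m p)}.
Proof.
move=> A1 [N [mN N0 PN]]; exists (mulmx A @^-1` N); split.
- by rewrite -[X in measurable X]setTI; exact: measurable_orth.
- by rewrite -N0; exact: hausdorff_orth.
- by move=> p /= nP; exact: PN.
Qed.

End Invariance.

(** * The sphere and its great circles *)

Section Covers.
Variables (R : realType) (n : nat).
Implicit Types (X : set 'cV[R]_3).

Lemma content_cover_le (J : finType) (C : J -> set 'cV[R]_3) X (delta d : R) :
  0 <= d -> d <= delta -> (forall j, (diam (C j) <= d%:E)%E) ->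
  X `<=` \bigcup_j C j ->
  (hausdorff_content n delta X <=
    (#|J|%:R * (unit_ball_volume R n * (d / 2) ^+ n))%:E)%E.
Proof.
move=> d0 dd Cd XC.
(* The finite family is padded with empty sets, whose gauge is 0 by convention. *)
pose C' i := if insub i : option 'I_#|J| is Some o then C (enum_val o) else set0.
have C'd i : (diam (C' i) <= d%:E)%E.
  by rewrite /C'; case: insub => // ; rewrite diam0 leNye.
apply: (@le_trans _ _ (\sum_(i <oo) hausdorff_gauge n (C' i))%E).
  apply: ereal_inf_lbound; exists C' => //; split => [i|x /XC[j _ Cj]].
    by rewrite (le_trans (C'd i))// lee_fin.
  exists (enum_rank j) => //; rewrite /C' (_ : insub _ = Some (enum_rank j)).
    by rewrite enum_rankK.
  exact: valK.
rewrite (nneseries_split _ #|J|); last by move=> i _; exact: hausdorff_gauge_ge0.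
rewrite add0n [X in (_ + X)%E]eseries0 ?adde0; last first.
  by move=> i Ji _; rewrite /C' insubF ?hausdorff_gauge0// ltnNge Ji.
rewrite big_mkord.
apply: (@le_trans _ _ (\sum_(i < #|J|)
  (unit_ball_volume R n * (d / 2) ^+ n)%:E)%E).
  by apply: lee_sum => i _; exact: gauge_le.
by rewrite sumEFin sumr_const card_ord mulr_natl.
Qed.

Lemma hausdorff_cover_le X (c : R) :
  (forall delta, 0 < delta -> (hausdorff_content n delta X <= c%:E)%E) ->
  (hausdorff n X <= c%:E)%E.
Proof. by move=> h; apply: ge_ereal_sup => _ [d /= d0 <-]; exact: h. Qed.

End Covers.

(** * Trigonometric estimates and subdivisions of an interval *)

Section Trigo.
Variable R : realType.
Implicit Types (a b x y : R).

(** Mean value theorem: sin x = x cos c with c <= x, and the cosine decreases on [0, pi]. *)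
Lemma sin_ge_mulcos x : 0 <= x -> x <= pi -> x * cos x <= sin x.
Proof.
move=> x0 xpi.
have [|c] := @MVT_segment R sin cos 0 x x0 (fun y _ => is_derive_sin y).
  by apply: continuous_subspaceT => y; exact: continuous_sin.
rewrite in_itv /= => /andP[c0 cx]; rewrite sin0 !subr0 => ->.
rewrite mulrC ler_wpM2r//.
move: cx; rewrite le_eqVlt => /predU1P[->//|cx].
by apply/ltW; rewrite ltr_cos ?in_itv/= ?c0 ?x0 ?xpi// (le_trans (ltW cx)).
Qed.

Lemma norm_sin_le x : `|sin x| <= `|x|.
Proof.
wlog x0 : x / 0 <= x.
  move=> h; have [/h//|/ltW x0] := leP 0 x.
  by rewrite -normrN -sinN -(normrN x); apply: h; rewrite oppr_ge0.
have [|c] := @MVT_segment R sin cos 0 x x0 (fun y _ => is_derive_sin y).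
  by apply: continuous_subspaceT => y; exact: continuous_sin.
move=> _; rewrite sin0 !subr0 => ->; rewrite normrM ler_piMl//.
exact: cos_max.
Qed.

Lemma chord_sqr a b : (cos a - cos b) ^+ 2 + (sin a - sin b) ^+ 2 =
  (2 * sin ((a - b) / 2)) ^+ 2.
Proof.
have -> : (cos a - cos b) ^+ 2 + (sin a - sin b) ^+ 2 = 2 - 2 * cos (a - b).
  rewrite cosB.
  have h1 := cos2Dsin2 a; have h2 := cos2Dsin2 b.
  lra.
have {1}-> : a - b = ((a - b) / 2) *+ 2 by rewrite -mulr_natr; field.
rewrite cos_mulr2n exprMn sin2cos2; ring.
Qed.

Lemma circle_angle x y : x ^+ 2 + y ^+ 2 = 1 ->
  exists2 t, 0 <= t <= 2 * pi & x = cos t /\ y = sin t.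
Proof.
move=> xy1.
have x1 : -1 <= x <= 1.
  by have := sqr_ge0 y; move=> y0; apply/andP; split; nra.
have pi0 := @pi_ge0 R.
have a0 := acos_ge0 x1; have api := acos_lepi x1.
have ca : cos (acos x) = x by apply: acosK; rewrite in_itv.
have sa : sin (acos x) = `|y|.
  by rewrite sin_acos// -[1]xy1 addrAC subrr add0r sqrtr_sqr.
have [y0|y0] := leP 0 y.
  exists (acos x); first by apply/andP; split; lra.
  by rewrite ca sa ger0_norm.
exists (- acos x + pi *+ 2).
  by rewrite mulr2n; apply/andP; split; lra.
by rewrite cosD2pi sinD2pi cosN sinN ca sa ltr0_norm// opprK.
Qed.

Lemma grid_cell (L x : R) N : 0 < L -> 0 <= x <= L ->
  exists i : 'I_N.+1, i%:R * (L / N.+1%:R) <= x <= i.+1%:R * (L / N.+1%:R).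
Proof.
move=> L0 /andP[x0 xL]; set h := L / _.
have h0 : 0 < h by rewrite divr_gt0.
have xh0 : 0 <= x / h by rewrite divr_ge0// ltW.
(* At x = L the integer part is N + 1, one too many; the last cell is closed and contains L. *)
have [xL'|xL'] := ltP x L; last first.
  exists ord_max => /=; have -> : x = L by apply/eqP; rewrite eq_le xL.
  have Lh : L = N.+1%:R * h by rewrite /h mulrC divfK.
  by rewrite Lh lexx andbT ler_pM2r// ler_nat.
have tx : (Num.truncn (x / h))%:R <= x / h by rewrite truncn_le.
have tl : (Num.truncn (x / h) < N.+1)%N.
  rewrite -(@ltr_nat R) (le_lt_trans tx)//.
  by rewrite ltr_pdivrMr// /h mulrC divfK.
exists (Ordinal tl) => /=.
rewrite -ler_pdivlMr// tx /= -ler_pdivrMr//.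
by rewrite ltW// truncnS_gt.
Qed.

End Trigo.

(** * Finite area of the sphere and nullity of its parallels *)

Section SphereMeasure.
Variable R : realType.
Implicit Types (p q u v : 'cV[R]_3).
Local Open Scope ring_scope.

Lemma coord_measurable n (D : set (space3 R n)) i :
  measurable_fun D ((fun p => p i 0) : space3 R n -> R).
Proof. by apply: continuous_measurable_H => p; exact: coord_continuous. Qed.

Lemma dot_measurable n (D : set (space3 R n)) v :
  measurable_fun D ((fun p => dot v p) : space3 R n -> R).
Proof.
under [X in measurable_fun _ X]funext do rewrite dotE.
have h i : measurable_fun D ((fun p => v i 0 * p i 0) : space3 R n -> R).
  by apply: measurable_funM; [exact: measurable_cst|exact: coord_measurable].
apply: (measurable_funD (measurable_funD (h 0) (h 1)) (h 2)).
Qed.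

Lemma measurable_sphere n : measurable (sphere R : set (space3 R n)).
Proof.
have m : measurable_fun [set: space3 R n]
    ((fun p => p 0 0 ^+ 2 + p 1 0 ^+ 2 + p 2 0 ^+ 2) : space3 R n -> R).
  have h i : measurable_fun [set: space3 R n]
      ((fun p => p i 0 ^+ 2) : space3 R n -> R).
    by apply: measurable_funX; exact: coord_measurable.
  exact: (measurable_funD (measurable_funD (h 0) (h 1)) (h 2)).
have := m measurableT _ (measurable_set1 (1 : R)); rewrite setTI.
by congr measurable; apply/seteqP; split=> p /= /sphereP.
Qed.

Lemma measurable_great_circle n v :
  measurable (great_circle v : set (space3 R n)).
Proof.
apply: measurableI; first exact: measurable_sphere.
have := @dot_measurable n setT v measurableT _ (measurable_set1 (0 : R)).
by rewrite setTI.
Qed.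

Definition circ t : 'cV[R]_3 := col3 (cos t) (sin t) 0.
Definition latitude_circle (z t : R) : 'cV[R]_3 :=
  col3 (Num.sqrt (1 - z ^+ 2) * cos t) (Num.sqrt (1 - z ^+ 2) * sin t) z.
Definition spherical (a t : R) : 'cV[R]_3 :=
  col3 (cos a * cos t) (cos a * sin t) (sin a).
Definition e3 : 'cV[R]_3 := col3 0 0 1.

Lemma dot_e3 p : dot e3 p = p 2 0.
Proof. by rewrite dotE !col3E !mul0r mul1r !add0r. Qed.

Lemma sphere_e3 : sphere R e3.
Proof. by apply/sphereP; rewrite !col3E; ring. Qed.

Lemma chord_sqr_le (t s : R) :
  (cos t - cos s) ^+ 2 + (sin t - sin s) ^+ 2 <= (t - s) ^+ 2.
Proof.
rewrite chord_sqr exprMn.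
have h : sin ((t - s) / 2) ^+ 2 <= ((t - s) / 2) ^+ 2.
  rewrite -(real_normK (num_real (sin _))) -(real_normK (num_real (_ / 2))).
  by rewrite ler_pXn2r ?nnegrE// norm_sin_le.
apply: (@le_trans _ _ (2 ^+ 2 * ((t - s) / 2) ^+ 2)).
  by rewrite ler_pM2l// exprn_gt0.
by rewrite le_eqVlt; apply/orP; left; apply/eqP; field.
Qed.

Lemma chord_scaled (r a t s : R) : 0 <= r -> r <= 1 ->
  enorm (col3 (r * cos t) (r * sin t) a - col3 (r * cos s) (r * sin s) a) <=
  `|t - s|.
Proof.
move=> r0 r1; rewrite -(@ler_pXn2r _ 2) ?nnegrE ?enorm_ge0//.
rewrite sqr_enorm dotE !colBE !col3E subrr mulr0 addr0 real_normK ?num_real//.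
have -> : (r * cos t - r * cos s) * (r * cos t - r * cos s) +
  (r * sin t - r * sin s) * (r * sin t - r * sin s) =
  r ^+ 2 * ((cos t - cos s) ^+ 2 + (sin t - sin s) ^+ 2) by ring.
apply: le_trans (chord_sqr_le t s).
by rewrite ler_piMl ?addr_ge0 ?sqr_ge0// expr_le1.
Qed.

Lemma spherical_lip (a b t s : R) :
  enorm (spherical a t - spherical b s) <= `|a - b| + `|t - s|.
Proof.
apply: (le_trans (enorm_dist _ (spherical b t) _)); rewrite lerD//.
  rewrite -(@ler_pXn2r _ 2) ?nnegrE ?enorm_ge0//.
  rewrite sqr_enorm dotE !colBE !col3E real_normK ?num_real//.
  have -> : (cos a * cos t - cos b * cos t) * (cos a * cos t - cos b * cos t) +
    (cos a * sin t - cos b * sin t) * (cos a * sin t - cos b * sin t) +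
    (sin a - sin b) * (sin a - sin b) =
    (cos a - cos b) ^+ 2 * (cos t ^+ 2 + sin t ^+ 2) + (sin a - sin b) ^+ 2 by ring.
  by rewrite cos2Dsin2 mulr1 chord_sqr_le.
rewrite -(@ler_pXn2r _ 2) ?nnegrE ?enorm_ge0//.
rewrite sqr_enorm dotE !colBE !col3E subrr mulr0 addr0 real_normK ?num_real//.
have -> : (cos b * cos t - cos b * cos s) * (cos b * cos t - cos b * cos s) +
    (cos b * sin t - cos b * sin s) * (cos b * sin t - cos b * sin s) =
    cos b ^+ 2 * ((cos t - cos s) ^+ 2 + (sin t - sin s) ^+ 2) by ring.
apply: le_trans (chord_sqr_le t s).
by rewrite ler_piMl ?addr_ge0 ?sqr_ge0// -(cos2Dsin2 b) lerDl.
Qed.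

(** The latitude also ranges over [0, 2 pi], so that [circle_angle] yields both angles; covering
    points twice is harmless for covers and for compactness. *)
Lemma spherical_surj p : sphere R p -> exists a t,
  [/\ 0 <= a <= 2 * pi, 0 <= t <= 2 * pi & p = spherical a t].
Proof.
move=> /sphereP p1.
pose r := Num.sqrt (p 0 0 ^+ 2 + p 1 0 ^+ 2).
have r2 : r ^+ 2 = p 0 0 ^+ 2 + p 1 0 ^+ 2.
  by rewrite sqr_sqrtr// addr_ge0 ?sqr_ge0.
have [|a a2 [ra za]] := @circle_angle R r (p 2 0); first by rewrite r2.
(* At the poles the longitude is arbitrary. *)
have [r0|r0] := eqVneq r 0.
  move: r2; rewrite r0 expr0n => /esym/eqP.
  rewrite paddr_eq0 ?sqr_ge0// !sqrf_eq0 => /andP[/eqP p0 /eqP p1'].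
  exists a, 0; split=> //; first by rewrite lexx mulr_ge0 ?pi_ge0.
  by rewrite [LHS]col3_eta p0 p1' za /spherical -ra r0 !mul0r.
have [|t t2 [xt yt]] := @circle_angle R (p 0 0 / r) (p 1 0 / r).
  by rewrite !exprMn -mulrDl -r2 -exprMn divff// expr1n.
exists a, t; split=> //.
by rewrite [LHS]col3_eta za /spherical -ra -xt -yt !mulrA ![r * _]mulrC !mulfK.
Qed.

Lemma latitude_surj p : sphere R p -> exists2 t, 0 <= t <= 2 * pi &
  p = latitude_circle (p 2 0) t.
Proof.
move=> /sphereP p1.
pose r := Num.sqrt (1 - p 2 0 ^+ 2).
have r2 : r ^+ 2 = p 0 0 ^+ 2 + p 1 0 ^+ 2.
  by rewrite sqr_sqrtr -p1 ?addrK// addr_ge0 ?sqr_ge0.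
have [r0|r0] := eqVneq r 0.
  move: r2; rewrite r0 expr0n => /esym/eqP.
  rewrite paddr_eq0 ?sqr_ge0// !sqrf_eq0 => /andP[/eqP p0 /eqP p1'].
  exists 0; first by rewrite lexx mulr_ge0 ?pi_ge0.
  by rewrite [LHS]col3_eta /latitude_circle -/r r0 !mul0r p0 p1'.
have [|t t2 [xt yt]] := @circle_angle R (p 0 0 / r) (p 1 0 / r).
  by rewrite !exprMn -mulrDl -r2 -exprMn divff// expr1n.
exists t => //.
by rewrite [LHS]col3_eta /latitude_circle -/r -xt -yt !mulrA ![r * _]mulrC !mulfK.
Qed.

Lemma pi2_gt0 : 0 < 2 * pi :> R. Proof. by rewrite mulr_gt0 ?pi_gt0. Qed.

Lemma cell_dist (L x y : R) N (i : 'I_N.+1) :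
  i%:R * (L / N.+1%:R) <= x <= i.+1%:R * (L / N.+1%:R) ->
  i%:R * (L / N.+1%:R) <= y <= i.+1%:R * (L / N.+1%:R) ->
  `|x - y| <= L / N.+1%:R.
Proof.
rewrite -(natr1 i) mulrDl mul1r; move: (L / _) => h; move: (_ * h) => k.
move=> /andP[x1 x2] /andP[y1 y2].
by rewrite ler_norml; apply/andP; split; lra.
Qed.

Definition cell N (i : 'I_N.+1) : set R :=
  [set t | i%:R * (2 * pi / N.+1%:R) <= t <= i.+1%:R * (2 * pi / N.+1%:R)].

Lemma mesh_le (delta : R) : 0 < delta -> exists N0, forall N, (N0 <= N)%N ->
  2 * pi / N.+1%:R <= delta.
Proof.
move=> d0; exists (Num.bound (2 * pi / delta)) => N N0.
rewrite ler_pdivrMr// [leRHS]mulrC -ler_pdivrMr//.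
have b0 : 0 <= 2 * pi / delta by rewrite divr_ge0 ?ltW ?pi2_gt0.
apply: (le_trans (ltW (archi_boundP b0))).
by rewrite ler_nat (leq_trans N0).
Qed.

Definition parallel (z : R) : set 'cV[R]_3 :=
  [set p | sphere R p /\ p 2 0 = z].

(** The parallel is cut into N + 1 arcs; bounding its radius by 1 makes the estimate independent of
    z. *)
Lemma content_latitude n (z delta : R) N : 2 * pi / N.+1%:R <= delta ->
  (hausdorff_content n delta (parallel z) <=
  (N.+1%:R * (unit_ball_volume R n * (2 * pi / N.+1%:R / 2) ^+ n))%:E)%E.
Proof.
move=> Nd.
have := @content_cover_le R n 'I_N.+1
  (fun i => (latitude_circle z @` cell i)) (parallel z)
  delta (2 * pi / N.+1%:R).
rewrite card_ord; apply => //; first by rewrite divr_ge0 ?ltW ?pi2_gt0.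
  move=> i; apply: diam_le => _ _ [t ti <-] [s si <-].
  apply: le_trans (chord_scaled _ _ _ _ _) (cell_dist ti si) => //.
  by rewrite -[leRHS]sqrtr1 ler_sqrt ?ltr01// gerBl sqr_ge0.
move=> p [/latitude_surj [t t2 pE] <-].
have [i it] := grid_cell N pi2_gt0 t2.
by exists i => //; exists t.
Qed.

Lemma hausdorff2_latitude (z : R) :
  hausdorff 2 (parallel z) = 0%E.
Proof.
apply/eqP; rewrite eq_le hausdorff_ge0 andbT.
apply/lee_addgt0Pr => eps eps0; rewrite add0e.
apply: hausdorff_cover_le => delta d0.
(* For the mesh h = 2 pi / (N + 1) the bound of [content_latitude] equals h pi^2 / 2, which tends to
   0. *)
have pp : 0 < pi * (pi / 2) :> R by rewrite mulr_gt0 ?divr_gt0 ?pi_gt0.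
have [N1 hN1] := mesh_le d0; have [N2 hN2] := mesh_le (divr_gt0 eps0 pp).
pose N := maxn N1 N2.
apply: (le_trans (content_latitude 2 z (hN1 N (leq_maxl _ _)))).
rewrite lee_fin [unit_ball_volume _ _]/=.
have := hN2 N (leq_maxr _ _); rewrite ler_pdivlMr//.
apply: le_trans; rewrite le_eqVlt; apply/orP; left; apply/eqP.
have : N.+1%:R != 0 :> R by [].
by move=> ?; field.
Qed.

Lemma hausdorff2_sphere : (hausdorff 2 (sphere R) < +oo)%E.
Proof.
(* With mesh h there are (N + 1)^2 patches of diameter at most 2 h, each of gauge pi h^2; the
   product does not depend on N. *)
pose c : R := (2 * pi / 2 * 1 * (2 * pi) ^+ 2).
apply: (@le_lt_trans _ _ c%:E); last by rewrite ltry.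
apply: hausdorff_cover_le => delta d0.
have [N hN] := mesh_le (divr_gt0 d0 (ltr0n R 2)).
have h0 : 0 <= 2 * pi / N.+1%:R :> R by rewrite divr_ge0 ?ltW ?pi2_gt0.
have := @content_cover_le R 2 ('I_N.+1 * 'I_N.+1)%type
  (fun ij => [set spherical a t | a in cell ij.1 & t in cell ij.2]) (sphere R)
  delta (2 * (2 * pi / N.+1%:R)).
move=> /(_ _ _ _ _)/le_trans; apply.
- by rewrite mulr_ge0.
- by have := hN N (leqnn _); move: (2 * pi / _) => h; lra.
- move=> [i j]; apply: diam_le => _ _ [a ai [t tj <-]] [b bi [s sj <-]].
  apply: (le_trans (spherical_lip _ _ _ _)); rewrite mulr2n mulrDl mul1r.
  by rewrite lerD// (cell_dist ai bi, cell_dist tj sj).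
- move=> p /spherical_surj[a [t [a2 t2 ->]]].
  have [i ia] := grid_cell N pi2_gt0 a2.
  have [j jt] := grid_cell N pi2_gt0 t2.
  by exists (i, j) => //; exists a => //; exists t.
rewrite lee_fin card_prod card_ord [unit_ball_volume _ _]/= natrM.
rewrite le_eqVlt; apply/orP; left; apply/eqP; rewrite /c.
have : N.+1%:R != 0 :> R by [].
by move=> ?; field.
Qed.

End SphereMeasure.

(** * Length of a great circle *)

Section Circle.
Variable R : realType.
Local Open Scope ring_scope.

Lemma sin_ge_near (k : R) : k < 1 ->
  exists2 r, 0 < r < pi / 2 & forall x, 0 <= x <= r -> k * x <= sin x.
Proof.
move=> k1.
have : \forall x \near (0 : R), k < cos x.
  by apply: (@cvgr_gt _ _ _ _ cos (cos 0) (@continuous_cos R 0)); rewrite cos0.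
move=> /nbhs_ballP[e /= e0 eP].
have p0 := @pi_gt0 R.
exists (Num.min (e / 2) (pi / 4)).
  rewrite lt_min !divr_gt0//= gt_min; apply/orP; right; lra.
move=> x /andP[x0]; rewrite le_min => /andP[xe xp].
apply: (@le_trans _ _ (x * cos x)).
  rewrite mulrC ler_wpM2l// ltW//; apply: eP.
  by rewrite /ball /= sub0r normrN ger0_norm//; lra.
by apply: sin_ge_mulcos => //; lra.
Qed.

Lemma enorm_circ (a b : R) :
  enorm (circ a - circ b) = 2 * `|sin ((a - b) / 2)|.
Proof.
apply/eqP; rewrite -(@eqrXn2 _ 2) ?enorm_ge0 ?mulr_ge0//.
rewrite sqr_enorm dotE !colBE !col3E subrr mulr0 addr0 -!expr2 chord_sqr.
by rewrite !exprMn real_normK// num_real.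
Qed.

(** At small scales a chord is almost as long as its arc. On a half circle the half-angle stays in
    [0, pi / 2[, where the sine increases, so a short chord forces a short arc; on the whole circle
    this fails near the angles 0 and 2 pi. *)
Lemma circ_expansive (k : R) : 0 < k < 1 -> exists2 delta, 0 < delta &
  forall a b, 0 <= a < pi -> 0 <= b < pi ->
  enorm (circ a - circ b) <= delta -> k * `|a - b| <= enorm (circ a - circ b).
Proof.
move=> /andP[k0 k1]; have [r /andP[r0 rpi] kr] := sin_ge_near k1.
have sr : 0 < sin r by rewrite sin_gt0_pihalf// r0.
exists (sin r) => //.
have key a b : 0 <= a < pi -> 0 <= b < pi -> b <= a ->
  enorm (circ a - circ b) <= sin r -> k * `|a - b| <= enorm (circ a - circ b).
  move=> /andP[a0 api] /andP[b0 bpi] ba; rewrite enorm_circ.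
  set x := (a - b) / 2.
  have x0 : 0 <= x by rewrite divr_ge0// subr_ge0.
  have xpi : x < pi / 2 by rewrite /x; lra.
  have sx : 0 <= sin x by rewrite sin_ge0_pi// x0/=; lra.
  rewrite (ger0_norm sx) => sxr.
  have xr : x < r.
    rewrite ltNge; apply/negP => rx.
    have : sin r <= sin x.
      move: rx; rewrite le_eqVlt => /predU1P[->//|rx].
      by apply/ltW; rewrite ltr_sin// in_itv/=; apply/andP; split; lra.
    by lra.
  rewrite ger0_norm ?subr_ge0//.
  have := kr x; rewrite x0 (ltW xr) => /(_ isT).
  have -> : a - b = 2 * x by rewrite /x; field.
  by lra.
move=> a b aI bI; have [ba|/ltW ab] := leP b a; first exact: key.
by rewrite enormC distrC; exact: key.
Qed.

Definition half_circle : set 'cV[R]_3 := @circ R @` [set t | 0 <= t < pi].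

(** By [circ_expansive], the angles whose points lie in a small set C fit in an interval of length
    diam C / k. The Lebesgue measure of [0, pi[ then bounds the total diameter of any cover from
    below. *)
Lemma content_half_circle (k : R) : 0 < k < 1 -> exists2 delta, 0 < delta &
  ((k * pi)%:E <= hausdorff_content 1 delta half_circle)%E.
Proof.
move=> k01; have [k0 _] := andP k01.
have [delta d0 dP] := circ_expansive k01.
exists delta => //; apply: le_ereal_inf_tmp => _ [C [Cd HC] <-].
have /choice[J hJ] : forall i, exists J : set R, [/\ measurable J,
    (forall t, 0 <= t < pi -> C i (circ t) -> J t) &
    (k%:E * lebesgue_measure J <= hausdorff_gauge 1 (C i))%E].
  move=> i.
  have [[t0 [t0I Ct0]]|no] := pselect (exists t, 0 <= t < pi /\ C i (circ t));
      last first.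
    exists set0; split; first exact: measurable0.
      by move=> t tI Ct; apply: no; exists t.
    by rewrite measure0 mule0 hausdorff_gauge_ge0.
  have C0 : C i !=set0 by exists (circ t0).
  pose d := fine (diam (C i)).
  have dE : diam (C i) = d%:E.
    rewrite /d fineK// ge0_fin_numE ?diam_ge0//.
    by rewrite (le_lt_trans (Cd i))// ltry.
  pose T := [set t | 0 <= t < pi /\ C i (circ t)].
  have Tk s t : T s -> T t -> s - t <= d / k.
    move=> [sI Cs] [tI Ct]; rewrite ler_pdivlMr// mulrC.
    have h1 : enorm (circ s - circ t) <= d.
      by rewrite -lee_fin -dE; exact: diam_ub.
    have h2 : d <= delta by rewrite -lee_fin -dE.
    apply: (le_trans _ h1); apply: (le_trans _ (dP _ _ sI tI (le_trans h1 h2))).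
    by rewrite ler_pM2l// ler_norm.
  have Tlb : has_lbound T by exists 0 => t [/andP[]].
  have T0 : T !=set0 by exists t0.
  exists `[inf T, inf T + d / k]%classic; split; first exact: measurable_itv.
    move=> t tI Ct; rewrite /= in_itv /=; apply/andP; split.
      by apply: ge_inf.
    rewrite -lerBlDr; apply: lb_le_inf => // s Ts.
    by rewrite lerBlDr addrC -lerBlDr; apply: Tk.
  have d0' : 0 <= d by rewrite -lee_fin -dE diam_ge0.
  (* The unit ball of R has volume 2, so the gauge of C i is its diameter d. *)
  rewrite /hausdorff_gauge ifF; last by apply/negbTE/set0P.
  rewrite lebesgue_measure_itv /= lte_fin.
  rewrite dE -!EFinM /=.
  case: ifP => _; last by rewrite mule0 lee_fin; lra.
  rewrite -EFinD -EFinM lee_fin addrAC subrr add0r mulrC divfK ?gt_eqF//.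
  by rewrite mulrCA divff// mulr1.
have mJ i : measurable (J i) by case: (hJ i).
have : (lebesgue_measure (`[0%R, pi[%classic : set R) <=
    \sum_(i <oo) lebesgue_measure (J i))%E.
  apply: (measure_sigma_subadditive lebesgue_measure mJ (measurable_itv _)).
  move=> t; rewrite /= in_itv /= => tI.
  have [i _ Ci] : (\bigcup_i C i) (circ t) by apply: HC; exists t.
  by exists i => //; case: (hJ i) => _ + _; apply.
rewrite lebesgue_measure_itv /= lte_fin pi_gt0 -EFinD subr0 => piJ.
rewrite EFinM.
apply: (@le_trans _ _ (k%:E * \sum_(i <oo) lebesgue_measure (J i))%E).
  by rewrite lee_wpmul2l// lee_fin ltW.
rewrite -nneseriesZl//.
apply: lee_nneseries => [i _ _|i _]; last by case: (hJ i).
by rewrite mule_ge0// lee_fin ltW.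
Qed.

Lemma hausdorff_half_circle : (pi%:E <= hausdorff 1 half_circle)%E.
Proof.
have fin : (hausdorff 1 half_circle <= (2 * pi)%:E)%E.
  apply: (@le_trans _ _ (hausdorff 1 (parallel (0 : R)))).
    apply: le_hausdorff => _ [t _ <-]; split; last by rewrite col3E.
    by apply/sphereP; rewrite !col3E -[RHS](cos2Dsin2 t); ring.
  apply: hausdorff_cover_le => delta d0.
  have [N hN] := mesh_le d0.
  apply: (le_trans (content_latitude 1 0 (hN N (leqnn _)))).
  rewrite lee_fin [unit_ball_volume _ _]/= expr1.
  rewrite le_eqVlt; apply/orP; left; apply/eqP.
  have : N.+1%:R != 0 :> R by [].
  by move=> ?; field.
rewrite -[leRHS]fineK; last first.
  by rewrite ge0_fin_numE ?hausdorff_ge0// (le_lt_trans fin)// ltry.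
rewrite lee_fin; set m := fine _.
have mE : hausdorff 1 half_circle = m%:E.
  by rewrite /m fineK// ge0_fin_numE ?hausdorff_ge0// (le_lt_trans fin)// ltry.
have p0 := @pi_gt0 R.
have km k : 0 < k < 1 -> k * pi <= m.
  move=> /content_half_circle[delta d0 h].
  by rewrite -lee_fin -mE (le_trans h)// content_le_hausdorff.
rewrite leNgt; apply/negP => mp.
have m0 : 0 <= m by rewrite -lee_fin -mE hausdorff_ge0.
(* A factor strictly between m / pi and 1 contradicts [km]. *)
have := km ((m / pi + 1) / 2).
have mp1 : m / pi < 1 by rewrite ltr_pdivrMr// mul1r.
have mp0 : 0 <= m / pi by rewrite divr_ge0// ltW.
have -> : 0 < (m / pi + 1) / 2 < 1 by apply/andP; split; lra.
move=> /(_ isT).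
have -> : (m / pi + 1) / 2 * pi = (m + pi) / 2.
  by rewrite mulrAC mulrDl mul1r divfK// gt_eqF.
by lra.
Qed.

Lemma great_circle_e3 : great_circle (e3 R) = parallel (0 : R).
Proof. by apply/seteqP; split=> p [p1 p2]; split=> //; move: p2; rewrite dot_e3. Qed.

(** The upper bound counts arcs. For the lower one, a measurable set splits the circle into a half
    circle and its antipodal image, each of length at least pi. *)
Lemma hausdorff_great_circle :
  hausdorff 1 (great_circle (e3 R)) = (2 * pi)%:E.
Proof.
rewrite great_circle_e3; apply/eqP; rewrite eq_le; apply/andP; split.
  apply: hausdorff_cover_le => delta d0.
  have [N hN] := mesh_le d0.
  apply: (le_trans (content_latitude 1 0 (hN N (leqnn _)))).
  rewrite lee_fin [unit_ball_volume _ _]/= expr1.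
  rewrite le_eqVlt; apply/orP; left; apply/eqP.
  have : N.+1%:R != 0 :> R by [].
  by move=> ?; field.
(* The boundary line y = 0 is split by the sign of x, so that exactly one of p and - p lies in H
   when p is on the equator. *)
pose H : set 'cV[R]_3 := [set p | 0 < p 1 0] `|`
  ([set p | p 1 0 = 0] `&` [set p | 0 < p 0 0]).
have mH : (@hausdorff R 3 1).-caratheodory H.
  change (measurable (H : set (space3 R 1))).
  have mpos i : measurable ([set p | 0 < p i 0] : set (space3 R 1)).
    have := @coord_measurable R 1 setT i measurableT _ (measurable_itv `]0, +oo[).
    rewrite setTI; congr measurable.
    by apply/seteqP; split=> p /=; rewrite in_itv /= andbT.
  apply: measurableU => //; apply: measurableI => //.
  have := @coord_measurable R 1 setT 1 measurableT _ (measurable_set1 (0 : R)).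
  by rewrite setTI.
have circP t : parallel 0 (circ t : 'cV[R]_3).
  split; last by rewrite col3E.
  by apply/sphereP; rewrite !col3E -[RHS](cos2Dsin2 t); ring.
have half_H : half_circle `<=` parallel 0 `&` H.
  move=> _ [t /= /andP[t0 tpi] <-]; split; first exact: circP.
  rewrite /H /= !col3E; move: t0; rewrite le_eqVlt => /predU1P[<-|t0].
    by right; rewrite sin0 cos0.
  by left; rewrite sin_gt0_pi// t0.
pose A : 'M[R]_3 := (-1)%:M.
have A1 : A^T *m A = 1%:M.
  by rewrite tr_scalar_mx -scalar_mxM mulrNN mulr1.
have AE p : A *m p = - p by rewrite mul_scalar_mx scaleN1r.
have -> : hausdorff 1 (parallel (0 : R)) =
  (hausdorff 1 (parallel (0 : R) `&` H) +
   hausdorff 1 (parallel (0 : R) `&` ~` H))%E by exact: mH.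
rewrite mulr2n mulrDl mul1r EFinD; apply: leeD.
  by apply: (le_trans hausdorff_half_circle); exact: le_hausdorff.
apply: (le_trans hausdorff_half_circle).
rewrite -(hausdorff_orth 1 half_circle A1); apply: le_hausdorff => p.
rewrite /= AE => /half_H [[p1 p2]].
rewrite /H /= => pH; split; first split.
- by apply/sphereP; move/sphereP: p1; rewrite !mxE !sqrrN.
- by apply/eqP; move/eqP: p2; rewrite mxE oppr_eq0.
- rewrite !mxE in pH; move=> [p10|[p10 p00]]; case: pH.
  + by rewrite oppr_gt0 => /(lt_trans p10); rewrite ltxx.
  + by move=> [/eqP]; rewrite oppr_eq0 => /eqP p1e; move: p10; rewrite p1e ltxx.
  + by rewrite p10 oppr0 ltxx.
  + by move=> [_]; rewrite oppr_gt0 => /(lt_trans p00); rewrite ltxx.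
Qed.

End Circle.

(** * Relatively open pieces of the sphere have positive area *)

Section Positivity.
Variable R : realType.
Local Open Scope ring_scope.
Local Notation leb := (@lebesgue_measure R).

Lemma square_measure (a b r : R) : 0 <= r ->
  (leb \x leb)%E (`[a - r, a + r] `*` `[b - r, b + r])%classic =
  ((2 * r) ^+ 2)%:E.
Proof.
move=> r0; rewrite product_measure1E; try exact: measurable_itv.
have h c : leb `[c - r, c + r]%classic = (2 * r)%:E.
  rewrite lebesgue_measure_itv /= lte_fin.
  case: ifPn => [_|]; first by rewrite -EFinD; congr EFin; ring.
  by rewrite -leNgt => cr; congr EFin; lra.
pose I c : set R := `[c - r, c + r]%classic.
change ((leb (I a) * leb (I b))%E = ((2 * r) ^+ 2)%:E).
by rewrite !h -EFinM expr2.
Qed.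

(** Projecting onto the (y, z) plane does not increase distances: each member of a cover of X
    projects into a square, and these squares cover one of side 2 e, whose Lebesgue area bounds
    their total area from below. *)
Lemma content2_ge (X : set 'cV[R]_3) (y0 z0 e : R) : 0 < e ->
  (forall y z, `|y - y0| <= e -> `|z - z0| <= e -> exists x, X (col3 x y z)) ->
  ((pi / 4 * e ^+ 2)%:E <= hausdorff_content 2 1 X)%E.
Proof.
move=> e0 Xe; have pi0 := @pi_gt0 R.
apply: le_ereal_inf_tmp => _ [C [Cd XC] <-].
have /choice[B hB] : forall i, exists B : set (R * R), [/\ measurable B,
    (forall x y z, C i (col3 x y z) -> B (y, z)) &
    ((pi / 16)%:E * (leb \x leb) B <= hausdorff_gauge 2 (C i))%E].
  move=> i; have [C0|C0] := eqVneq (C i) set0.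
    exists set0; split; first exact: measurable0.
      by move=> x y z; rewrite C0.
    by rewrite measure0 mule0 hausdorff_gauge_ge0.
  have /set0P[c Cc] := C0.
  have cne : C i !=set0 by exists c.
  pose d := fine (diam (C i)).
  have dE : diam (C i) = d%:E.
    rewrite /d fineK// ge0_fin_numE ?diam_ge0//.
    by rewrite (le_lt_trans (Cd i))// ltry.
  have d0 : 0 <= d by rewrite -lee_fin -dE diam_ge0.
  (* The factor pi / 16 is the ratio of the gauge pi (d / 2)^2 to the area (2 d)^2 of this
     square. *)
  exists (`[c 1 0 - d, c 1 0 + d] `*` `[c 2 0 - d, c 2 0 + d])%classic; split.
  - by apply: measurableX; exact: measurable_itv.
  - move=> x y z Cx.
    have hd : enorm (col3 x y z - c) <= d by rewrite -lee_fin -dE; exact: diam_ub.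
    have := le_trans (coord_le_enorm (col3 x y z - c) 1) hd.
    have := le_trans (coord_le_enorm (col3 x y z - c) 2) hd.
    rewrite !colBE !col3E !ler_norml => /andP[z1 z2] /andP[y1 y2].
    by split; rewrite /= in_itv /=; apply/andP; split; lra.
  rewrite square_measure// /hausdorff_gauge (negbTE C0) dE.
  rewrite -EFinM -EFin_expe -!EFinM lee_fin /=.
  by rewrite le_eqVlt; apply/orP; left; apply/eqP; move: (pi) => q; field.
have mB i : measurable (B i) by case: (hB i).
have sub : (((2 * e) ^+ 2)%:E <= \sum_(i <oo) (leb \x leb) (B i))%E.
  rewrite -(square_measure y0 z0 (ltW e0)).
  apply: (measure_sigma_subadditive (leb \x leb)%E mB).
    by apply: measurableX; exact: measurable_itv.
  move=> -[y z] [/=]; rewrite !in_itv /= => /andP[y1 y2] /andP[z1 z2].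
  have [||x Xx] := Xe y z; try by rewrite ler_norml; apply/andP; split; lra.
  have [i _ Ci] := XC _ Xx.
  by exists i => //; case: (hB i) => _ + _; apply; exact: Ci.
apply: (@le_trans _ _ ((pi / 16)%:E * \sum_(i <oo) (leb \x leb) (B i))%E).
  apply: (@le_trans _ _ ((pi / 16)%:E * ((2 * e) ^+ 2)%:E)%E).
    rewrite -EFinM lee_fin le_eqVlt; apply/orP; left; apply/eqP.
    by move: (pi) => q; field.
  by apply: lee_wpmul2l => //; rewrite lee_fin divr_ge0// ltW.
rewrite -nneseriesZl//.
apply: lee_nneseries => [i _ _|i _]; last by case: (hB i).
by rewrite mule_ge0// lee_fin divr_ge0// ltW.
Qed.

(** Where the first coordinate is positive the sphere is a graph over the other two, so U contains
    the part of the graph above a small square. *)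
Lemma sphere_open_pos (U : set 'cV[R]_3) (p : 'cV[R]_3) : open U -> U p ->
  sphere R p -> 0 < p 0 0 -> (0 < hausdorff 2 (U `&` sphere R))%E.
Proof.
move=> oU Up Sp p0.
have /nbhs_ballP[r /= r0 rU] : nbhs p U by exact: open_nbhs_nbhs.
set x0 := p 0 0 in p0 *; pose y0 := p 1 0; pose z0 := p 2 0.
have x0E : x0 ^+ 2 = 1 - y0 ^+ 2 - z0 ^+ 2.
  by move/sphereP: Sp; rewrite -/x0 -/y0 -/z0 => <-; ring.
have x01 : x0 <= 1 by rewrite (le_trans (ler_norm _))// sphere_le1.
have y01 : `|y0| <= 1 by rewrite sphere_le1.
have z01 : `|z0| <= 1 by rewrite sphere_le1.
(* The squares of y and z move by at most 3 e each, hence x^2 by at most 6 e. The first bound keeps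
   x^2 positive; the second gives |x - x0| x0 <= 6 e < r x0. *)
pose e := Num.min (x0 ^+ 2 / 7) (r * x0 / 7).
have e0 : 0 < e by rewrite lt_min !divr_gt0 ?exprn_gt0 ?mulr_gt0.
have ex : e <= x0 ^+ 2 / 7 by rewrite ge_min lexx.
have er : e <= r * x0 / 7 by rewrite ge_min lexx orbT.
have x02 : x0 ^+ 2 <= 1 by rewrite expr_le1// ltW.
apply: (@lt_le_trans _ _ (pi / 4 * e ^+ 2)%:E).
  by rewrite lte_fin mulr_gt0 ?exprn_gt0// divr_gt0// pi_gt0.
apply: (le_trans _ (content_le_hausdorff 2 _ ltr01)).
apply: (content2_ge (y0 := y0) (z0 := z0)) => // y z ye ze.
have sq a b : `|b| <= 1 -> `|a - b| <= e -> `|a ^+ 2 - b ^+ 2| <= 3 * e.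
  move=> b1 ab; rewrite subr_sqr normrM mulrC ler_pM//.
  have -> : a + b = (a - b) + b *+ 2 by rewrite mulr2n; ring.
  rewrite (le_trans (ler_normD _ _))// normrMn mulr2n.
  have : e <= 1 by lra.
  by lra.
have := sq _ _ y01 ye; have := sq _ _ z01 ze.
rewrite !ler_norml => /andP[z1 z2] /andP[y1 y2].
pose x := Num.sqrt (1 - y ^+ 2 - z ^+ 2).
have x2 : x ^+ 2 = 1 - y ^+ 2 - z ^+ 2.
  rewrite sqr_sqrtr//.
  have : 0 <= x0 ^+ 2 - 6 * e by lra.
  by rewrite x0E; lra.
have xge0 : 0 <= x by exact: sqrtr_ge0.
have xx0 : `|x - x0| < r.
  rewrite -(ltr_pM2r p0).
  apply: (@le_lt_trans _ _ (`|x - x0| * (x + x0))).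
    by rewrite ler_wpM2l// lerDr.
  rewrite -[x + x0]ger0_norm ?addr_ge0 ?(ltW p0)// -normrM -subr_sqr x2 x0E.
  apply: (@le_lt_trans _ _ (6 * e)); last by lra.
  by rewrite ler_norml; apply/andP; split; lra.
exists x; split; last by apply/sphereP; rewrite !col3E x2; ring.
apply: rU; rewrite mx_norm_ball /ball_ /=.
have er' : e < r.
  apply: (le_lt_trans er); rewrite ltr_pdivrMr// ltr_pM2l//; lra.
have hm : forall i, `|(p - col3 x y z) i 0| < r.
  apply: forall3; rewrite colBE !col3E distrC //.
  - exact: le_lt_trans er'.
  - exact: le_lt_trans er'.
have : `|p - col3 x y z| <= \big[Num.max/0]_i `|(p - col3 x y z) i 0|.
  apply/mx_norm_leP => [|i j]; first by elim/big_ind : _ => // a b a0 b0; rewrite le_max a0.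
  by rewrite (ord1 j); apply: le_bigmax_cond.
move=> /le_lt_trans; apply.
by apply/bigmax_ltP; split => // i _; exact: hm.
Qed.

End Positivity.

(** * Integration over the sphere *)

Section Cols.
Variable R : realType.
Implicit Types (u v w p : 'cV[R]_3).

Definition cols u v w : 'M[R]_3 := \matrix_(i, j) [:: u; v; w]`_j i 0.

Lemma colsE u v w p : cols u v w *m p =
  p 0 0 *: u + p 1 0 *: v + p 2 0 *: w.
Proof.
apply/colP => i; rewrite mxE sum3 !mxE /=; ring.
Qed.

Lemma orth_cols u v w : sphere R u -> sphere R v -> sphere R w ->
  dot u v = 0 -> dot u w = 0 -> dot v w = 0 ->
  (cols u v w)^T *m cols u v w = 1%:M.
Proof.
move=> /sphere_dot uu /sphere_dot vv /sphere_dot ww uv uw vw.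
have vu := uv; have wu := uw; have wv := vw.
rewrite dot_sym in vu; rewrite dot_sym in wu; rewrite dot_sym in wv.
apply/matrixP => i j; rewrite mxE sum3 !mxE.
have -> : [:: u; v; w]`_i 0 0 * [:: u; v; w]`_j 0 0 +
  [:: u; v; w]`_i 1 0 * [:: u; v; w]`_j 1 0 +
  [:: u; v; w]`_i 2 0 * [:: u; v; w]`_j 2 0 =
  dot ([:: u; v; w]`_i) ([:: u; v; w]`_j) by rewrite dotE.
by move: i; apply: forall3; move: j; apply: forall3 => /=.
Qed.

End Cols.

Section SphereIntegral.
Variable R : realType.
Local Notation S := (sphere R : set (space3 R 2)).
Local Notation mS := (@measurable_sphere R 2).
Implicit Types (f g : 'cV[R]_3 -> R) (A M H : 'M[R]_3).

Definition sint f : R := \int[Hmeas R 2]_(p in sphere R) f p.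
Definition sbm f : Prop := bounded_measurable S f.
Definition sL1 f : Prop :=
  (Hmeas R 2).-integrable (sphere R) (fun p => (f p)%:E).
Definition smeas f : Prop := measurable_fun S f.

Lemma finite_sphere : (Hmeas R 2 (sphere R) < +oo)%E.
Proof. exact: hausdorff2_sphere. Qed.

Lemma sbm_meas f : sbm f -> smeas f. Proof. by case. Qed.

Lemma sL1_meas f : sL1 f -> smeas f.
Proof. by move=> h; apply/measurable_EFinP; exact: (measurable_int _ h). Qed.

Lemma sbm_L1 f : sbm f -> sL1 f.
Proof. exact: (bm_int mS finite_sphere). Qed.

Lemma sbm_cst (c : R) : sbm (fun=> c). Proof. exact: bm_cst. Qed.

Lemma sbmD f g : sbm f -> sbm g -> sbm (fun p => f p + g p).
Proof. exact: bmD. Qed.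

Lemma sbmN f : sbm f -> sbm (fun p => - f p).
Proof. exact: bmN. Qed.

Lemma sbmM f g : sbm f -> sbm g -> sbm (fun p => f p * g p).
Proof. exact: bmM. Qed.

Lemma sbmX f n : sbm f -> sbm (fun p => f p ^+ n).
Proof. exact: bmX. Qed.

Lemma sbm_sum (J : Type) (s : seq J) (F : J -> 'cV[R]_3 -> R) :
  (forall i, sbm (F i)) -> sbm (fun p => \sum_(i <- s) F i p).
Proof. exact: bm_sum. Qed.

Lemma sbm_comp (h : R -> R) f : continuous h -> sbm f -> sbm (fun p => h (f p)).
Proof. exact: bm_comp. Qed.

Lemma sbm_indic f (U : set 'cV[R]_3) : measurable (U : set (space3 R 2)) ->
  sbm f -> sbm (fun p => if p \in U then f p else 0).
Proof. exact: bm_indic. Qed.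

Lemma sbm_coord i : sbm (fun p => p i 0).
Proof.
split; first exact: coord_measurable.
by exists 1 => p; exact: sphere_le1.
Qed.

Lemma quadE M (p : 'cV[R]_3) :
  dot (M *m p) p = \sum_i \sum_j M i j * (p i 0 * p j 0).
Proof. by rewrite dotE !mxE !sum3; ring. Qed.

Lemma sbm_quad M : sbm (fun p => dot (M *m p) p).
Proof.
have -> : (fun p : 'cV[R]_3 => dot (M *m p) p) =
    (fun p => \sum_i \sum_j M i j * (p i 0 * p j 0)).
  by apply/funext => p; exact: quadE.
apply: sbm_sum => i; apply: sbm_sum => j.
exact: (sbmM (sbm_cst _) (sbmM (sbm_coord i) (sbm_coord j))).
Qed.

Lemma sbm_int_mul f g : sbm f -> sL1 g -> sL1 (fun p => f p * g p).
Proof. exact: (bm_int_mul mS). Qed.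

Lemma sL1D f g : sL1 f -> sL1 g -> sL1 (fun p => f p + g p).
Proof. exact: (L1D mS). Qed.

Lemma sL1N f : sL1 f -> sL1 (fun p => - f p).
Proof. exact: L1N. Qed.

Lemma sL1Z (c : R) f : sL1 f -> sL1 (fun p => c * f p).
Proof. exact: (L1Z mS). Qed.

Lemma sL1_sum (J : Type) (s : seq J) (F : J -> 'cV[R]_3 -> R) :
  (forall i, sL1 (F i)) -> sL1 (fun p => \sum_(i <- s) F i p).
Proof. exact: (L1_sum mS finite_sphere). Qed.

Lemma sphere_preimage A : A^T *m A = 1%:M -> mulmx A @^-1` sphere R = sphere R.
Proof. by move=> A1; apply/seteqP; split=> p /=; rewrite sphere_orth. Qed.

Lemma IS_orth A f : A^T *m A = 1%:M -> smeas f ->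
  sint (fun p => f (A *m p)) = sint f.
Proof.
move=> A1 mf; rewrite /sint -(Rintegral_orth A1 mS mf).
by have -> : mulmx A @^-1` S = S by exact: sphere_preimage.
Qed.

Lemma ISD f g : sL1 f -> sL1 g -> sint (fun p => f p + g p) = sint f + sint g.
Proof. exact: (intD (@measurable_sphere R 2)). Qed.

Lemma ISB f g : sL1 f -> sL1 g -> sint (fun p => f p - g p) = sint f - sint g.
Proof. exact: (intB (@measurable_sphere R 2)). Qed.

Lemma ISZ c f : sL1 f -> sint (fun p => c * f p) = c * sint f.
Proof. exact: (intZ (@measurable_sphere R 2)). Qed.

Lemma IS_sum (J : Type) (s : seq J) (F : J -> 'cV[R]_3 -> R) :
  (forall i, sL1 (F i)) ->
  sint (fun p => \sum_(i <- s) F i p) = \sum_(i <- s) sint (F i).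
Proof. exact: (int_sum (@measurable_sphere R 2) finite_sphere). Qed.

Lemma IS_le f g : sL1 f -> sL1 g -> (forall p, sphere R p -> f p <= g p) ->
  sint f <= sint g.
Proof. exact: (int_le (@measurable_sphere R 2)). Qed.

Lemma IS_abs_le f g : sL1 f -> sL1 g ->
  (forall p, sphere R p -> `|f p| <= g p) -> `|sint f| <= sint g.
Proof. exact: (int_abs_le (@measurable_sphere R 2)). Qed.

Lemma IS_ge0 f : (forall p, sphere R p -> 0 <= f p) -> 0 <= sint f.
Proof. by move=> f0; apply: Rintegral_ge0. Qed.

Lemma eq_IS f g : (forall p, sphere R p -> f p = g p) -> sint f = sint g.
Proof. by move=> fg; apply: eq_Rintegral => p /set_mem; exact: fg. Qed.

Lemma IS_bound f (M : R) : sbm f -> (forall p, sphere R p -> `|f p| <= M) ->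
  `|sint f| <= M * sint (fun=> 1).
Proof.
move=> bf fM; rewrite -ISZ; last exact: sbm_L1 (sbm_cst _).
by apply: IS_abs_le => [||p /fM]; rewrite ?mulr1//; apply: sbm_L1 => //; exact: sbm_cst.
Qed.

Lemma ISN f : sL1 f -> sint (fun p => - f p) = - sint f.
Proof. exact: (intN (@measurable_sphere R 2)). Qed.

(** The function c times the indicator of U on the sphere is a minorant of f with positive
    integral. *)
Lemma IS_gt0 f (U : set 'cV[R]_3) (p : 'cV[R]_3) (c : R) :
  sL1 f -> (forall q, sphere R q -> 0 <= f q) ->
  open U -> U p -> sphere R p -> 0 < p 0 0 -> 0 < c ->
  (forall q, sphere R q -> U q -> c <= f q) -> 0 < sint f.
Proof.
move=> lf f0 oU Up Sp p0 c0 cf.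
have pos := sphere_open_pos oU Up Sp p0.
pose V : set 'cV[R]_3 := U `&` sphere R.
have mV : measurable (V : set (space3 R 2)).
  by apply: measurableI; [exact: open_measurable_H|exact: measurable_sphere].
have finV : (Hmeas R 2 V < +oo)%E.
  apply: le_lt_trans finite_sphere; apply: le_hausdorff; exact: subIsetr.
pose i (q : 'cV[R]_3) : R := if q \in V then 1 else 0.
have bi : sbm i by exact: (sbm_indic mV (sbm_cst 1)).
have iE : sint i = fine (Hmeas R 2 V).
  congr fine.
  transitivity (\int[Hmeas R 2]_(q in S) (\1_V q)%:E)%E.
    by apply: eq_integral => q _; rewrite indicE /i; case: (q \in V).
  rewrite integral_indic; [|exact: measurable_sphere|exact: mV].
  congr (Hmeas R 2 _).
  by apply/seteqP; split=> q; rewrite /V /= => -[] //; move=> [].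
apply: (@lt_le_trans _ _ (sint (fun q => c * i q))).
  rewrite ISZ; last exact: sbm_L1.
  rewrite mulr_gt0// iE fine_gt0//.
  by apply/andP; split; [exact: pos|exact: finV].
apply: IS_le => //; first by apply: sL1Z; exact: sbm_L1.
move=> q Sq; rewrite /i; case: ifPn => [|_].
  by rewrite inE mulr1 => -[Uq _]; exact: cf.
by rewrite mulr0 f0.
Qed.

Lemma ae_parallel (z : R) : {ae Hmeas R 2, forall p, sphere R p -> p 2 0 != z}.
Proof.
exists (parallel z : set (space3 R 2)); split.
- apply: measurableI; first exact: measurable_sphere.
  have := @coord_measurable R 2 setT 2 measurableT _ (measurable_set1 z).
  by rewrite setTI.
- exact: hausdorff2_latitude.
- by move=> p /not_implyP[Sp /negP/negPn/eqP]; split.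
Qed.

Lemma col3_orth (s0 s1 s2 : R) (p : 'cV[R]_3) : `|s0| = 1 -> `|s1| = 1 ->
  `|s2| = 1 ->
  let A := cols (col3 s0 0 0) (col3 0 s1 0) (col3 0 0 s2) in
  A^T *m A = 1%:M /\ A *m p = col3 (s0 * p 0 0) (s1 * p 1 0) (s2 * p 2 0).
Proof.
move=> h0 h1 h2 A.
have sq (s : R) : `|s| = 1 -> s ^+ 2 = 1.
  by move=> hs; rewrite -real_normK ?num_real// hs expr1n.
split; last first.
  rewrite colsE; apply/colP; apply: forall3; rewrite !mxE /= ?mulr0 ?addr0 ?add0r;
  by rewrite mulrC.
by apply: orth_cols; rewrite ?dotE ?mxE /= ?mulr0 ?mul0r ?addr0//;
  apply/sphereP; rewrite !mxE /= ?expr0n /= ?addr0 ?add0r sq.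
Qed.

Lemma IS_reflect (s0 s1 s2 : R) f : `|s0| = 1 -> `|s1| = 1 -> `|s2| = 1 ->
  smeas f ->
  sint (fun p => f (col3 (s0 * p 0 0) (s1 * p 1 0) (s2 * p 2 0))) = sint f.
Proof.
move=> h0 h1 h2 mf.
have h p := col3_orth p h0 h1 h2.
rewrite -(IS_orth (proj1 (h 0)) mf).
by apply: eq_IS => p _; rewrite (proj2 (h p)).
Qed.

Lemma IS_swap01 f : smeas f ->
  sint (fun p => f (col3 (p 1 0) (p 0 0) (p 2 0))) = sint f.
Proof.
move=> mf; pose A : 'M[R]_3 := cols (col3 0 1 0) (col3 1 0 0) (col3 0 0 1).
have A1 : A^T *m A = 1%:M.
  by apply: orth_cols; rewrite ?dotE ?mxE /= ?mulr0 ?mul0r ?addr0//;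
  apply/sphereP; rewrite !mxE /= ?expr0n ?expr1n /= ?addr0 ?add0r.
rewrite -(IS_orth A1 mf); apply: eq_IS => p _; congr f.
rewrite colsE; apply/colP; apply: forall3;
  by rewrite !mxE /= ?mulr0 ?mulr1 ?addr0 ?add0r.
Qed.

Section Axisymmetric.
Variable phi : R -> R.
Hypothesis bphi : sbm (fun p => phi (p 2 0)).
Let m0 := sint (fun p => phi (p 2 0)).
Let m2 := sint (fun p => phi (p 2 0) * p 2 0 ^+ 2).

(** Reflecting one coordinate kills the mixed moments, exchanging the first two equates their second
    moments, and |p| = 1 gives their sum. *)
Lemma axisym_moments (i j : 'I_3) :
  sint (fun p => phi (p 2 0) * (p i 0 * p j 0)) =
  if i == j then if i == 2 then m2 else (m0 - m2) / 2 else 0.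
Proof.
have bF a b : sbm (fun p => phi (p 2 0) * (p a 0 * p b 0)).
  exact: (sbmM bphi (sbmM (sbm_coord a) (sbm_coord b))).
have off (a b : 'I_3) (s0 s1 : R) : `|s0| = 1 -> `|s1| = 1 ->
    (forall p : 'cV[R]_3, (col3 (s0 * p 0 0) (s1 * p 1 0) (1 * p 2 0)) a 0 *
      (col3 (s0 * p 0 0) (s1 * p 1 0) (1 * p 2 0)) b 0 = - (p a 0 * p b 0)) ->
    sint (fun p => phi (p 2 0) * (p a 0 * p b 0)) = 0.
  move=> h0 h1 hab.
  pose F (p : 'cV[R]_3) := phi (p 2 0) * (p a 0 * p b 0).
  have mF : measurable_fun S F by exact: (sbm_meas (bF a b)).
  have h := @IS_reflect s0 s1 1 F h0 h1 (normr1 R) mF.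
  have e : sint (fun p => F (col3 (s0 * p 0 0) (s1 * p 1 0) (1 * p 2 0))) =
      - sint F.
    rewrite -ISN; last by apply: sbm_L1; exact: bF.
    by apply: eq_IS => p _; rewrite /F hab col3E mul1r mulrN.
  have : - sint F = sint F := etrans (esym e) h.
  by rewrite /F; lra.
have diag : sint (fun p => phi (p 2 0) * (p 0 0 * p 0 0)) = (m0 - m2) / 2 /\
    sint (fun p => phi (p 2 0) * (p 1 0 * p 1 0)) = (m0 - m2) / 2.
  have e01 : sint (fun p => phi (p 2 0) * (p 0 0 * p 0 0)) =
      sint (fun p => phi (p 2 0) * (p 1 0 * p 1 0)).
    rewrite -(IS_swap01 (sbm_meas (bF 0 0))).
    by apply: eq_IS => p _; rewrite !col3E.
  have sum : sint (fun p => phi (p 2 0) * (p 0 0 * p 0 0)) +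
      sint (fun p => phi (p 2 0) * (p 1 0 * p 1 0)) = m0 - m2.
    rewrite -ISD; try by apply: sbm_L1; exact: bF.
    rewrite /m0 /m2 -ISB; first last.
    - exact: (sbm_L1 (sbmM bphi (sbmX 2 (sbm_coord 2)))).
    - exact: (sbm_L1 bphi).
    apply: eq_IS => p /sphereP p1.
    have -> : phi (p 2 0) = phi (p 2 0) * 1 by rewrite mulr1.
    by rewrite -{3}p1; ring.
  by split; move: sum; rewrite e01; lra.
have n1 : `|-1| = 1 :> R by rewrite normrN1.
have n2 := normr1 R.
move: i j; apply: forall3; apply: forall3 => /=.
- exact: diag.1.
- by apply: (off _ _ (-1) 1) => // p; rewrite !col3E; ring.
- by apply: (off _ _ (-1) 1) => // p; rewrite !col3E; ring.
- by apply: (off _ _ (-1) 1) => // p; rewrite !col3E; ring.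
- exact: diag.2.
- by apply: (off _ _ 1 (-1)) => // p; rewrite !col3E; ring.
- by apply: (off _ _ (-1) 1) => // p; rewrite !col3E; ring.
- by apply: (off _ _ 1 (-1)) => // p; rewrite !col3E; ring.
- by apply: eq_IS => p _; rewrite expr2.
Qed.

(** The first two diagonal entries enter with equal weights, and their sum is - H 2 2 since the
    trace vanishes. *)
Lemma axisym_quad H : \tr H = 0 ->
  sint (fun p => phi (p 2 0) * dot (H *m p) p) = H 2 2 * (3 * m2 - m0) / 2.
Proof.
move=> trH.
have -> : sint (fun p => phi (p 2 0) * dot (H *m p) p) =
    \sum_i \sum_j H i j * sint (fun p => phi (p 2 0) * (p i 0 * p j 0)).
  have bF a b : sbm (fun p => phi (p 2 0) * (p a 0 * p b 0)).
    exact: (sbmM bphi (sbmM (sbm_coord a) (sbm_coord b))).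
  under [RHS]eq_bigr => i _.
    under eq_bigr => j _ do rewrite -(ISZ _ (sbm_L1 (bF i j))).
    rewrite -IS_sum; last first.
      by move=> j; apply: sbm_L1; apply: sbmM; [exact: sbm_cst|exact: bF].
    over.
  rewrite -IS_sum; last first.
    move=> i; apply: sbm_L1; apply: sbm_sum => j.
    by apply: sbmM; [exact: sbm_cst|exact: bF].
  apply: eq_IS => p _; rewrite quadE mulr_sumr; apply: eq_bigr => i _.
  by rewrite mulr_sumr; apply: eq_bigr => j _; rewrite mulrCA.
rewrite !sum3 !axisym_moments /=.
move: trH; rewrite /mxtrace sum3 => h.
have -> : H 0 0 = - H 1 1 - H 2 2 by lra.
by field.
Qed.

End Axisymmetric.

End SphereIntegral.
Arguments sbm_coord {R} i.

(** * The energy *)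

(** No sign or integrability is assumed, as the energy density may take the value +oo; positive and
    negative parts are compared separately. *)
Lemma le_integral_ae d (T : measurableType d) (R : realType)
    (mu : {measure set T -> \bar R}) (D : set T) (f g : T -> \bar R) :
  measurable D -> measurable_fun D f -> measurable_fun D g ->
  {ae mu, forall x, D x -> (f x <= g x)%E} ->
  (\int[mu]_(x in D) f x <= \int[mu]_(x in D) g x)%E.
Proof.
move=> mD mf mg fg; rewrite integralE [leRHS]integralE; apply: leeB.
- apply: ae_ge0_le_integral => //; [exact: measurable_funepos|exact: measurable_funepos|].
  apply: filterS fg => x fg Dx; rewrite !funeposE.
  by rewrite ge_max le_max fg//= le_max lexx orbT.
- apply: ae_ge0_le_integral => //; [exact: measurable_funeneg|exact: measurable_funeneg|].
  apply: filterS fg => x fg Dx; rewrite !funenegE.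
  by rewrite ge_max le_max leeN2 fg//= le_max lexx orbT.
Qed.

Section Energy.
Variable R : realType.
Local Notation S := (sphere R : set (space3 R 2)).
Local Notation mS := (@measurable_sphere R 2).
Implicit Types (f g u : 'cV[R]_3 -> R) (A M H Q : 'M[R]_3).

Lemma neg_ln_measurable : measurable_fun setT (@neg_ln R).
Proof.
apply: measurable_fun_ifT.
- by apply: measurable_fun_ltr; [exact: measurable_cst|exact: measurable_id].
- apply/measurable_EFinP; apply: measurable_funN; exact: measurable_ln.
- exact: measurable_cst.
Qed.

Definition energy_density (w f : 'cV[R]_3 -> R) p : \bar R :=
  ((f p * ln (f p))%:E + (f p)%:E * neg_ln (w p))%E.

Lemma smeasM f g : smeas f -> smeas g -> smeas (fun p => f p * g p).
Proof. exact: measurable_funM. Qed.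

Lemma smeas_ln f : smeas f -> smeas (fun p => ln (f p)).
Proof. by move=> mf; exact: (measurableT_comp (@measurable_ln R) mf). Qed.

Lemma energy_density_measurable w f : smeas w -> smeas f ->
  measurable_fun S (energy_density w f).
Proof.
move=> mw mf; apply: emeasurable_funD.
  by apply/measurable_EFinP; apply: smeasM => //; exact: smeas_ln.
apply: emeasurable_funM; first exact/measurable_EFinP.
exact: (measurableT_comp neg_ln_measurable mw).
Qed.

Definition weight Q (eta : R) (p : 'cV[R]_3) : R := dot (Q *m p) p - eta.

Lemma sbm_weight Q eta : sbm (weight Q eta).
Proof. exact: (sbmD (sbm_quad Q) (sbm_cst _)). Qed.

Lemma energyE Q eta f :
  energy Q eta f =
  (\int[Hmeas R 2]_(p in sphere R) energy_density (weight Q eta) f p)%E.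
Proof. by []. Qed.

Lemma sint_EFin g : sL1 g ->
  (\int[Hmeas R 2]_(p in sphere R) (g p)%:E)%E = (sint g)%:E.
Proof. exact: (int_EFin mS). Qed.

Lemma energy_ge Q eta f g : smeas f -> sL1 g ->
  {ae Hmeas R 2, forall p, sphere R p ->
    ((g p)%:E <= energy_density (weight Q eta) f p)%E} ->
  ((sint g)%:E <= energy Q eta f)%E.
Proof.
move=> mf lg gf; rewrite -sint_EFin// energyE.
apply: (le_integral_ae mS _ _ gf).
- by apply/measurable_EFinP; exact: sL1_meas.
- by apply: energy_density_measurable => //; exact: sbm_meas (sbm_weight _ _).
Qed.

Lemma energy_le Q eta f g : smeas f -> sL1 g ->
  {ae Hmeas R 2, forall p, sphere R p ->
    (energy_density (weight Q eta) f p <= (g p)%:E)%E} ->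
  (energy Q eta f <= (sint g)%:E)%E.
Proof.
move=> mf lg gf; rewrite -sint_EFin// energyE.
apply: (le_integral_ae mS _ _ gf).
- by apply: energy_density_measurable => //; exact: sbm_meas (sbm_weight _ _).
- by apply/measurable_EFinP; exact: sL1_meas.
Qed.

Lemma ln_le_subr1 (x : R) : 0 < x -> ln x <= x - 1.
Proof. by move=> x0; rewrite -{1}(subrKC 1 x) le_ln1Dx//; lra. Qed.

(** For w, f > 0 this is ln t <= t - 1 at t = w k / f, with equality when f = w k. For w <= 0 the
    right side is +oo unless f = 0. *)
Lemma gibbs (f w k : R) : 0 <= f -> 0 < k ->
  ((f - Num.max w 0 * k + f * ln k)%:E <= (f * ln f)%:E + f%:E * neg_ln w)%E.
Proof.
move=> f0 k0; rewrite /neg_ln; have [w0|w0] := ltP 0 w.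
  rewrite -EFinM -EFinD lee_fin.
  move: f0; rewrite le_eqVlt => /predU1P[<-|f0].
    by rewrite !mul0r !addr0 sub0r oppr_le0 mulr_ge0// ltW.
  have h : ln (w * k / f) <= w * k / f - 1.
    by apply: ln_le_subr1; rewrite divr_gt0// mulr_gt0.
  rewrite ln_div ?posrE ?mulr_gt0// lnM ?posrE// in h.
  have : f * (ln w + ln k - ln f) <= f * (w * k / f - 1) by rewrite ler_pM2l.
  have -> : f * (w * k / f - 1) = w * k - f by field; rewrite gt_eqF.
  by lra.
rewrite mul0r subr0; move: f0; rewrite le_eqVlt => /predU1P[<-|f0].
  by rewrite !mul0r !addr0 mul0e adde0.
by rewrite gt0_muley ?lte_fin// addey// leey.
Qed.

Lemma sbm_max0 f : sbm f -> sbm (fun p => Num.max (f p) 0).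
Proof.
move=> [mf [M fM]]; split.
  by apply: measurable_maxr => //; exact: measurable_cst.
exists `|M| => p Sp; have := fM p Sp.
rewrite !ler_norml => /andP[f1 f2].
have := ler_norm M; have := normr_ge0 M.
move=> M0 MM; rewrite le_max ge_max M0 andbT; apply/andP; split.
  by apply/orP; right; rewrite oppr_le0.
exact: le_trans MM.
Qed.

Lemma sbm_pos_indic f : sbm f -> sbm (fun p => if 0 < f p then 1 else 0).
Proof.
move=> bf; split; last first.
  by exists 1 => p _; case: ifP; rewrite ?normr1 ?normr0.
apply: measurable_fun_if.
- exact: mS.
- by apply: measurable_fun_ltr; [exact: measurable_cst|exact: sbm_meas].
- exact: measurable_cst.
- exact: measurable_cst.
Qed.

(** The matrix norm is the sup norm, and 9 counts the entries. *)
Lemma norm_quad_le H (p : 'cV[R]_3) : sphere R p ->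
  `|dot (H *m p) p| <= 9 * `|H|.
Proof.
move=> Sp; rewrite quadE.
have h i j : `|H i j * (p i 0 * p j 0)| <= `|H|.
  rewrite normrM -[leRHS]mulr1 ler_pM// ?coord_le_norm//.
  by rewrite normrM mulr_ile1// sphere_le1.
rewrite sum3 !sum3.
have := h 0 0; have := h 0 1; have := h 0 2; have := h 1 0; have := h 1 1.
have := h 1 2; have := h 2 0; have := h 2 1; have := h 2 2.
rewrite !ler_norml => /andP[? ?] /andP[? ?] /andP[? ?] /andP[? ?] /andP[? ?].
move=> /andP[? ?] /andP[? ?] /andP[? ?] /andP[? ?].
by apply/andP; split; lra.
Qed.

(** Unit mass need not be checked separately: on the sphere the diagonal second moments add up to
    the mass, and here to tr Q + 1. *)
Lemma admissible_intro Q f : sL1 f ->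
  {ae Hmeas R 2, forall p, sphere R p -> 0 <= f p} ->
  \tr Q = 0 ->
  (forall i j, sint (fun p => p i 0 * p j 0 * f p) = Q i j + (i == j)%:R / 3) ->
  admissible Q f.
Proof.
move=> lf f0 trQ mom.
have lp (i j : 'I_3) : sL1 (fun p => p i 0 * p j 0 * f p).
  exact: (sbm_int_mul (sbmM (sbm_coord i) (sbm_coord j)) lf).
have f1 : sint f = 1.
  have -> : sint f = \sum_i sint (fun p => p i 0 * p i 0 * f p).
    rewrite -IS_sum; last by move=> i; exact: lp.
    apply: eq_IS => p /sphereP p1.
    by rewrite sum3 -!mulrDl -!expr2 p1 mul1r.
  move: trQ; rewrite /mxtrace !sum3 !mom /= => h.
  have -> : Q 0 0 = - Q 1 1 - Q 2 2 by lra.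
  by field.
split; first by split.
apply/matrixP => i j; rewrite mxE.
have -> : (\int[Hmeas R 2]_(p in sphere R) (deviator p i j * f p)) =
    sint (fun p => p i 0 * p j 0 * f p - (i == j)%:R / 3 * f p).
  apply: eq_IS => p _; rewrite /deviator !mxE big_ord1 !mxE.
  by rewrite -mulrBl; congr (_ * _); case: (i == j); rewrite ?mulr1n ?mulr0n; field.
rewrite ISB; [|exact: lp|exact: sL1Z].
by rewrite mom ISZ// f1 mulr1 addrK.
Qed.

Lemma admissible_moment Q f : admissible Q f ->
  sint f = 1 /\
  forall i j, sint (fun p => p i 0 * p j 0 * f p) = Q i j + (i == j)%:R / 3.
Proof.
move=> [[lf f0 f1] QE]; split; first exact: f1.
move=> i j; rewrite {}QE mxE.
have -> : (\int[Hmeas R 2]_(p in sphere R) (deviator p i j * f p)) =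
    sint (fun p => p i 0 * p j 0 * f p - (i == j)%:R / 3 * f p).
  apply: eq_IS => p _; rewrite /deviator !mxE big_ord1 !mxE.
  by rewrite -mulrBl; congr (_ * _); case: (i == j); rewrite ?mulr1n ?mulr0n; field.
have lp : sL1 (fun p => p i 0 * p j 0 * f p).
  exact: (sbm_int_mul (sbmM (sbm_coord i) (sbm_coord j)) lf).
rewrite ISB; [|exact: lp|exact: sL1Z].
by rewrite ISZ// (f1 : sint f = 1) mulr1 subrK.
Qed.

End Energy.

(** * Solving for a prescribed second moment *)

Section Gram.
Variable R : realType.
Variable wt : 'cV[R]_3 -> R.
Hypothesis bwt : sbm wt.
Hypothesis wt_ge0 : forall p, sphere R p -> 0 <= wt p.
Variable r0 : R.
Hypothesis r0_gt0 : 0 < r0.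
Hypothesis wt_ge1 : forall p, sphere R p -> `|p 1 0| < r0 -> `|p 2 0| < r0 ->
  1 <= wt p.
Implicit Types (M Y : 'M[R]_3).

(** The integral sees only the symmetric part of M. The term M - M^T restores injectivity on all
    matrices, so that [gram] can be inverted as an endomorphism of the whole matrix space. *)
Definition gram M : 'M[R]_3 := \matrix_(i, j)
  (sint (fun p => p i 0 * p j 0 * (wt p * dot (M *m p) p)) + (M i j - M j i)).

Let bint M i j : sbm (fun p => p i 0 * p j 0 * (wt p * dot (M *m p) p)).
Proof.
exact: (sbmM (sbmM (sbm_coord i) (sbm_coord j)) (sbmM bwt (sbm_quad M))).
Qed.

Lemma gram_linear : linear gram.
Proof.
move=> a M N; apply/matrixP => i j; rewrite !mxE.
have -> : sint (fun p => p i 0 * p j 0 * (wt p * dot ((a *: M + N) *m p) p)) =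
    a * sint (fun p => p i 0 * p j 0 * (wt p * dot (M *m p) p)) +
    sint (fun p => p i 0 * p j 0 * (wt p * dot (N *m p) p)).
  rewrite -ISZ; last exact: sbm_L1 (bint M i j).
  rewrite -ISD; [|exact: sL1Z (sbm_L1 (bint M i j))|exact: sbm_L1 (bint N i j)].
  apply: eq_IS => p _.
  by rewrite mulmxDl -scalemxAl !dotE !mxE; ring.
by ring.
Qed.

HB.instance Definition _ := GRing.isLinear.Build R 'M[R]_3 'M[R]_3 *:%R gram
  gram_linear.

(** By homogeneity the form vanishes at (1, a, b) for small a and b, where it is a quadratic
    polynomial whose coefficients are the entries of M. *)
Lemma quad_eq0 M : M^T = M -> (forall p, sphere R p -> 0 < p 0 0 ->
  `|p 1 0| < r0 -> `|p 2 0| < r0 -> dot (M *m p) p = 0) -> M = 0.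
Proof.
move=> Ms Mp.
pose s := r0.
have key (a b : R) : `|a| < s -> `|b| < s ->
    dot (M *m col3 1 a b) (col3 1 a b) = 0.
  move=> ab bb; pose n := Num.sqrt (1 + a ^+ 2 + b ^+ 2).
  have n2 : n ^+ 2 = 1 + a ^+ 2 + b ^+ 2.
    by rewrite sqr_sqrtr// !addr_ge0 ?sqr_ge0.
  have n1 : 1 <= n.
    by rewrite -[leLHS]sqrtr1 ler_sqrt -?addrA ?lerDl ?ltr_wpDr ?addr_ge0 ?sqr_ge0.
  have n0 : 0 < n by exact: lt_le_trans n1.
  have vn : n^-1 <= 1 by rewrite invf_le1.
  have := Mp (n^-1 *: col3 1 a b); rewrite !mxE /= => h.
  have : dot (M *m (n^-1 *: col3 1 a b)) (n^-1 *: col3 1 a b) = 0.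
    apply: h.
    - apply/sphereP; rewrite !mxE /= !exprMn expr1n -!mulrDr -n2.
      by rewrite -exprMn mulVf ?expr1n// gt_eqF.
    - by rewrite mulr1 invr_gt0.
    - rewrite normrM gtr0_norm ?invr_gt0//; apply: le_lt_trans ab.
      by rewrite ler_piMl.
    - rewrite normrM gtr0_norm ?invr_gt0//; apply: le_lt_trans bb.
      by rewrite ler_piMl.
  have -> : dot (M *m (n^-1 *: col3 1 a b)) (n^-1 *: col3 1 a b) =
      n^-1 ^+ 2 * dot (M *m col3 1 a b) (col3 1 a b).
    by rewrite -scalemxAr !dotE !mxE /=; ring.
  by move=> /eqP; rewrite mulf_eq0 expf_eq0/= invr_eq0 (gt_eqF n0) => /eqP.
have sym i j : M i j = M j i by rewrite -{1}Ms mxE.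
pose t := s / 2.
have t0 : 0 < t by rewrite divr_gt0.
have ts : `|t| < s by rewrite gtr0_norm// /t; move: r0_gt0; rewrite /s; lra.
have nts : `|- t| < s by rewrite normrN.
have zs : `|0 : R| < s by rewrite normr0.
have E (a b : R) : dot (M *m col3 1 a b) (col3 1 a b) =
    M 0 0 + 2 * a * M 0 1 + 2 * b * M 0 2 + a ^+ 2 * M 1 1 +
    2 * a * b * M 1 2 + b ^+ 2 * M 2 2.
  by rewrite quadE !sum3 !mxE /= (sym 1 0) (sym 2 0) (sym 2 1); ring.
(* Six sample points determine the six coefficients. *)
have k00 := key _ _ zs zs; have kp0 := key _ _ ts zs; have km0 := key _ _ nts zs.
have k0p := key _ _ zs ts; have k0m := key _ _ zs nts; have kpp := key _ _ ts ts.
rewrite !E in k00 kp0 km0 k0p k0m kpp.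
have m00 : M 0 0 = 0 by move: k00; lra.
have tM x : t * x = 0 -> x = 0.
  by move=> /eqP; rewrite mulf_eq0 (gt_eqF t0) => /eqP.
have m01 : M 0 1 = 0 by apply: tM; lra.
have m02 : M 0 2 = 0 by apply: tM; lra.
have m11 : M 1 1 = 0 by apply: (tM); apply: (tM); lra.
have m22 : M 2 2 = 0 by apply: (tM); apply: (tM); lra.
have m12 : M 1 2 = 0.
  by apply: (tM); apply: (tM); move: kpp; rewrite m00 m01 m02 m11 m22; lra.
apply/matrixP; apply: forall3; apply: forall3; rewrite mxE //.
- by rewrite sym.
- by rewrite sym.
- by rewrite sym.
Qed.

(** Pairing with M turns gram M = 0 into an identity between the integral of wt (Mp.p)^2 and minus a
    sum of squares of antisymmetric entries. Both sides vanish, so M is symmetric and its form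
    vanishes where wt >= 1. *)
Lemma gram_inj M : gram M = 0 -> M = 0.
Proof.
move=> gM.
have gE i j : sint (fun p => p i 0 * p j 0 * (wt p * dot (M *m p) p)) =
    M j i - M i j.
  have /matrixP/(_ i j) := gM; rewrite !mxE; lra.
pose q (p : 'cV[R]_3) := wt p * dot (M *m p) p ^+ 2.
have bq : sbm q by exact: (sbmM bwt (sbmX 2 (sbm_quad M))).
have qE : sint q = \sum_i \sum_j M i j * (M j i - M i j).
  have -> : sint q = sint (fun p => \sum_i \sum_j
      M i j * (p i 0 * p j 0 * (wt p * dot (M *m p) p))).
    apply: eq_IS => p _; rewrite /q expr2 {1}quadE.
    rewrite mulrCA mulr_suml; apply: eq_bigr => i _.
    rewrite mulr_suml; apply: eq_bigr => j _. ring.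
  rewrite IS_sum; last first.
    move=> i; apply: sL1_sum => j; apply: sL1Z; exact: sbm_L1 (bint M i j).
  apply: eq_bigr => i _; rewrite IS_sum; last first.
    by move=> j; apply: sL1Z; exact: sbm_L1 (bint M i j).
  apply: eq_bigr => j _; rewrite ISZ ?gE//; exact: sbm_L1 (bint M i j).
have q0 : 0 <= sint q.
  by apply: IS_ge0 => p Sp; rewrite mulr_ge0 ?sqr_ge0// wt_ge0.
have sq : sint q = - ((M 0 1 - M 1 0) ^+ 2 + (M 0 2 - M 2 0) ^+ 2 +
    (M 1 2 - M 2 1) ^+ 2).
  by rewrite qE !sum3; ring.
have e1 := sqr_ge0 (M 0 1 - M 1 0); have e2 := sqr_ge0 (M 0 2 - M 2 0).
have e3' := sqr_ge0 (M 1 2 - M 2 1).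
have z (x : R) : x ^+ 2 <= 0 -> x = 0.
  by move=> x0; apply/eqP; rewrite -sqrf_eq0 eq_le x0 sqr_ge0.
have s01 : M 0 1 - M 1 0 = 0 by apply: z; lra.
have s02 : M 0 2 - M 2 0 = 0 by apply: z; lra.
have s12 : M 1 2 - M 2 1 = 0 by apply: z; lra.
have Ms : M^T = M.
  by apply/matrixP; apply: forall3; apply: forall3; rewrite mxE; lra.
apply: (quad_eq0 Ms) => p Sp p0 p1 p2; apply/eqP/negPn/negP => np.
pose F (x : 'cV[R]_3) := dot (M *m x) x.
have cF : continuous F.
  have -> : F = (fun x => \sum_i \sum_j M i j * (x i 0 * x j 0)).
    by apply/funext => x; rewrite /F quadE.
  have cc i : continuous (fun x : 'cV[R]_3 => x i 0).
    by move=> x; exact: coord_continuous.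
  have cM (f g : 'cV[R]_3 -> R) : continuous f -> continuous g ->
      continuous (fun x => f x * g x).
    by move=> cf cg x; exact: (cvgM (cf x) (cg x)).
  have cs (h : 'I_3 -> 'cV[R]_3 -> R) : (forall i, continuous (h i)) ->
      continuous (fun x => \sum_i h i x).
    move=> ch.
    have -> : (fun x => \sum_i h i x) = (fun x => h 0 x + h 1 x + h 2 x).
      by apply/funext => x; rewrite sum3.
    by move=> x; exact: (cvgD (cvgD (ch 0 x) (ch 1 x)) (ch 2 x)).
  apply: (cs) => i; apply: (cs) => j.
  have c0 : continuous (fun _ : 'cV[R]_3 => M i j) by exact: cst_continuous.
  exact: (cM _ _ c0 (cM _ _ (cc i) (cc j))).
pose c := `|F p| / 2.
have c0 : 0 < c by rewrite divr_gt0// normr_gt0.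
pose U := [set x : 'cV[R]_3 | c < `|F x|] `&`
  ([set x : 'cV[R]_3 | `|x 1 0| < r0] `&` [set x : 'cV[R]_3 | `|x 2 0| < r0]).
have oU : open U.
  have op (G : 'cV[R]_3 -> R) : continuous G -> continuous (fun x => `|G x|).
    by move=> cG x; apply: continuous_comp; [exact: cG|exact: norm_continuous].
  apply: openI.
    by apply: (@open_comp _ _ (fun x => `|F x|) [set y | c < y]) => [x _|];
      [exact: op|exact: open_gt].
  have cc i : continuous (fun x : 'cV[R]_3 => x i 0).
    by move=> x; exact: coord_continuous.
  apply: openI.
    by apply: (@open_comp _ _ (fun x : 'cV[R]_3 => `|x 1 0|) [set y | y < r0])
      => [x _|]; [exact: op|exact: open_lt].
  by apply: (@open_comp _ _ (fun x : 'cV[R]_3 => `|x 2 0|) [set y | y < r0])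
      => [x _|]; [exact: op|exact: open_lt].
have : 0 < sint q.
  apply: (@IS_gt0 R q U p (c ^+ 2)) => //.
  - exact: sbm_L1.
  - by move=> x Sx; rewrite mulr_ge0 ?sqr_ge0// wt_ge0.
  - by split; [rewrite /= /c; move: c0; rewrite /c; lra|split].
  - by rewrite exprn_gt0.
  - move=> x Sx [/= cx [x1 x2]].
    apply: (@le_trans _ _ (F x ^+ 2)).
      by rewrite -[leRHS]real_normK ?num_real// ler_pXn2r ?nnegrE// ltW.
    by rewrite /q ler_peMl ?sqr_ge0// wt_ge1.
by rewrite sq; lra.
Qed.

(** The constant is a norm bound for the inverse of [gram]; linear dependence on Y is what makes the
    later corrector of order |H|. *)
Lemma gram_solve : exists C : R, 0 <= C /\ forall Y, Y^T = Y ->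
  exists M, `|M| <= C * `|Y| /\
    forall i j, sint (fun p => p i 0 * p j 0 * (wt p * dot (M *m p) p)) = Y i j.
Proof.
pose G := lin_mx gram.
have Gu : G \in unitmx.
  rewrite -row_free_unit; apply: inj_row_free => v vG.
  have : gram (vec_mx v) = 0.
    by rewrite -[gram _]mxvecK -mul_vec_lin vec_mxK vG linear0.
  by move=> /gram_inj /(congr1 mxvec); rewrite vec_mxK linear0.
exists ((3 * 3)%:R * `|invmx G|); split; first by rewrite mulr_ge0.
move=> Y Ys; exists (vec_mx (mxvec Y *m invmx G)); split.
  apply/mx_norm_leP; first by rewrite !mulr_ge0.
  move=> i j; rewrite mxE mxE.
  apply: (le_trans (ler_norm_sum _ _ _)).
  apply: (@le_trans _ _ (\sum_(k < 3 * 3) (`|invmx G| * `|Y|))).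
    apply: ler_sum => k _; rewrite normrM mulrC ler_pM ?coord_le_norm//.
    by case/mxvec_indexP: k => a b; rewrite mxvecE coord_le_norm.
  by rewrite sumr_const card_ord -[leLHS]mulr_natl mulrA.
set M := vec_mx _.
have gM : gram M = Y.
  by rewrite -[gram _]mxvecK -mul_vec_lin vec_mxK -mulmxA mulVmx// mulmx1 mxvecK.
have gE i j : gram M i j = Y i j by rewrite gM.
have sE i j : sint (fun p => p i 0 * p j 0 * (wt p * dot (M *m p) p)) =
    sint (fun p => p j 0 * p i 0 * (wt p * dot (M *m p) p)).
  by apply: eq_IS => p _; rewrite [p i 0 * _]mulrC.
have Ysym i j : Y i j = Y j i by rewrite -{1}Ys mxE.
(* For symmetric Y, adding the entries (i, j) and (j, i) cancels the antisymmetric term. *)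
move=> i j; have := gE i j; have := gE j i; rewrite !mxE (sE j i) (Ysym j i).
by lra.
Qed.

End Gram.

(** * A sufficient condition for criticality *)

Section SphereExtra.
Variable R : realType.
Implicit Types (f g : 'cV[R]_3 -> R).

Lemma sbm_norm f : sbm f -> sbm (fun p => `|f p|).
Proof. by apply: sbm_comp; exact: norm_continuous. Qed.

Lemma sbm_expR f : sbm f -> sbm (fun p => expR (f p)).
Proof. by apply: sbm_comp; exact: continuous_expR. Qed.

Lemma sbm_cvg (F : nat -> 'cV[R]_3 -> R) f (M : R) :
  (forall n, smeas (F n)) -> smeas f ->
  (forall n p, sphere R p -> `|F n p| <= M) ->
  {ae Hmeas R 2, forall p, sphere R p -> F n p @[n --> \oo] --> f p} ->
  sint (F n) @[n --> \oo] --> sint f.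
Proof. exact: (bounded_cvg (@measurable_sphere R 2) (finite_sphere R)). Qed.

Lemma sint1_ge0 : 0 <= sint (fun _ : 'cV[R]_3 => 1 : R).
Proof. by apply: IS_ge0. Qed.

Lemma max0_lip (a b : R) : `|Num.max a 0 - Num.max b 0| <= `|a - b|.
Proof.
by case: (leP a 0) => ?; case: (leP b 0) => ?; rewrite ler_norml;
  apply/andP; split; have := ler_norm (a - b); have := ler_norm (- (a - b));
  rewrite normrN; lra.
Qed.

(** The positive part is affine on each side of 0, so the linearization is exact unless w is within
    b of 0. *)
Lemma max0_deriv (w h b : R) : `|h| <= b ->
  `|Num.max (w + h) 0 - Num.max w 0 - (if 0 < w then 1 else 0) * h| <=
  if `|w| <= b then b else 0.
Proof.
rewrite ler_norml => /andP[h1 h2].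
have [w0|w0] := ltP 0 w; case: ifPn => wb.
- rewrite mul1r; case: (leP (w + h) 0) => wh;
  rewrite ler_norml; apply/andP; split; lra.
- move: wb; rewrite gtr0_norm// -ltNge => wb; rewrite mul1r.
  by case: (leP (w + h) 0) => wh; rewrite normr_le0; apply/eqP; lra.
- rewrite mul0r; case: (leP (w + h) 0) => wh;
  rewrite ler_norml; apply/andP; split; lra.
- move: wb; rewrite ler0_norm// -ltNge => wb; rewrite mul0r.
  by case: (leP (w + h) 0) => wh; rewrite normr_le0; apply/eqP; lra.
Qed.

(** A reverse of [gibbs] with quadratic error: ln (1 + x) <= x at x = c / (w k) leaves the remainder
    c^2 / (w k). The alternative in the hypothesis allows a nonzero c only where w k >= b. *)
Lemma density_le (w k c b f : R) : 0 < k -> 0 < b ->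
  c = 0 \/ (b <= w * k /\ `|c| <= b / 2) ->
  f = Num.max w 0 * k + c ->
  ((f * ln f)%:E + f%:E * neg_ln w <= (f * ln k + c + c ^+ 2 / b)%:E)%E.
Proof.
move=> k0 b0 hc fdef; rewrite /neg_ln; case: ifPn => [w0|]; last first.
  rewrite -leNgt => w0.
  have c0 : c = 0.
    case: hc => // -[bw _]; move: (lt_le_trans b0 bw).
    by rewrite pmulr_lgt0// ltNge w0.
  have -> : f = 0 by rewrite fdef c0 addr0 max_r// mul0r.
  by rewrite c0 !mul0r mul0e adde0 !add0r expr0n mul0r.
rewrite -EFinM -EFinD lee_fin.
have wk : 0 < w * k by rewrite mulr_gt0.
have fE : f = w * k + c by rewrite fdef max_l// ltW.
have f0 : 0 < f.
  rewrite fE; case: hc => [->|[bw]]; first by rewrite addr0.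
  by rewrite ler_norml => /andP[c1 c2]; lra.
have e : ln f = ln w + ln k + ln (1 + c / (w * k)).
  rewrite -lnM ?posrE// -lnM ?posrE//; first last.
    by have -> : 1 + c / (w * k) = f / (w * k);
      [rewrite fE mulrDl divff// gt_eqF|rewrite divr_gt0].
  by congr ln; rewrite fE; field; rewrite !gt_eqF.
have xpos : -1 < c / (w * k).
  have -> : c / (w * k) = f / (w * k) - 1.
    by rewrite fE mulrDl divff ?gt_eqF//; ring.
  by have := divr_gt0 f0 wk; lra.
have l1 := le_ln1Dx xpos.
have h1 : f * ln (1 + c / (w * k)) <= f * (c / (w * k)) by rewrite ler_pM2l.
have h2 : f * (c / (w * k)) = c + c ^+ 2 / (w * k).
  by rewrite fE; field; rewrite !gt_eqF.
have h3 : c ^+ 2 / (w * k) <= c ^+ 2 / b.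
  case: hc => [->|[bw _]]; first by rewrite expr0n !mul0r.
  by rewrite ler_wpM2l ?sqr_ge0// lef_pV2.
rewrite e; rewrite h2 in h1.
move: h1 h3; set l := ln (1 + _); set x := c ^+ 2 / (w * k); set y := _ / b.
by move=> h1 h3; lra.
Qed.

End SphereExtra.

Section Critical.
Variable R : realType.
Variables (sig alp lam : R).
Implicit Types (p : 'cV[R]_3) (H : 'M[R]_3).

Definition cw p : R := sig * (alp - p 2 0 ^+ 2).
Definition cexp p : R := expR (lam * p 2 0 ^+ 2).
Definition cind p : R := if 0 < cw p then 1 else 0.
Definition cZ : R := sint (fun p => Num.max (cw p) 0 * cexp p).

(* [Q] below is - sig (e3 (x) e3 - I / 3), [cw] is its weight on the sphere and
   the positive part of [cw] times [cexp / cZ] is the candidate minimizer.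
   [moment_eq] says that this density is admissible for [Q]; [stationary_eq]
   says that the derivative of [rho] at 0 cancels the Lagrange multiplier
   [lam], so that the gradient of J vanishes at [Q]. *)
Hypothesis sig0 : 0 < sig.
Hypothesis sig1 : 2 * sig < 1.
Hypothesis alp0 : 0 < alp.
Hypothesis moment_eq :
  sint (fun p => Num.max (cw p) 0 * cexp p * p 2 0 ^+ 2) =
  (3^-1 - 2 / 3 * sig) * cZ.
Hypothesis stationary_eq :
  sint (fun p => cind p * cexp p * (p 2 0 ^+ 2 - 3^-1)) = 2 / 3 * lam * cZ.

Let Q : 'M[R]_3 := (- sig) *: deviator (e3 R).
Let eta : R := sig * (3^-1 - alp).
Let k p : R := cexp p / cZ.
Let wH H p : R := cw p + dot (H *m p) p.
Let one : R := sint (fun _ : 'cV[R]_3 => 1 : R).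

Let bz2 : sbm (fun p : 'cV[R]_3 => p 2 0 ^+ 2).
Proof. exact: (sbmX 2 (sbm_coord 2)). Qed.

Let bcw : sbm cw.
Proof. exact: (sbmM (sbm_cst _) (sbmD (sbm_cst _) (sbmN bz2))). Qed.

Let bcexp : sbm cexp.
Proof. exact: (sbm_expR (sbmM (sbm_cst _) bz2)). Qed.

Let bcind : sbm cind.
Proof. exact: sbm_pos_indic bcw. Qed.

Let bk : sbm k.
Proof. exact: (sbmM bcexp (sbm_cst _)). Qed.

Let bwH H : sbm (wH H).
Proof. exact: (sbmD bcw (sbm_quad H)). Qed.

Let bmaxk H : sbm (fun p => Num.max (wH H p) 0 * k p).
Proof. exact: (sbmM (sbm_max0 (bwH H)) bk). Qed.

Let bmax0k : sbm (fun p => Num.max (cw p) 0 * k p).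
Proof. exact: (sbmM (sbm_max0 bcw) bk). Qed.

Let z2_le1 p : sphere R p -> 0 <= p 2 0 ^+ 2 <= 1.
Proof.
move=> Sp; rewrite sqr_ge0 -[X in X <= _]real_normK ?num_real//=.
by rewrite expr_le1// sphere_le1.
Qed.

Let cexp_ge p : sphere R p -> expR (- `|lam|) <= cexp p.
Proof.
move=> /z2_le1/andP[z0 z1]; rewrite ler_expR.
have h1 := ler_norm (- lam); rewrite normrN in h1; have h2 := normr_ge0 lam.
by nra.
Qed.

Let cexp_le p : sphere R p -> cexp p <= expR `|lam|.
Proof.
move=> /z2_le1/andP[z0 z1]; rewrite ler_expR.
by have h1 := ler_norm lam; have h2 := normr_ge0 lam; nra.
Qed.

Let Z_gt0 : 0 < cZ.
Proof.
pose r : R := Num.min 1 (alp / 2).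
have r0 : 0 < r by rewrite lt_min ltr01 divr_gt0.
have r1 : r <= 1 by rewrite ge_min lexx.
have ra : r <= alp / 2 by rewrite ge_min lexx orbT.
pose U := [set p : 'cV[R]_3 | `|p 2 0| < r].
have cc : continuous (fun x : 'cV[R]_3 => `|x 2 0|).
  move=> x; apply: continuous_comp; [exact: coord_continuous|].
  exact: norm_continuous.
apply: (@IS_gt0 R _ U (col3 1 0 0) (sig * (alp / 2) * expR (- `|lam|))).
- exact: sbm_L1 (sbmM (sbm_max0 bcw) bcexp).
- by move=> q _; rewrite mulr_ge0 ?expR_ge0// le_max lexx orbT.
- apply: (@open_comp _ _ (fun x : 'cV[R]_3 => `|x 2 0|)
    [set y | y < r]) => [x _|]; first exact: cc.
  exact: open_lt.
- by rewrite /U /mkset col3E normr0.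
- by apply/sphereP; rewrite !col3E; ring.
- by rewrite col3E.
- by rewrite !mulr_gt0 ?expR_gt0// divr_gt0.
- move=> q Sq /= qr; have q1 := lt_le_trans qr r1; have q2 := lt_le_trans qr ra.
  have qq : q 2 0 ^+ 2 <= alp / 2.
    rewrite -real_normK ?num_real// expr2.
    have := normr_ge0 (q 2 0); move: (`|_|) q1 q2 => x q1 q2 q0; nra.
  apply: ler_pM; last exact: cexp_ge.
  + by rewrite mulr_ge0 ?(ltW sig0)// divr_ge0 ?(ltW alp0).
  + exact: expR_ge0.
  + by rewrite le_max /cw ler_pM2l//; apply/orP; left; lra.
Qed.

Let kmin : R := expR (- `|lam|) / cZ.
Let kmax : R := expR `|lam| / cZ.

Let kmin_gt0 : 0 < kmin. Proof. by rewrite divr_gt0 ?expR_gt0. Qed.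
Let kmax_gt0 : 0 < kmax. Proof. by rewrite divr_gt0 ?expR_gt0. Qed.
Let k_gt0 p : 0 < k p. Proof. by rewrite divr_gt0 ?expR_gt0. Qed.
Let k_ge p : sphere R p -> kmin <= k p.
Proof. by move=> Sp; rewrite ler_pM2r ?invr_gt0// cexp_ge. Qed.
Let k_le p : sphere R p -> k p <= kmax.
Proof. by move=> Sp; rewrite ler_pM2r ?invr_gt0// cexp_le. Qed.

Let mass0 : sint (fun p => Num.max (cw p) 0 * k p) = 1.
Proof.
rewrite -(divff (lt0r_neq0 Z_gt0)) [in X in _ = X / _]/cZ mulrC -ISZ.
  by apply: eq_IS => p _; rewrite /k; ring.
exact: sbm_L1 (sbmM (sbm_max0 bcw) bcexp).
Qed.

Let moment0 : sint (fun p => Num.max (cw p) 0 * k p * p 2 0 ^+ 2) =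
  3^-1 - 2 / 3 * sig.
Proof.
have -> : sint (fun p => Num.max (cw p) 0 * k p * p 2 0 ^+ 2) =
    sint (fun p => cZ^-1 * (Num.max (cw p) 0 * cexp p * p 2 0 ^+ 2)).
  by apply: eq_IS => p _; rewrite /k; ring.
rewrite ISZ; last exact: sbm_L1 (sbmM (sbmM (sbm_max0 bcw) bcexp) bz2).
by rewrite moment_eq mulrC mulfK// gt_eqF.
Qed.

Let QE i j : Q i j = if i == j then if i == 2 then - (2 / 3 * sig) else sig / 3
  else 0.
Proof.
rewrite /Q /deviator !mxE big_ord1 !mxE.
by move: i j; apply: forall3; apply: forall3 => /=; field.
Qed.

Let moment0_full i j :
  sint (fun p => p i 0 * p j 0 * (Num.max (cw p) 0 * k p)) =
  Q i j + (i == j)%:R / 3.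
Proof.
pose phi (t : R) := Num.max (sig * (alp - t ^+ 2)) 0 * (expR (lam * t ^+ 2) / cZ).
have -> : sint (fun p => p i 0 * p j 0 * (Num.max (cw p) 0 * k p)) =
    sint (fun p => phi (p 2 0) * (p i 0 * p j 0)).
  by apply: eq_IS => p _; rewrite mulrC.
rewrite (axisym_moments (phi := phi)); last exact: bmax0k.
have -> : sint (fun p => phi (p 2 0)) = 1 by exact: mass0.
have -> : sint (fun p => phi (p 2 0) * p 2 0 ^+ 2) = 3^-1 - 2 / 3 * sig.
  exact: moment0.
rewrite QE; case: (i == j) => /=; last by rewrite mul0r addr0.
by case: (i == 2); field.
Qed.

Let weightE H p : sphere R p -> weight (Q + H) eta p = wH H p.
Proof.
move=> Sp; rewrite /weight /wH mulmxDl.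
have -> : dot (Q *m p + H *m p) p = dot (Q *m p) p + dot (H *m p) p.
  by rewrite !dotE !mxE; ring.
rewrite addrAC; congr (_ + _); rewrite quadE !sum3 !QE /= /eta /cw.
move/sphereP: Sp => Sp.
have -> : p 2 0 ^+ 2 = 1 - p 0 0 ^+ 2 - p 1 0 ^+ 2 by rewrite -Sp; ring.
have e2 : p 2 0 * p 2 0 = 1 - p 0 0 ^+ 2 - p 1 0 ^+ 2 by rewrite -Sp; ring.
by rewrite e2; field.
Qed.

(** [J0] is the mean of ln k under the candidate and turns out to be J at Q; [rho H] is the excess
    mass of the positive part of the perturbed weight. *)
Let J0 : R := lam * (3^-1 - 2 / 3 * sig) - ln cZ.
Let rho H : R := sint (fun p => Num.max (wH H p) 0 * k p) - 1.

Let lnk p : ln (k p) = lam * p 2 0 ^+ 2 - ln cZ.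
Proof. by rewrite /k ln_div ?posrE ?expR_gt0// expRK. Qed.

Let blnk : sbm (fun p => ln (k p)).
Proof.
have -> : (fun p => ln (k p)) = (fun p => lam * p 2 0 ^+ 2 - ln cZ).
  by apply/funext => p; rewrite lnk.
exact: (sbmD (sbmM (sbm_cst _) bz2) (sbm_cst _)).
Qed.

Let sint_lnk H f : admissible (Q + H) f ->
  sint (fun p => ln (k p) * f p) = J0 + lam * H 2 2.
Proof.
move=> adm; have [f1 mom] := admissible_moment adm.
have lf : sL1 f by case: adm => -[].
have -> : sint (fun p => ln (k p) * f p) =
    sint (fun p => lam * (p 2 0 * p 2 0 * f p) - ln cZ * f p).
  by apply: eq_IS => p _; rewrite lnk; ring.
rewrite ISB; first last.
- exact: sL1Z.
- exact: sL1Z (sbm_int_mul (sbmM (sbm_coord 2) (sbm_coord 2)) lf).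
rewrite !ISZ//; last exact: (sbm_int_mul (sbmM (sbm_coord 2) (sbm_coord 2)) lf).
by rewrite mom f1 mxE QE /= /J0; field.
Qed.

(** Integrate [gibbs] with the perturbed weight but the old k: as ln k is affine in z^2, its mean
    under f depends only on the prescribed moments. *)
Let lower H f : admissible (Q + H) f ->
  ((J0 + lam * H 2 2 - rho H)%:E <= energy (Q + H) eta f)%E.
Proof.
move=> adm; have [f1 _] := admissible_moment adm.
have [[lf f0 _] _] := adm.
pose g p := f p - Num.max (wH H p) 0 * k p + ln (k p) * f p.
have lln : sL1 (fun p => ln (k p) * f p) by exact: sbm_int_mul.
have lm : sL1 (fun p => Num.max (wH H p) 0 * k p) by exact: sbm_L1.
have -> : J0 + lam * H 2 2 - rho H = sint g.
  rewrite /g ISD//; last exact: sL1D (sL1N _).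
  by rewrite ISB// f1 (sint_lnk adm) /rho; ring.
apply: energy_ge.
- exact: sL1_meas.
- exact: sL1D (sL1D lf (sL1N lm)) lln.
have {}f0 : {ae Hmeas R 2, forall p, sphere R p -> 0 <= f p} := f0.
apply: (@filterS _ _ (ae_filter_ringOfSetsType (Hmeas R 2)) _ _ _ f0) => p {}f0 Sp; rewrite /energy_density weightE// /g [ln _ * _]mulrC.
by apply: gibbs => //; exact: f0.
Qed.

(* The positive part is linear off 0, and the set where [cw] is of the size of
   [H] shrinks to a null set. *)
Let rho_deriv (eps : R) : 0 < eps -> exists2 d, 0 < d & forall H,
  Sym0 R H -> `|H| < d -> `|rho H - lam * H 2 2| <= eps * `|H|.
Proof.
move=> eps0.
(* Indicators of shrinking neighbourhoods of the zero set of the weight, which consists of the two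
   parallels z = +- sqrt alp. *)
pose F n p : R := if 0 < n.+1%:R^-1 - `|cw p| then 1 else 0.
have bF n : sbm (F n).
  exact: sbm_pos_indic (sbmD (sbm_cst _) (sbmN (sbm_norm bcw))).
have : sint (F n) @[n --> \oo] --> sint (fun _ : 'cV[R]_3 => 0 : R).
  apply: (sbm_cvg (M := 1)).
  - by move=> n; exact: sbm_meas.
  - exact: sbm_meas (sbm_cst _).
  - by move=> n p _; rewrite /F; case: ifP; rewrite ?normr1 ?normr0.
  have a1 := ae_parallel (Num.sqrt alp).
  have a2 := ae_parallel (- Num.sqrt alp).
  apply: (@filterS2 _ _ (ae_filter_ringOfSetsType (Hmeas R 2)) _ _ _ _ a1 a2) => p h1 h2 Sp.
  have w0 : 0 < `|cw p|.
    rewrite normr_gt0 /cw mulf_neq0//; first by rewrite gt_eqF.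
    rewrite subr_eq0.
    rewrite -[X in X == _](@sqr_sqrtr _ alp) ?ltW// eqf_sqr negb_or.
    by rewrite eq_sym (h1 Sp) -eqr_oppLR eq_sym (h2 Sp).
  apply: cvg_near_cst.
  have := near_infty_natSinv_lt (PosNum w0); apply: filterS => n /= hn.
  by rewrite /F ifF//; apply/negbTE; rewrite -leNgt subr_le0 ltW.
have -> : sint (fun _ : 'cV[R]_3 => 0 : R) = 0.
  have -> : sint (fun _ : 'cV[R]_3 => 0 : R) =
    sint (fun _ : 'cV[R]_3 => 0 * 1 : R) by apply: eq_IS => p _; rewrite mul0r.
  by rewrite ISZ ?mul0r//; exact: sbm_L1 (sbm_cst _).
(* On the bad set the error is at most 9 |H| kmax, by [norm_quad_le] and the bound on k. *)
have ek : 0 < eps / (9 * kmax) by rewrite divr_gt0// mulr_gt0 ?kmax_gt0.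
move=> /cvgrPdist_lt/(_ _ ek)[N _]; move=> /(_ N (leqnn _)); rewrite sub0r normrN => hN.
exists (N.+1%:R^-1 / 9); first by rewrite divr_gt0 ?invr_gt0.
move=> H [Hs trH] Hd.
have Hd' : 9 * `|H| < N.+1%:R^-1 by move: Hd; rewrite ltr_pdivlMr// mulrC.
have bq := sbm_quad H.
have b1 : sbm (fun p => cind p * k p * dot (H *m p) p).
  exact: (sbmM (sbmM bcind bk) bq).
have lin : sint (fun p => cind p * k p * dot (H *m p) p) = lam * H 2 2.
  pose phi (t : R) := (if 0 < sig * (alp - t ^+ 2) then 1 else 0) *
    (expR (lam * t ^+ 2) / cZ).
  have bphi : sbm (fun p : 'cV[R]_3 => phi (p 2 0)) by exact: (sbmM bcind bk).
  have -> : sint (fun p => cind p * k p * dot (H *m p) p) =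
    sint (fun p => phi (p 2 0) * dot (H *m p) p) by [].
  rewrite axisym_quad//.
  set m2 := sint _; set m0 := sint _.
  have : m2 - 3^-1 * m0 = 2 / 3 * lam.
    rewrite /m2 /m0 -ISZ ?ISB; try exact: sbm_L1.
    - have -> : 2 / 3 * lam = cZ^-1 *
        sint (fun p => cind p * cexp p * (p 2 0 ^+ 2 - 3^-1)).
        by rewrite stationary_eq [RHS]mulrC mulfK// gt_eqF.
      rewrite -ISB; [|exact: sbm_L1 (sbmM bphi bz2)
        |exact: sbm_L1 (sbmM (sbm_cst _) bphi)].
      rewrite -ISZ; last exact: sbm_L1 (sbmM (sbmM bcind bcexp)
        (sbmD bz2 (sbm_cst _))).
      by apply: eq_IS => p _; rewrite /phi /cind /cw /cexp; ring.
  move=> e; have -> : 3 * m2 - m0 = 2 * lam by lra.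
  by field.
have -> : rho H - lam * H 2 2 = sint (fun p =>
    (Num.max (wH H p) 0 - Num.max (cw p) 0 - cind p * dot (H *m p) p) * k p).
  rewrite -lin /rho -mass0 -ISB; try exact: sbm_L1.
  rewrite -ISB; [|exact: sbm_L1 (sbmD (bmaxk H) (sbmN bmax0k))|exact: sbm_L1].
  by apply: eq_IS => p _; ring.
apply: (@le_trans _ _ (sint (fun p => 9 * `|H| * kmax * F N p))).
  apply: IS_abs_le.
  - exact: sbm_L1 (sbmM (sbmD (sbmD (sbm_max0 (bwH H)) (sbmN (sbm_max0 bcw)))
      (sbmN (sbmM bcind bq))) bk).
  - exact: sbm_L1 (sbmM (sbm_cst _) (bF N)).
  move=> p Sp; have hq := norm_quad_le H Sp.
  have h := max0_deriv (cw p) hq.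
  have kk := k_le Sp; have k0 := k_gt0 p; have H0 := normr_ge0 H.
  rewrite normrM [X in _ * X <= _]gtr0_norm// /F; move: h.
  case: (leP (`|cw p|) (9 * `|H|)) => cH h.
    rewrite ifT; last by rewrite subr_gt0 (le_lt_trans cH).
    by rewrite mulr1 ler_pM// ltW.
  move: h; rewrite normr_le0 => /eqP h; rewrite /wH /cind h normr0 mul0r.
  apply: mulr_ge0; last by case: ifP.
  by apply: mulr_ge0; [rewrite mulr_ge0|exact: ltW kmax_gt0].
rewrite ISZ; last exact: sbm_L1.
have FN : sint (F N) <= eps / (9 * kmax) by rewrite (le_trans (ler_norm _))// ltW.
apply: (@le_trans _ _ (9 * `|H| * kmax * (eps / (9 * kmax)))).
  apply: ler_wpM2l => //.
  by apply: mulr_ge0; [rewrite mulr_ge0|exact: ltW kmax_gt0].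
rewrite le_eqVlt; apply/orP; left; apply/eqP.
have kn : kmax != 0 by rewrite gt_eqF.
by move: (kmax) kn => x xn; field.
Qed.

(** On the strip z^2 < alp / 2 the weight is at least sig alp / 2 = 2 kap, so a perturbation below
    kap leaves at least kap; [bb] then bounds the weight times k from below. *)
Let kap : R := sig * alp / 4.
Let kap_gt0 : 0 < kap. Proof. by rewrite divr_gt0// mulr_gt0. Qed.
Let bb : R := kap * kmin.
Let bb_gt0 : 0 < bb. Proof. by rewrite mulr_gt0. Qed.
Let wt p : R := if 0 < alp / 2 - p 2 0 ^+ 2 then 1 else 0.
Let bwt : sbm wt.
Proof. exact: sbm_pos_indic (sbmD (sbm_cst _) (sbmN bz2)). Qed.

(* The corrector [wt p * dot (M *m p) p] lives where the weight is bounded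
   below and restores the moment constraint for the perturbed matrix. *)
Let upper : exists C d : R, [/\ 0 <= C, 0 < d & forall H, Sym0 R H -> `|H| < d ->
  exists2 f, admissible (Q + H) f &
  (energy (Q + H) eta f <= (J0 + lam * H 2 2 - rho H + C * `|H| ^+ 2)%:E)%E].
Proof.
have ra : 0 < Num.min 1 (alp / 2) :> R by rewrite lt_min ltr01 divr_gt0.
have wt_ge0 p : sphere R p -> 0 <= wt p by move=> _; rewrite /wt; case: ifP.
have wt_ge1 p : sphere R p -> `|p 1 0| < Num.min 1 (alp / 2) ->
    `|p 2 0| < Num.min 1 (alp / 2) -> 1 <= wt p.
  move=> _ _; rewrite lt_min => /andP[q1 q2].
  rewrite /wt ifT// subr_gt0 -real_normK ?num_real// expr2.
  have := normr_ge0 (p 2 0); move: (`|_|) q1 q2 => x q1 q2 q0; nra.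
have [C1 [C10 solve]] := gram_solve bwt wt_ge0 ra wt_ge1.
have one0 : 0 <= one := sint1_ge0 R.
(* B |H| bounds the moment defect [Y]: the 1 comes from the new target, the rest from the change of
   the positive part. D |H| then bounds the corrector. *)
pose B := 1 + 9 * kmax * one.
have B0 : 0 <= B by rewrite addr_ge0// mulr_ge0// mulr_ge0// ltW.
pose D := 9 * (C1 * B).
have D0 : 0 <= D by rewrite mulr_ge0// mulr_ge0.
(* The first radius keeps the perturbed weight above kap on the strip, the second keeps the
   corrector below bb / 2; C collects the remainder c^2 / bb of [density_le]. *)
exists (D ^+ 2 / bb * one), (Num.min (kap / 9) (bb / 2 / (D + 1))).
split.
- by rewrite mulr_ge0// divr_ge0 ?sqr_ge0// ltW.
- rewrite lt_min; apply/andP; split; first exact: divr_gt0.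
  by apply: divr_gt0; [exact: divr_gt0|rewrite ltr_wpDl].
move=> H [Hs trH]; rewrite lt_min => /andP[Hk Hb].
have H0 := normr_ge0 H.
have Hk' : 9 * `|H| < kap by move: Hk; rewrite ltr_pdivlMr// mulrC.
have Hb' : D * `|H| <= bb / 2.
  move: Hb; rewrite ltr_pdivlMr ?ltr_wpDl// => /ltW; apply: le_trans.
  by rewrite mulrDr mulr1 mulrC lerDl.
pose Y : 'M[R]_3 := \matrix_(i, j) (H i j -
  sint (fun p => p i 0 * p j 0 *
    ((Num.max (wH H p) 0 - Num.max (cw p) 0) * k p))).
have bdiff i j : sbm (fun p => p i 0 * p j 0 *
    ((Num.max (wH H p) 0 - Num.max (cw p) 0) * k p)).
  exact: (sbmM (sbmM (sbm_coord i) (sbm_coord j)) (sbmM (sbmD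
    (sbm_max0 (bwH H)) (sbmN (sbm_max0 bcw))) bk)).
have Ys : Y^T = Y.
  apply/matrixP => i j; rewrite !mxE -{1}Hs mxE; congr (_ - _).
  by apply: eq_IS => p _; rewrite [p j 0 * _]mulrC.
have Yle : `|Y| <= B * `|H|.
  apply/mx_norm_leP; first by rewrite mulr_ge0.
  move=> i j; rewrite mxE; apply: (le_trans (ler_normB _ _)).
  rewrite mulrDl mul1r lerD ?coord_le_norm//.
  have -> : 9 * kmax * one * `|H| = 9 * `|H| * kmax * one by ring.
  apply: IS_bound => [|p Sp]; first exact: bdiff.
  have pp : `|p i 0 * p j 0| <= 1 by rewrite normrM mulr_ile1// sphere_le1.
  rewrite normrM -[leRHS]mul1r ler_pM// normrM (gtr0_norm (k_gt0 p)).
  apply: ler_pM => //; [exact: ltW|  | exact: k_le].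
  apply: (le_trans (max0_lip _ _)).
  by rewrite /wH addrAC subrr add0r norm_quad_le.
have [M [Mle Mint]] := solve Y Ys.
pose c p := wt p * dot (M *m p) p.
have bc : sbm c by exact: (sbmM bwt (sbm_quad M)).
have cle p : sphere R p -> `|c p| <= D * `|H|.
  move=> Sp; rewrite /c normrM -[leRHS]mul1r ler_pM//.
    by rewrite /wt; case: ifP; rewrite ?normr1 ?normr0.
  apply: (le_trans (norm_quad_le M Sp)); rewrite /D -mulrA ler_pM2l//.
  by rewrite (le_trans Mle)// -mulrA ler_wpM2l.
have cK p : sphere R p -> c p = 0 \/ (bb <= wH H p * k p /\ `|c p| <= bb / 2).
  move=> Sp; have [w1|w1] := ltP 0 (alp / 2 - p 2 0 ^+ 2); last first.
    by left; rewrite /c /wt ltNge w1 /= mul0r.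
  right; split; last exact: le_trans (cle _ Sp) Hb'.
  apply: ler_pM; [exact: ltW|exact: ltW| |exact: k_ge].
  have := norm_quad_le H Sp; rewrite ler_norml => /andP[h1 h2].
  rewrite /wH /cw.
  have : sig * (alp / 2) <= sig * (alp - p 2 0 ^+ 2) by rewrite ler_pM2l//; lra.
  by move: Hk'; rewrite /kap; lra.
pose f p := Num.max (wH H p) 0 * k p + c p.
have bf : sbm f by exact: (sbmD (bmaxk H) bc).
have f0 p : sphere R p -> 0 <= f p.
  move=> Sp; rewrite /f; case: (cK p Sp) => [->|[b1]].
    by rewrite addr0 mulr_ge0 ?(ltW (k_gt0 p))// le_max lexx orbT.
  rewrite ler_norml => /andP[c1 c2].
  have : wH H p * k p <= Num.max (wH H p) 0 * k p.
    by rewrite ler_pM2r// le_max lexx.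
  by move: bb_gt0; lra.
have trQ : \tr (Q + H) = 0.
  by rewrite mxtraceD trH addr0 /mxtrace sum3 !QE /=; field.
have adm : admissible (Q + H) f.
  apply: admissible_intro => //; first exact: sbm_L1.
    by apply: aeW => p Sp; exact: f0.
  move=> i j.
  have -> : sint (fun p => p i 0 * p j 0 * f p) =
      sint (fun p => p i 0 * p j 0 * (Num.max (cw p) 0 * k p)) +
      (sint (fun p => p i 0 * p j 0 *
        ((Num.max (wH H p) 0 - Num.max (cw p) 0) * k p)) +
      sint (fun p => p i 0 * p j 0 * c p)).
    have bij := sbmM (sbm_coord i) (sbm_coord j) : sbm (fun p => p i 0 * p j 0).
    rewrite -ISD; [|exact: sbm_L1 (bdiff i j)|exact: sbm_L1 (sbmM bij bc)].
    rewrite -ISD; [|exact: sbm_L1 (sbmM bij bmax0k)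
      |exact: sbm_L1 (sbmD (bdiff i j) (sbmM bij bc))].
    by apply: eq_IS => p _; rewrite /f; ring.
  have QH : (Q + H) i j = Q i j + H i j by rewrite mxE.
  have YE : Y i j = H i j - sint (fun p => p i 0 * p j 0 *
      ((Num.max (wH H p) 0 - Num.max (cw p) 0) * k p)) by rewrite mxE.
  rewrite moment0_full Mint QH YE.
  by rewrite subrKC addrAC.
exists f => //.
have -> : J0 + lam * H 2 2 - rho H + D ^+ 2 / bb * one * `|H| ^+ 2 =
    sint (fun p => ln (k p) * f p + c p + (D * `|H|) ^+ 2 / bb).
  rewrite ISD; [|exact: sbm_L1 (sbmD (sbmM blnk bf) bc)|exact: sbm_L1 (sbm_cst _)].
  rewrite ISD; [|exact: sbm_L1 (sbmM blnk bf)|exact: sbm_L1].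
  rewrite (sint_lnk adm).
  have [f1 _] := admissible_moment adm.
  (* Since f has mass one, the corrector exactly compensates the excess mass; this makes the upper
     bound match the lower one to first order. *)
  have -> : sint c = - rho H.
    move: f1; rewrite /f ISD; [|exact: sbm_L1|exact: sbm_L1].
    by rewrite /rho; lra.
  congr (_ + _).
  have -> : sint (fun _ : 'cV[R]_3 => (D * `|H|) ^+ 2 / bb) =
      sint (fun _ : 'cV[R]_3 => (D * `|H|) ^+ 2 / bb * 1).
    by apply: eq_IS => p _; rewrite mulr1.
  rewrite ISZ; last exact: sbm_L1 (sbm_cst _).
  have h2 (x y z t : R) : x / y * t * z = x * z / y * t by rewrite mulrAC (mulrAC x).
  by rewrite h2 -exprMn.
apply: energy_le; first exact: sbm_meas.
  exact: sbm_L1 (sbmD (sbmD (sbmM blnk bf) bc) (sbm_cst _)).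
apply: aeW => p Sp; rewrite /energy_density weightE//.
apply: (le_trans (density_le (k_gt0 p) bb_gt0 (cK p Sp) erefl)).
rewrite lee_fin [_ * ln _]mulrC lerD2l ler_pM2r ?invr_gt0//.
rewrite -[leLHS]real_normK ?num_real// ler_pXn2r ?nnegrE ?mulr_ge0//.
exact: cle.
Qed.

(** An eigenvalue is the value of the quadratic form at a unit eigenvector; the form of Q is at
    least - 2 sig / 3, and 2 sig < 1 leaves room for H. *)
Let calQ_near H : Sym0 R H -> 9 * `|H| < 3^-1 - 2 / 3 * sig -> calQ (Q + H).
Proof.
move=> [Hs trH] Hlt.
have Qs : (Q + H)^T = Q + H.
  rewrite linearD /= Hs; congr (_ + _); apply/matrixP => i j.
  by rewrite mxE !QE eq_sym; case: eqVneq => // ->.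
have trQ : \tr (Q + H) = 0.
  by rewrite mxtraceD trH addr0 /mxtrace sum3 !QE /=; field.
split; first by split.
have lb a : eigenvalue (Q + H) a -> - (2 / 3 * sig) - 9 * `|H| <= a.
  move=> /eigenvalueP[v vQ v0].
  pose q : 'cV[R]_3 := v^T.
  have q0 : 0 < enorm q.
    rewrite lt_neqAle enorm_ge0 andbT eq_sym; apply: contra v0 => /eqP q0.
    apply/eqP/rowP => j; rewrite mxE.
    by have := coord_le_enorm q j; rewrite q0 normr_le0 mxE => /eqP.
  pose p := (enorm q)^-1 *: q.
  have Sp : sphere R p.
    rewrite /sphere /= /enorm dotE !mxE.
    have -> : (enorm q)^-1 * v 0 0 * ((enorm q)^-1 * v 0 0) +
        (enorm q)^-1 * v 0 1 * ((enorm q)^-1 * v 0 1) +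
        (enorm q)^-1 * v 0 2 * ((enorm q)^-1 * v 0 2) =
        (enorm q)^-1 ^+ 2 * dot q q by rewrite dotE !mxE; ring.
    by rewrite -sqr_enorm -exprMn mulVf ?gt_eqF// expr1n sqrtr1.
  have Mp : (Q + H) *m p = a *: p.
    rewrite /p -scalemxAr scalerA mulrC -scalerA; congr (_ *: _).
    by rewrite /q -{1}Qs -trmx_mul vQ linearZ.
  have aE : a = dot ((Q + H) *m p) p.
    rewrite Mp dotE !mxE.
    have := sphere_dot Sp; rewrite dotE => h.
    rewrite -[LHS]mulr1 -{1}h !mxE; ring.
  have -> : a = sig * (3^-1 - p 2 0 ^+ 2) + dot (H *m p) p.
    have := weightE H Sp; rewrite /weight -aE /wH /cw /eta => h.
    by move: h; lra.
  have := norm_quad_le H Sp; rewrite ler_norml => /andP[h1 h2].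
  have /andP[z0 z1] := z2_le1 Sp.
  have : sig * p 2 0 ^+ 2 <= sig by rewrite ler_piMr// ltW.
  by rewrite mulrBr; lra.
rewrite /vmin; set E := [set a | _].
(* For an empty set of eigenvalues [inf] would be 0, which is also above - 1/3; existence of an
   eigenvalue is thereby avoided. *)
have [E0|/set0P E0] := eqVneq E set0; first by rewrite E0 inf0 oppr_lt0.
apply: (@lt_le_trans _ _ (- (2 / 3 * sig) - 9 * `|H|)); first by lra.
by apply: lb_le_inf.
Qed.

Let J_bounds : exists C d : R, [/\ 0 <= C, 0 < d & forall H, Sym0 R H -> `|H| < d ->
  domJ eta (Q + H) /\
  J0 + lam * H 2 2 - rho H <= fine (J (Q + H) eta) <=
  J0 + lam * H 2 2 - rho H + C * `|H| ^+ 2].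
Proof.
have [C [d [C0 d0 up]]] := upper.
have s0 : 0 < (3^-1 - 2 / 3 * sig) / 9.
  have s2 : 0 < 3^-1 - 2 / 3 * sig.
    by move: sig1; lra.
  by apply: divr_gt0.
exists C, (Num.min d ((3^-1 - 2 / 3 * sig) / 9)); split => //.
  by rewrite lt_min d0.
move=> H Hs; rewrite lt_min => /andP[Hd Hq].
have [f adm fe] := up H Hs Hd.
have lo : ((J0 + lam * H 2 2 - rho H)%:E <= J (Q + H) eta)%E.
  by apply: le_ereal_inf_tmp => _ [g ga <-]; exact: lower.
have hi : (J (Q + H) eta <= (J0 + lam * H 2 2 - rho H + C * `|H| ^+ 2)%:E)%E.
  by apply: le_trans fe; apply: ereal_inf_lbound; exists f.
have finJ : J (Q + H) eta \is a fin_num.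
  by rewrite fin_numE -ltNye -ltey (lt_le_trans _ lo) ?ltNyr// (le_lt_trans hi) ?ltry.
split.
  split; last by rewrite (le_lt_trans hi) ?ltry.
  by apply: calQ_near => //; move: Hq; rewrite ltr_pdivlMr// mulrC.
by rewrite -!lee_fin fineK// lo.
Qed.

Lemma critical_point_of_equations :
  critical_point (sig * (3^-1 - alp)) ((- sig) *: deviator (e3 R)).
Proof.
change (critical_point eta Q).
have [C [d [C0 d0 bounds]]] := J_bounds.
have sym00 : Sym0 R (0 : 'M[R]_3) by split; rewrite ?trmx0 ?mxtrace0.
have n0 : `|0 : 'M[R]_3| = 0 := normr0 _.
have [dom0 J00] : domJ eta Q /\ fine (J Q eta) = J0.
  have [] := bounds 0 sym00; first by rewrite n0.
  rewrite addr0 n0 => dom0 /andP[lo hi]; split=> //.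
  have r0 : rho 0 = 0.
    rewrite /rho -mass0; apply/eqP; rewrite subr_eq0; apply/eqP.
    apply: eq_IS => p _; rewrite /wH mul0mx.
    by rewrite dotE !mxE !mul0r !addr0.
  move: lo hi; rewrite mxE r0 mulr0 expr0n mulr0 subr0 !addr0 => lo hi.
  by apply/eqP; rewrite eq_le lo hi.
split=> //; split=> // eps eps0.
have e20 : 0 < eps / 2 by rewrite divr_gt0.
have [d1 d10 hr] := rho_deriv e20.
(* Below this radius the quadratic error C |H|^2 is at most (eps / 2) |H|. *)
pose d2 := eps / (2 * (C + 1)).
have d20 : 0 < d2 by rewrite divr_gt0// mulr_gt0// ltr_wpDl.
have dm0 : 0 < Num.min d (Num.min d1 d2) by rewrite !lt_min d0 d10.
have nb : \forall H \near (0 : 'M[R]_3), `|H| < Num.min d (Num.min d1 d2).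
  apply/nbhs_ballP; exists (Num.min d (Num.min d1 d2)); first exact: dm0.
  by move=> H; rewrite mx_norm_ball /ball_ /= sub0r normrN.
rewrite near_withinE; apply: filterS nb => H.
rewrite !lt_min => /and3P[Hd Hd1 Hd2] Hs.
have [domH /andP[lo hi]] := bounds H Hs Hd.
split; first exact: domH.
have aux (x y t : R) : y = J0 -> t = 0 -> J0 + lam * H 2 2 - rho H <= x ->
    x <= J0 + lam * H 2 2 - rho H + C * `|H| ^+ 2 ->
    `|x - y - t| <= eps * `|H|.
  move=> -> ->; rewrite subr0 => {}lo {}hi.
  have := hr H Hs Hd1.
  have H0 := normr_ge0 H.
  have CH : C * `|H| ^+ 2 <= eps / 2 * `|H|.
    rewrite expr2 mulrA ler_wpM2r//.
    have : `|H| * (2 * (C + 1)) <= eps.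
      by rewrite -ler_pdivlMr ?mulr_gt0 ?ltr_wpDl// ltW.
    by nra.
  rewrite !ler_norml => /andP[r1 r2].
  by apply/andP; split; lra.
have tr0 : \tr ((0 : 'M[R]_3)^T *m H) = 0 by rewrite trmx0 mul0mx mxtrace0.
exact: (aux _ _ _ J00 tr0 lo hi).
Qed.
End Critical.

(** * Existence of oblate critical points *)

Section CriticalPoints.
Variable R : realType.
Implicit Types (p : 'cV[R]_3) (x y a m : R).

Definition hh x : R := (1 - x) * expR x.

Lemma hh0 : hh 0 = 1. Proof. by rewrite /hh subr0 expR0 mulr1. Qed.

(** The derivative of [hh] is - t e^t <= - t, which suggests the bound. The proof uses only e^t >= 1
    + t, and splits at x = 1 where the factor 1 - x changes sign. *)
Lemma hh_decr x y : 0 <= x -> x <= y -> x * (y - x) <= hh x - hh y.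
Proof.
move=> x0 xy; rewrite /hh.
have ex : 1 <= expR x by rewrite (le_trans _ (expR_ge1Dx x))//; lra.
have ey : 1 <= expR y by rewrite (le_trans _ (expR_ge1Dx y))//; lra.
have [x1|x1] := leP x 1.
  have : expR y * (1 + (x - y)) <= expR x.
    by rewrite -{2}(subrKC y x) expRD ler_pM2l ?expR_gt0// expR_ge1Dx.
  move: (expR x) (expR y) ex ey => u v u1 v1 uv.
  have : (1 - x) * (v * (1 + (x - y))) <= (1 - x) * u by apply: ler_wpM2l => //; lra.
  have -> : (1 - x) * (v * (1 + (x - y))) = v * (1 - y) + v * (x * (y - x)) by ring.
  have : x * (y - x) <= v * (x * (y - x)).
    by apply: ler_peMl => //; apply: mulr_ge0 => //; lra.
  by lra.
have : expR x * (1 + (y - x)) <= expR y.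
  by rewrite -{2}(subrKC x y) expRD ler_pM2l ?expR_gt0// expR_ge1Dx.
move: (expR x) (expR y) ex ey => u v u1 v1 uv.
have : (y - 1) * (u * (1 + (y - x))) <= (y - 1) * v by apply: ler_wpM2l => //; lra.
have -> : (y - 1) * (u * (1 + (y - x))) = u * (x - 1) + u * (y * (y - x)) by ring.
have : y * (y - x) <= u * (y * (y - x)).
  by apply: ler_peMl => //; apply: mulr_ge0; lra.
have : x * (y - x) <= y * (y - x) by apply: ler_wpM2r => //; lra.
by lra.
Qed.

Lemma hh_nincr x y : 0 <= x -> x <= y -> hh y <= hh x.
Proof.
move=> x0 xy; have := hh_decr x0 xy.
by have : 0 <= x * (y - x) by [apply: mulr_ge0 => //; lra]; lra.
Qed.

Lemma hh_le1 x : 0 <= x -> hh x <= 1.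
Proof. by move=> x0; rewrite -hh0 hh_nincr. Qed.

Lemma hh_le_sub x : 1 <= x -> hh x <= 1 - x.
Proof.
move=> x1; rewrite /hh; have := expR_ge1Dx x.
by move: (expR x) => u hu; nra.
Qed.

Lemma continuous_hh : continuous hh.
Proof.
move=> x; apply: cvgM; last exact: continuous_expR.
by apply: cvgB; [exact: cvg_cst|exact: cvg_id].
Qed.

(** Bounded convergence along a real parameter, reduced to sequences tending to a. *)
Lemma sint_cvg_at (F : R -> 'cV[R]_3 -> R) a (M : R) :
  (forall x, smeas (F x)) ->
  (\forall x \near a, forall p, sphere R p -> `|F x p| <= M) ->
  {ae Hmeas R 2, forall p, sphere R p -> F x p @[x --> a] --> F a p} ->
  sint (F x) @[x --> a] --> sint (F a).
Proof.
move=> mF bF cF; apply/(@cvg_nbhsP _ R^o) => u ua.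
have [N _ hN] : \forall n \near \oo, forall p, sphere R p -> `|F (u n) p| <= M.
  exact: ua _ bF.
(* The bound holds only near a, so the first terms of the sequence are dropped. *)
rewrite -(cvg_shiftn N) /=.
have uaN : u (n + N) @[n --> \oo] --> a by rewrite (cvg_shiftn N).
apply: (@sbm_cvg R (fun n => F (u (n + N))) (F a) M) => //.
  by move=> n p Sp; apply: hN => //=; exact: leq_addl.
apply: (@filterS _ _ (ae_filter_ringOfSetsType (Hmeas R 2)) _ _ _ cF) => p h Sp.
exact: (cvg_comp _ _ uaN (h Sp)).
Qed.

Definition ind x : R := if 0 < x then 1 else 0.

Lemma ind_cvg (b : R -> R) a : b x @[x --> a] --> b a -> b a != 0 ->
  ind (b x) @[x --> a] --> ind (b a).
Proof.
move=> cb b0; apply: cvg_near_cst; rewrite /ind.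
have [bp|bn] := ltP 0 (b a).
  by apply: filterS (cvgr_gt _ cb _ bp) => x xp; rewrite xp.
have {bn} bn : b a < 0 by rewrite lt_neqAle b0.
by apply: filterS (cvgr_lt _ cb _ bn) => x xn; rewrite ltNge (ltW xn).
Qed.

(* For the multiplier [lam = - m] and [alp = a], the equation [balance a m = 0]
   is what remains of the stationarity condition when [sig] is eliminated with
   the moment condition, which reads [sig = order_of]. *)
Definition slack a p : R := a - p 2 0 ^+ 2.
Definition mint a m p : R := (1 - 3 * p 2 0 ^+ 2) * (ind (slack a p) * hh (m * slack a p)).
Definition balance a m : R := sint (mint a m).

Let bz2 : sbm (fun p => p 2 0 ^+ 2).
Proof. exact: (sbmX 2 (sbm_coord 2)). Qed.

Let bslack a : sbm (slack a).
Proof. exact: (sbmD (sbm_cst _) (sbmN bz2)). Qed.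

Let b13 : sbm (fun p => 1 - 3 * p 2 0 ^+ 2).
Proof. exact: (sbmD (sbm_cst _) (sbmN (sbmM (sbm_cst _) bz2))). Qed.

Let bind_ a : sbm (fun p => ind (slack a p)).
Proof. exact: sbm_pos_indic (bslack a). Qed.

Let bexp a m : sbm (fun p => expR (m * slack a p)).
Proof. exact: sbm_expR (sbmM (sbm_cst m) (bslack a)). Qed.

Let bhh a m : sbm (fun p => hh (m * slack a p)).
Proof.
exact: (sbmM (sbmD (sbm_cst _) (sbmN (sbmM (sbm_cst m) (bslack a)))) (bexp a m)).
Qed.

Let bmint a m : sbm (mint a m).
Proof. exact: (sbmM b13 (sbmM (bind_ a) (bhh a m))). Qed.

Lemma sqr_z p : sphere R p -> 0 <= p 2 0 ^+ 2 <= 1.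
Proof.
move=> Sp; rewrite sqr_ge0 -[X in X <= _]real_normK ?num_real//=.
by rewrite expr_le1// sphere_le1.
Qed.

Lemma IS_gt0_band (f : 'cV[R]_3 -> R) (lo hi z c : R) :
  sL1 f -> (forall p, sphere R p -> 0 <= f p) ->
  lo < z -> z < hi -> z ^+ 2 < 1 -> 0 < c ->
  (forall p, sphere R p -> lo < p 2 0 < hi -> c <= f p) -> 0 < sint f.
Proof.
move=> lf f0 loz zhi z1 c0 cf.
pose U := [set p : 'cV[R]_3 | lo < p 2 0] `&` [set p : 'cV[R]_3 | p 2 0 < hi].
have cc : continuous (fun p : 'cV[R]_3 => p 2 0).
  by move=> p; exact: coord_continuous.
apply: (@IS_gt0 R f U (col3 (Num.sqrt (1 - z ^+ 2)) 0 z) c) => //.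
- apply: openI.
    by apply: (@open_comp _ _ (fun p : 'cV[R]_3 => p 2 0) [set y | lo < y])
      => [x _|]; [exact: cc|exact: open_gt].
  by apply: (@open_comp _ _ (fun p : 'cV[R]_3 => p 2 0) [set y | y < hi])
      => [x _|]; [exact: cc|exact: open_lt].
- by split; rewrite /= col3E.
- apply/sphereP; rewrite !col3E sqr_sqrtr; first by ring.
  by rewrite subr_ge0 ltW.
- by rewrite col3E sqrtr_gt0 subr_gt0.
- by move=> q Sq [/= q1 q2]; apply: cf => //; apply/andP.
Qed.

Lemma band_sqr a p : 0 < a -> a <= 3^-1 -> - (a / 2) < p 2 0 < a / 2 ->
  p 2 0 ^+ 2 <= a / 2.
Proof.
move=> a0 a3 /andP[q1 q2].
have h : `|p 2 0| < a / 2 by rewrite ltr_norml q1.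
rewrite -real_normK ?num_real// expr2.
by have := normr_ge0 (p 2 0); move: (`|_|) h => x h x0; nra.
Qed.

Let ge13 a p : a <= 3^-1 -> 0 < slack a p -> 0 <= 1 - 3 * p 2 0 ^+ 2.
Proof. by rewrite /slack; move: (p 2 0 ^+ 2) => t; lra. Qed.

(** Since a <= 1/3, the factor 1 - 3 z^2 is nonnegative where the slack is positive, so the
    integrand inherits the monotonicity of [hh]; a band around the equator makes the inequality
    strict. *)
Lemma balance_decr a m1 m2 : 0 < a -> a <= 3^-1 -> 0 < m1 -> m1 < m2 ->
  balance a m2 < balance a m1.
Proof.
move=> a0 a3 m10 m12; rewrite -subr_gt0 /balance -ISB; try exact: sbm_L1.
(* On this band z^2 <= a / 2 <= 1/6, so 1 - 3 z^2 >= 1/2 and the slack is at least a / 2; [hh_decr]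
   gives the other factors. *)
apply: (@IS_gt0_band _ (- (a / 2)) (a / 2) 0
  (2^-1 * (m1 * (a / 2) * ((m2 - m1) * (a / 2))))).
- exact: sbm_L1 (sbmD (bmint a m1) (sbmN (bmint a m2))).
- move=> p Sp; rewrite /mint -mulrBr -mulrBr /ind.
  case: ifPn => [s0|_]; last by rewrite mul0r mulr0.
  rewrite mul1r mulr_ge0//; first exact: ge13 s0.
  rewrite subr_ge0 hh_nincr//; first by rewrite mulr_ge0 ?ltW.
  by rewrite ler_pM2r// ltW.
- by rewrite oppr_lt0 divr_gt0.
- by rewrite divr_gt0.
- by rewrite expr0n ltr01.
- rewrite mulr_gt0 ?invr_gt0// mulr_gt0 ?mulr_gt0 ?divr_gt0// subr_gt0.
  exact: m12.
- move=> p Sp /(band_sqr a0 a3) z2.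
  have s2 : a / 2 <= slack a p by rewrite /slack; lra.
  have s0 : 0 < slack a p by apply: lt_le_trans s2; rewrite divr_gt0.
  rewrite /mint -mulrBr -mulrBr /ind s0 mul1r.
  apply: ler_pM.
  + by rewrite invr_ge0.
  + by rewrite !mulr_ge0 ?subr_ge0 ?ltW// divr_gt0.
  + by lra.
  have m1s : 0 <= m1 * slack a p by rewrite mulr_ge0 ?ltW.
  have m12s : m1 * slack a p <= m2 * slack a p by rewrite ler_pM2r// ltW.
  apply: le_trans (hh_decr m1s m12s).
  rewrite -mulrBl; apply: ler_pM.
  + by rewrite mulr_ge0 ?ltW// divr_gt0.
  + by rewrite mulr_ge0 ?subr_ge0 ?ltW// divr_gt0.
  + by rewrite ler_pM2l.
  + by rewrite ler_pM2l// subr_gt0.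
Qed.

Let mint_bound a m p : a <= 1 -> 0 <= m -> sphere R p ->
  `|mint a m p| <= 2 * ((1 + m) * expR m).
Proof.
move=> a1 m0 Sp; have /andP[z0 z1] := sqr_z Sp.
rewrite /mint normrM; apply: ler_pM => //.
  by rewrite ler_norml; apply/andP; split; lra.
rewrite /ind; case: ifPn => [s0|_]; last first.
  by rewrite mul0r normr0 mulr_ge0 ?expR_ge0// addr_ge0.
rewrite mul1r /hh normrM (gtr0_norm (expR_gt0 _)).
have s1 : slack a p <= 1 by rewrite /slack; lra.
have ms : 0 <= m * slack a p <= m.
  by rewrite mulr_ge0 ?(ltW s0)//= ler_piMr.
have /andP[ms0 ms1] := ms.
apply: ler_pM; [exact: normr_ge0|exact: expR_ge0| |by rewrite ler_expR].
by rewrite ler_norml; apply/andP; split; lra.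
Qed.

Lemma balance_cvg_m a m : a <= 1 -> 0 < m ->
  balance a x @[x --> m] --> balance a m.
Proof.
move=> a1 m0; apply: (@sint_cvg_at _ m (2 * ((1 + (m + 1)) * expR (m + 1)))).
- by move=> x; exact: sbm_meas.
- have n1 : \forall x \near m, 0 < x by apply: (@cvgr_gt _ _ _ _ id m cvg_id).
  have n2 : \forall x \near m, x < m + 1.
    by apply: (@cvgr_lt _ _ _ _ id m cvg_id); rewrite ltrDl.
  apply: filterS2 n1 n2 => x x0 x1 p Sp.
  apply: (le_trans (mint_bound a1 (ltW x0) Sp)).
  apply: ler_wpM2l => //.
  apply: ler_pM; [lra|exact: expR_ge0|lra|by rewrite ler_expR ltW].
- apply: aeW => p Sp; apply: cvgM; first exact: cvg_cst.
  apply: cvgM; first exact: cvg_cst.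
  apply: (@continuous_comp _ _ _ (fun x => x * slack a p) hh); last exact: continuous_hh.
  by apply: cvgM; [exact: cvg_id|exact: cvg_cst].
Qed.

Lemma ae_slack a : {ae Hmeas R 2, forall p, sphere R p -> slack a p != 0}.
Proof.
have a1 := ae_parallel (Num.sqrt a).
have a2 := ae_parallel (- Num.sqrt a).
apply: (@filterS2 _ _ (ae_filter_ringOfSetsType (Hmeas R 2)) _ _ _ _ a1 a2) => p h1 h2 Sp.
have [a0|a0] := leP 0 a.
  rewrite /slack subr_eq0 -[X in X == _](@sqr_sqrtr _ a)// eqf_sqr negb_or.
  by rewrite eq_sym (h1 Sp) -eqr_oppLR eq_sym (h2 Sp).
by rewrite /slack lt_eqF// subr_lt0 (lt_le_trans a0)// sqr_ge0.
Qed.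

(** The indicator jumps only where the slack vanishes, which is a null union of parallels. *)
Lemma balance_cvg_a (b : R -> R) a m : 0 < m -> b x @[x --> a] --> b a ->
  (forall x, b x <= 1) ->
  balance (b x) m @[x --> a] --> balance (b a) m.
Proof.
move=> m0 cb b1.
apply: (@sint_cvg_at (fun x => mint (b x) m) a (2 * ((1 + m) * expR m))).
- by move=> x; exact: sbm_meas.
- have bb x p : sphere R p -> `|mint (b x) m p| <= 2 * ((1 + m) * expR m).
    by move=> Sp; exact: mint_bound (b1 x) (ltW m0) Sp.
  by near=> x => p Sp; exact: bb.
apply: (@filterS _ _ (ae_filter_ringOfSetsType (Hmeas R 2)) _ _ _
  (ae_slack (b a))) => p h Sp.
have cs : slack (b x) p @[x --> a] --> slack (b a) p.
  exact: (cvgB cb (cvg_cst _)).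
apply: cvgM; first exact: cvg_cst.
apply: cvgM.
  exact: (@ind_cvg (fun x => slack (b x) p) a cs (h Sp)).
apply: (@continuous_comp _ _ _ (fun x => m * slack (b x) p) hh); last exact: continuous_hh.
exact: (cvgM (cvg_cst _) cs).
Unshelve. all: by end_near. Qed.

(** The balance is nonnegative for small m, where [hh] is close to 1, and nonpositive for large m,
    where [hh] is very negative on the inner strip z^2 < a / 2. *)
Lemma balance_root a : 0 < a -> a <= 3^-1 -> exists2 m, 0 < m & balance a m = 0.
Proof.
move=> a0 a3.
pose P' := sint (fun p => (1 - 3 * p 2 0 ^+ 2) * ind (slack (a / 2) p)).
have bP' : sbm (fun p => (1 - 3 * p 2 0 ^+ 2) * ind (slack (a / 2) p)).
  exact: (sbmM b13 (bind_ _)).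
pose P := sint (fun p => (1 - 3 * p 2 0 ^+ 2) * ind (slack a p)).
have bP : sbm (fun p => (1 - 3 * p 2 0 ^+ 2) * ind (slack a p)).
  exact: (sbmM b13 (bind_ _)).
have P'0 : 0 < P'.
  apply: (@IS_gt0_band _ (- (a / 4)) (a / 4) 0 (2^-1)).
  - exact: sbm_L1.
  - move=> p Sp; rewrite /ind; case: ifPn => [s0|_]; last by rewrite mulr0.
    by rewrite mulr1; apply: ge13 s0; lra.
  - by rewrite oppr_lt0 divr_gt0.
  - by rewrite divr_gt0.
  - by rewrite expr0n ltr01.
  - by rewrite invr_gt0.
  - move=> p Sp hp.
    have z2 : p 2 0 ^+ 2 <= a / 2 / 2.
      apply: band_sqr; [by rewrite divr_gt0|by lra|].
      by move/andP: hp => [h1 h2]; apply/andP; split; lra.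
    rewrite /ind ifT; first by lra.
    by rewrite /slack; lra.
(* On the inner strip m times the slack exceeds m a / 2 >= 1, so hh <= 1 - m a / 2 there; elsewhere
   hh <= 1. *)
have Gm m : 2 / a <= m -> balance a m <= P - (m * (a / 2) * P').
  move=> ma.
  have m0 : 0 < m by apply: lt_le_trans ma; rewrite divr_gt0.
  have ma1 : 1 <= m * (a / 2).
    by move: ma; rewrite ler_pdivrMr//; lra.
  rewrite /P /P' -(ISZ _ (sbm_L1 bP')).
  rewrite -(ISB (sbm_L1 bP) (sbm_L1 (sbmM (sbm_cst _) bP'))).
  apply: IS_le => [||p Sp]; first exact: sbm_L1.
    exact: sbm_L1 (sbmD bP (sbmN (sbmM (sbm_cst _) bP'))).
  rewrite /mint [X in _ <= X](_ : _ = (1 - 3 * p 2 0 ^+ 2) *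
    (ind (slack a p) - m * (a / 2) * ind (slack (a / 2) p))); last by ring.
  have [s0|s0] := ltP 0 (slack a p); last first.
    rewrite /ind ltNge s0 /= ltNge.
    have -> : slack (a / 2) p <= 0 by move: s0; rewrite /slack; lra.
    by rewrite /= mulr0 subr0 !mul0r.
  have c0 := ge13 a3 s0.
  rewrite {1}/ind s0 mul1r ler_wpM2l// /ind s0.
  case: ifPn => [s2|_].
    rewrite mulr1.
    have : m * (a / 2) <= m * slack a p.
      by rewrite ler_pM2l//; move: s2; rewrite /slack; lra.
    move=> h; have := hh_le_sub (le_trans ma1 h); lra.
  by rewrite mulr0 subr0 hh_le1// mulr_ge0// ltW.
have P0 : 0 < P.
  apply: lt_le_trans P'0 _; apply: IS_le => [||p Sp]; try exact: sbm_L1.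
  have [s0|s0] := ltP 0 (slack (a / 2) p).
    rewrite /ind s0 ifT//.
    by move: s0; rewrite /slack; lra.
  rewrite {1}/ind ltNge s0 /= mulr0 /ind; case: ifPn => [s1|_]; rewrite ?mulr0//.
  by rewrite mulr1; exact: ge13 s1.
have G0 : exists2 m, 0 < m & 0 <= balance a m.
  (* For 0 < m <= 1 the balance is at least (1 - m) P >= 0. *)
  pose m := Num.min 1 (P / (P + 1)).
  have m0 : 0 < m by rewrite lt_min ltr01 divr_gt0// addr_gt0.
  exists m => //.
  have lb p : sphere R p -> (1 - m) * ((1 - 3 * p 2 0 ^+ 2) * ind (slack a p)) <=
      mint a m p.
    move=> Sp; rewrite /mint mulrCA; rewrite /ind; case: ifPn => [s0|_].
      rewrite mulr1 mul1r ler_wpM2l//; first exact: ge13 s0.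
      have s1 : slack a p <= 1.
        by have /andP[z0 z1] := sqr_z Sp; rewrite /slack; lra.
      have ms : 0 <= m * slack a p <= m.
        by rewrite mulr_ge0 ?(ltW s0) ?(ltW m0)//= ler_piMr// ltW.
      have /andP[ms0 ms1] := ms.
      have m1 : m <= 1 by rewrite ge_min lexx.
      rewrite /hh; have := expR_ge1Dx (m * slack a p).
      move: (m * slack a p) ms0 ms1 => t t0 t1 e.
      have : (1 - t) * 1 <= (1 - t) * expR t by apply: ler_wpM2l; lra.
      by lra.
    by rewrite mul0r mulr0.
  have : sint (fun p => (1 - m) * ((1 - 3 * p 2 0 ^+ 2) * ind (slack a p))) <=
      balance a m.
    apply: IS_le => [||p Sp]; [exact: sbm_L1 (sbmM (sbm_cst _) bP)
      |exact: sbm_L1 (bmint _ _)|exact: lb].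
  rewrite ISZ; last exact: sbm_L1.
  apply: le_trans; apply: mulr_ge0; last exact: ltW.
  by rewrite subr_ge0 ge_min lexx.
have [m1 m10 Gm1] := G0.
(* The three terms ensure that [Gm] applies, that its bound is nonpositive, and that m1 < m2. *)
pose m2 := Num.max (Num.max (2 / a) (P / (a / 2 * P'))) (m1 + 1).
have m12 : m1 < m2 by rewrite lt_max ltrDl ltr01 orbT.
have Gm2 : balance a m2 <= 0.
  have h1 : 2 / a <= m2 by rewrite !le_max lexx.
  apply: (le_trans (Gm _ h1)); rewrite subr_le0 -mulrA -ler_pdivrMr.
    by rewrite !le_max lexx orbT.
  by rewrite mulr_gt0// divr_gt0.
have [||c] := @IVT R (balance a) m1 m2 0 (ltW m12).
- apply: continuous_in_subspaceT => x /set_mem; rewrite /= in_itv /= => /andP[x1 _].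
  apply: balance_cvg_m; first by lra.
  exact: lt_le_trans x1.
- by rewrite ge_min Gm2 orbT le_max Gm1.
rewrite in_itv /= => /andP[c1 _] Gc.
by exists c => //; exact: lt_le_trans c1.
Qed.

(* Truncating at 1/3 makes [eta_of] continuous on a neighbourhood of the
   parameter 1/3, where it vanishes; [mult x] is junk for [x <= 0]. *)
Definition clip x : R := Num.min x 3^-1.
Definition mult x : R := xget 0 [set m | 0 < m /\ balance (clip x) m = 0].

Lemma clip_gt0 x : 0 < x -> 0 < clip x.
Proof. by move=> x0; rewrite /clip lt_min x0 invr_gt0 ltr0n. Qed.

Lemma clip_le x : clip x <= 3^-1.
Proof. by rewrite /clip ge_min lexx orbT. Qed.

Lemma clip_le1 x : clip x <= 1.
Proof. by rewrite (le_trans (clip_le x))//; lra. Qed.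

Lemma clip_cvg x : clip y @[y --> x] --> clip x.
Proof.
apply: (@continuous_min _ _ (id : R -> R^o) (fun=> 3^-1) x); first exact: cvg_id.
exact: cvg_cst.
Qed.

Lemma multP x : 0 < x -> 0 < mult x /\ balance (clip x) (mult x) = 0.
Proof.
move=> x0; rewrite /mult; case: xgetP => [m -> []//|no].
have [m m0 Gm] := balance_root (clip_gt0 x0) (clip_le x).
by exfalso; apply: (no m).
Qed.

(** Strict monotonicity in m gives opposite signs of the balance at mult x - d and mult x + d; these
    signs persist for nearby y and trap the root mult y. *)
Lemma mult_cvg x : 0 < x -> mult y @[y --> x] --> mult x.
Proof.
move=> x0; have [m0 Gm] := multP x0.
apply/cvgrPdist_lt => eps eps0.
have key (u v w : R) : w <= eps / 2 -> u - w < v -> v < u + w -> `|u - v| < eps.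
  by move=> *; rewrite ltr_norml; apply/andP; split; lra.
pose d := Num.min (eps / 2) (mult x / 2).
have d0 : 0 < d by rewrite lt_min !divr_gt0.
have d1 : d <= eps / 2 by rewrite ge_min lexx.
have d2 : d <= mult x / 2 by rewrite ge_min lexx orbT.
have lo0 : 0 < mult x - d by lra.
have hi0 : 0 < mult x + d by lra.
have Glo : 0 < balance (clip x) (mult x - d).
  by rewrite -[X in X < _]Gm; apply: balance_decr (clip_gt0 x0) (clip_le x) lo0 _; lra.
have Ghi : balance (clip x) (mult x + d) < 0.
  by rewrite -[X in _ < X]Gm; apply: balance_decr (clip_gt0 x0) (clip_le x) m0 _; lra.
have n1 := cvgr_gt _ (balance_cvg_a lo0 (@clip_cvg x) clip_le1) _ Glo.
have n2 := cvgr_lt _ (balance_cvg_a hi0 (@clip_cvg x) clip_le1) _ Ghi.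
have n3 : \forall y \near x, 0 < y by apply: (@cvgr_gt _ _ _ _ id x cvg_id).
near=> y.
have y1 : 0 < balance (clip y) (mult x - d) by near: y; exact: n1.
have y2 : balance (clip y) (mult x + d) < 0 by near: y; exact: n2.
have y0 : 0 < y by near: y; exact: n3.
have [my Gy] := multP y0.
have c0 := clip_gt0 y0; have c3 := clip_le y.
have h1 : mult x - d < mult y.
  rewrite ltNge; apply/negP; rewrite le_eqVlt => /predU1P[e|h].
    by move: y1; rewrite -e Gy ltxx.
  by have := balance_decr c0 c3 my h; rewrite Gy => /(lt_trans y1); rewrite ltxx.
have h2 : mult y < mult x + d.
  rewrite ltNge; apply/negP; rewrite le_eqVlt => /predU1P[e|h].
    by move: y2; rewrite e Gy ltxx.
  by have := balance_decr c0 c3 hi0 h; rewrite Gy => /lt_trans/(_ y2); rewrite ltxx.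
exact: key d1 h1 h2.
Unshelve. all: by end_near. Qed.

(** Up to a positive factor independent of p this is the candidate density: the exponent m (a - z^2)
    replaces lam z^2 with lam = - m. *)
Definition dens x p : R :=
  Num.max (slack (clip x) p) 0 * expR (mult x * slack (clip x) p).
Definition N0 x : R := sint (dens x).
Definition N2 x : R := sint (fun p => dens x p * p 2 0 ^+ 2).

Let bdens x : sbm (dens x).
Proof. exact: (sbmM (sbm_max0 (bslack _)) (bexp _ _)). Qed.

Let bdens2 x : sbm (fun p => dens x p * p 2 0 ^+ 2).
Proof. exact: (sbmM (bdens x) bz2). Qed.

Let dens_ge0 x p : 0 <= dens x p.
Proof. by rewrite mulr_ge0 ?expR_ge0// le_max lexx orbT. Qed.

Let dens_ge x p (c : R) : 0 < x -> 0 < c -> c <= slack (clip x) p -> c <= dens x p.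
Proof.
move=> x0 c0 cs; have [m0 _] := multP x0.
rewrite /dens -[leLHS]mulr1; apply: ler_pM => //; first exact: ltW.
  by rewrite le_max cs.
rewrite -expR0 ler_expR mulr_ge0 ?(ltW m0)// (le_trans (ltW c0))//.
Qed.

Lemma N0_gt0 x : 0 < x -> 0 < N0 x.
Proof.
move=> x0; have c0 := clip_gt0 x0; have c3 := clip_le x.
apply: (@IS_gt0_band _ (- (clip x / 2)) (clip x / 2) 0 (clip x / 2)).
- exact: sbm_L1.
- by move=> p _; exact: dens_ge0.
- by rewrite oppr_lt0 divr_gt0.
- by rewrite divr_gt0.
- by rewrite expr0n ltr01.
- by rewrite divr_gt0.
- move=> p Sp /(band_sqr c0 c3) z2; apply: dens_ge => //; first by rewrite divr_gt0.
  by rewrite /slack; lra.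
Qed.

(** Yields 2 [order_of] < 1. The test band avoids the equator, where z^2 vanishes. *)
Lemma N2_gt0 x : 0 < x -> 0 < N2 x.
Proof.
move=> x0; have c0 := clip_gt0 x0; have c3 := clip_le x.
move: (clip x) c0 c3 (@dens_ge x) => a a0 a3 dge.
apply: (@IS_gt0_band _ (a / 4) (a / 2) (3 / 8 * a) (a / 2 * (a / 4) ^+ 2)).
- exact: sbm_L1.
- by move=> p _; rewrite mulr_ge0 ?sqr_ge0.
- by lra.
- by lra.
- by nra.
- by rewrite mulr_gt0 ?exprn_gt0// divr_gt0.
- move=> p Sp /andP[z1 z2].
  have z2' : p 2 0 ^+ 2 <= a / 2.
    by apply: band_sqr => //; apply/andP; split; lra.
  have hs : a / 2 <= slack a p by rewrite /slack; lra.
  apply: ler_pM.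
  + by rewrite divr_ge0// ltW.
  + by rewrite sqr_ge0.
  + by apply: dge => //; rewrite divr_gt0.
  + by rewrite ler_pXn2r ?nnegrE ?divr_ge0 ?ltW//; lra.
Qed.

(** Yields [order_of] > 0; the density lives where z^2 < clip x <= 1/3. *)
Lemma N2_lt x : 0 < x -> 3 * N2 x < N0 x.
Proof.
move=> x0; have c0 := clip_gt0 x0; have c3 := clip_le x.
rewrite -subr_gt0 /N0 /N2 -(ISZ _ (sbm_L1 (bdens2 x))).
rewrite -(ISB (sbm_L1 (bdens x)) (sbm_L1 (sbmM (sbm_cst _) (bdens2 x)))).
apply: (@IS_gt0_band _ (- (clip x / 2)) (clip x / 2) 0 (clip x / 2 * 2^-1)).
- exact: sbm_L1 (sbmD (bdens x) (sbmN (sbmM (sbm_cst _) (bdens2 x)))).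
- move=> p _; have -> : dens x p - 3 * (dens x p * p 2 0 ^+ 2) =
    dens x p * (1 - 3 * p 2 0 ^+ 2) by ring.
  have [s0|s0] := ltP 0 (slack (clip x) p).
    by rewrite mulr_ge0//; exact: ge13 s0.
  by rewrite /dens max_r// !mul0r.
- by rewrite oppr_lt0 divr_gt0.
- by rewrite divr_gt0.
- by rewrite expr0n ltr01.
- by rewrite mulr_gt0 ?invr_gt0// divr_gt0.
- move=> p Sp /(band_sqr c0 c3) z2.
  have -> : dens x p - 3 * (dens x p * p 2 0 ^+ 2) =
    dens x p * (1 - 3 * p 2 0 ^+ 2) by ring.
  apply: ler_pM; [by rewrite divr_ge0// ltW|by rewrite invr_ge0| |by lra].
  by apply: dens_ge => //; [rewrite divr_gt0|rewrite /slack; lra].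
Qed.

Lemma N2_le x : 0 < x -> N2 x <= clip x * N0 x.
Proof.
move=> x0; rewrite /N0 /N2 -ISZ; last exact: sbm_L1.
apply: IS_le => [||p Sp]; first exact: sbm_L1.
  exact: sbm_L1 (sbmM (sbm_cst _) (bdens x)).
have [s0|s0] := ltP 0 (slack (clip x) p).
  by rewrite mulrC ler_wpM2r//; move: s0; rewrite /slack; lra.
by rewrite /dens max_r// !mul0r mulr0.
Qed.

Let dens_cvg x p : 0 < x -> dens y p @[y --> x] --> dens x p.
Proof.
move=> x0.
have cs : slack (clip y) p @[y --> x] --> slack (clip x) p.
  by apply: cvgB; [exact: clip_cvg|exact: cvg_cst].
apply: cvgM.
  apply: (@continuous_max _ _ (fun y => slack (clip y) p : R^o) (fun=> 0) x _ (cvg_cst _)).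
  exact: cs.
apply: (@continuous_comp _ _ _ (fun y => mult y * slack (clip y) p) expR);
  last exact: continuous_expR.
exact: (cvgM (mult_cvg x0) cs).
Qed.

Lemma slack_clip_le1 x p : sphere R p -> slack (clip x) p <= 1.
Proof.
by move=> Sp; have := clip_le1 x; have /andP[z0 z1] := sqr_z Sp; rewrite /slack; lra.
Qed.

Let dens_bound x : 0 < x -> \forall y \near x, forall p, sphere R p ->
  `|dens y p| <= expR (mult x + 1).
Proof.
move=> x0.
have n1 := cvgr_lt _ (mult_cvg x0) _ (ltr_pwDr ltr01 (lexx (mult x))).
have n3 : \forall y \near x, 0 < y by apply: (@cvgr_gt _ _ _ _ id x cvg_id).
near=> y => p Sp.
have y1 : mult y < mult x + 1 by near: y; exact: n1.
have y0 : 0 < y by near: y; exact: n3.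
have [m0 _] := multP y0.
have s1 : slack (clip y) p <= 1.
  exact: slack_clip_le1.
rewrite ger0_norm// /dens -[leRHS]mul1r; apply: ler_pM.
- by rewrite le_max lexx orbT.
- exact: expR_ge0.
- by rewrite ge_max s1 ler01.
rewrite ler_expR (le_trans _ (ltW y1))//.
by rewrite -[leRHS]mulr1 ler_pM2l.
Unshelve. all: by end_near. Qed.

Lemma N0_cvg x : 0 < x -> N0 y @[y --> x] --> N0 x.
Proof.
move=> x0; apply: (sint_cvg_at _ (dens_bound x0)).
  by move=> y; exact: sbm_meas.
by apply: aeW => p Sp; exact: dens_cvg.
Qed.

Lemma N2_cvg x : 0 < x -> N2 y @[y --> x] --> N2 x.
Proof.
move=> x0.
apply: (@sint_cvg_at (fun y p => dens y p * p 2 0 ^+ 2) x (expR (mult x + 1))).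
- by move=> y; exact: sbm_meas.
- have := dens_bound x0; apply: filterS => y h p Sp.
  have /andP[z0 z1] := sqr_z Sp.
  rewrite normrM -[leRHS]mulr1 ler_pM//; first exact: h.
  by rewrite ger0_norm.
- by apply: aeW => p Sp; apply: cvgM; [exact: dens_cvg|exact: cvg_cst].
Qed.

Definition order_of x : R := (1 - 3 * (N2 x / N0 x)) / 2.
Definition eta_of x : R := order_of x * (3^-1 - clip x).

Lemma eta_of_cvg x : 0 < x -> eta_of y @[y --> x] --> eta_of x.
Proof.
move=> x0; apply: cvgM; last by apply: cvgB; [exact: cvg_cst|exact: clip_cvg].
apply: cvgM; last exact: cvg_cst.
apply: cvgB; first exact: cvg_cst.
apply: cvgM; first exact: cvg_cst.
apply: cvgM; first exact: N2_cvg.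
by apply: cvgV; [rewrite gt_eqF// N0_gt0|exact: N0_cvg].
Qed.

Lemma eta_of_surj (eta : R) : 0 <= eta -> eta < 6^-1 ->
  exists2 x, 0 < x & eta_of x = eta.
Proof.
move=> eta0 eta6; pose a0 := (1 - 6 * eta) / 6.
have a00 : 0 < a0 by rewrite /a0; lra.
have a03 : a0 <= 3^-1 by rewrite /a0; lra.
have clipE : clip a0 = a0 by rewrite /clip min_l.
have n0 := N0_gt0 a00.
have lo : eta <= eta_of a0.
  rewrite /eta_of /order_of clipE.
  have : N2 a0 / N0 a0 <= a0 by rewrite ler_pdivrMr// -{2}clipE N2_le.
  move: (N2 a0 / N0 a0) => E Ea.
  have : (1 - 3 * a0) / 2 * (3^-1 - a0) <= (1 - 3 * E) / 2 * (3^-1 - a0).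
    by apply: ler_wpM2r; lra.
  apply: le_trans; rewrite /a0; nra.
have hi : eta_of 3^-1 = 0 by rewrite /eta_of /clip minxx subrr mulr0.
have [||c] := @IVT R eta_of a0 3^-1 eta a03.
- apply: continuous_in_subspaceT => x /set_mem; rewrite /= in_itv /= => /andP[x1 _].
  by apply: eta_of_cvg; exact: lt_le_trans x1.
- by rewrite hi ge_min eta0 orbT le_max lo.
rewrite in_itv /= => /andP[c1 _] ec.
by exists c => //; exact: lt_le_trans c1.
Qed.

Lemma order_of_bounds x : 0 < x -> 0 < order_of x /\ 2 * order_of x < 1.
Proof.
move=> x0; have n0 := N0_gt0 x0; have n2 := N2_gt0 x0; have n3 := N2_lt x0.
have e0 : 0 < N2 x / N0 x by rewrite divr_gt0.
have e1 : N2 x / N0 x < 3^-1 by rewrite ltr_pdivrMr//; lra.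
by rewrite /order_of; split; lra.
Qed.

Lemma critical_point_eta_of x : 0 < x ->
  critical_point (eta_of x) ((- order_of x) *: deviator (e3 R)).
Proof.
move=> x0; have [s0 s1] := order_of_bounds x0.
have [m0 Gm] := multP x0.
have n0 := N0_gt0 x0.
have EE : N2 x / N0 x = 3^-1 - 2 / 3 * order_of x by rewrite /order_of; lra.
(* The factor between [dens] and the unnormalized density of [critical_point_of_equations]. *)
pose K := order_of x * expR (- (mult x * clip x)).
have maxE p : Num.max (cw (order_of x) (clip x) p) 0 * cexp (- mult x) p =
    K * dens x p.
  rewrite /cw /cexp /dens /K -/(slack (clip x) p).
  have -> : Num.max (order_of x * slack (clip x) p) 0 =
      order_of x * Num.max (slack (clip x) p) 0.
    by rewrite -{1}(mulr0 (order_of x)) maxr_pMr// ltW.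
  have -> : expR (- mult x * p 2 0 ^+ 2) =
      expR (- (mult x * clip x)) * expR (mult x * slack (clip x) p).
    by rewrite -expRD /slack; congr expR; ring.
  by ring.
have ZE : cZ (order_of x) (clip x) (- mult x) = K * N0 x.
  rewrite /cZ /N0 -ISZ; last exact: sbm_L1.
  by apply: eq_IS => p _; exact: maxE.
have -> : eta_of x = order_of x * (3^-1 - clip x) by [].
apply: (@critical_point_of_equations _ _ _ (- mult x)) => //.
- exact: clip_gt0.
- rewrite ZE -EE.
  have -> : N2 x / N0 x * (K * N0 x) = K * N2 x.
    by rewrite mulrCA divfK// gt_eqF.
  rewrite /N2 -ISZ; last exact: sbm_L1.
  by apply: eq_IS => p _; rewrite maxE mulrA.
rewrite ZE.
have bF : sbm (fun p => ind (slack (clip x) p) * expR (mult x * slack (clip x) p) *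
    (p 2 0 ^+ 2 - 3^-1)).
  exact: (sbmM (sbmM (bind_ _) (bexp _ _)) (sbmD bz2 (sbm_cst _))).
have -> : sint (fun p => cind (order_of x) (clip x) p * cexp (- mult x) p *
    (p 2 0 ^+ 2 - 3^-1)) = expR (- (mult x * clip x)) *
    sint (fun p => ind (slack (clip x) p) * expR (mult x * slack (clip x) p) *
    (p 2 0 ^+ 2 - 3^-1)).
  rewrite -ISZ; last exact: sbm_L1.
  apply: eq_IS => p _; rewrite /cind /cw /cexp -/(slack (clip x) p) pmulr_rgt0//.
  rewrite -/(ind (slack (clip x) p)).
  have -> : expR (- mult x * p 2 0 ^+ 2) =
      expR (- (mult x * clip x)) * expR (mult x * slack (clip x) p).
    by rewrite -expRD /slack; congr expR; ring.
  by ring.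
(* The vanishing balance, split along hh t = e^t - t e^t: the second term produces N0 - 3 N2, which
   the moment condition turns into 2 sig N0. *)
have bal : sint (fun p => ind (slack (clip x) p) * expR (mult x * slack (clip x) p) *
    (p 2 0 ^+ 2 - 3^-1)) = - 3^-1 * (mult x * (N0 x - 3 * N2 x)).
  have : balance (clip x) (mult x) = - 3 * sint (fun p => ind (slack (clip x) p) *
     expR (mult x * slack (clip x) p) * (p 2 0 ^+ 2 - 3^-1)) -
     mult x * (N0 x - 3 * N2 x).
    rewrite /balance /N0 /N2.
    rewrite -(ISZ 3); last exact: sbm_L1.
    rewrite -ISB; [|exact: sbm_L1|exact: sbm_L1 (sbmM (sbm_cst _) (bdens2 x))].
    have bd : sbm (fun p => dens x p - 3 * (dens x p * p 2 0 ^+ 2)).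
      exact: (sbmD (bdens x) (sbmN (sbmM (sbm_cst _) (bdens2 x)))).
    rewrite -!ISZ; [|exact: sbm_L1|exact: sbm_L1].
    rewrite -ISB; [|exact: sbm_L1 (sbmM (sbm_cst _) bF)
      |exact: sbm_L1 (sbmM (sbm_cst _) bd)].
    apply: eq_IS => p _; rewrite /mint /dens /hh /ind.
    have [h|h] := ltP 0 (slack (clip x) p).
      by field.
    by rewrite !mul0r !mulr0; ring.
  by rewrite Gm; lra.
rewrite bal.
have e3 : N0 x - 3 * N2 x = 2 * order_of x * N0 x.
  have -> : N2 x = (3^-1 - 2 / 3 * order_of x) * N0 x.
    by rewrite -EE divfK// gt_eqF.
  by field.
by rewrite e3 /K; field.
Qed.

Lemma exists_oblate_critical (eta : R) : 0 <= eta < 6^-1 ->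
  exists Q : 'M[R]_3, oblate_uniaxial Q /\ critical_point eta Q.
Proof.
move=> /andP[eta0 eta6]; have [x x0 <-] := eta_of_surj eta0 eta6.
have [s0 s1] := order_of_bounds x0.
exists ((- order_of x) *: deviator (e3 R)); split; last exact: critical_point_eta_of.
exists (e3 R), (- order_of x); split => //; first exact: sphere_e3.
by apply/andP; split; lra.
Qed.

End CriticalPoints.

(** * Rotations *)

Section Rotations.
Variable R : realType.
Implicit Types (u v n p : 'cV[R]_3) (A B : 'M[R]_3).

(** Entries are indexed by [nat] so that the shifted indices of the cofactors compute to
    numerals. *)
Lemma det3 (a : nat -> nat -> R) : \det (\matrix_(i < 3, j < 3) a i j) =
  a 0 0 * (a 1 1 * a 2 2 - a 1 2 * a 2 1) -
  a 0 1 * (a 1 0 * a 2 2 - a 1 2 * a 2 0) +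
  a 0 2 * (a 1 0 * a 2 1 - a 1 1 * a 2 0).
Proof.
rewrite (expand_det_row _ ord0) !big_ord_recl big_ord0 /cofactor.
rewrite !(expand_det_row _ ord0) !big_ord_recl !big_ord0 /cofactor !det_mx11.
by rewrite !mxE /= /bump /=; ring.
Qed.

Lemma SO3_mul A B : SO3 R A -> SO3 R B -> SO3 R (A *m B).
Proof.
move=> [A1 dA] [B1 dB]; split; last by rewrite det_mulmx dA dB mulr1.
by rewrite trmx_mul mulmxA -(mulmxA B^T) A1 mulmx1.
Qed.

Lemma SO3_tr A : SO3 R A -> SO3 R A^T.
Proof. by move=> [A1 dA]; split; [exact: orthV|rewrite det_tr]. Qed.

Definition half_turn n : 'M[R]_3 := 2 *: (n *m n^T) - 1%:M.

Lemma half_turnE n u : half_turn n *m u = (2 * dot n u) *: n - u.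
Proof.
rewrite mulmxBl mul1mx -scalemxAl -mulmxA.
have -> : n^T *m u = (dot n u)%:M by rewrite [LHS]mx11_scalar.
by rewrite mul_mx_scalar scalerA.
Qed.

Lemma SO3_half_turn n : sphere R n -> SO3 R (half_turn n).
Proof.
move=> n1; have d1 := sphere_dot n1.
have sym : (half_turn n)^T = half_turn n.
  by rewrite /half_turn linearB /= linearZ /= trmx_mul trmxK trmx1.
split.
  rewrite sym; apply/matrixP => i j.
  have key u : half_turn n *m (half_turn n *m u) = u.
    rewrite !half_turnE.
    have -> : dot n ((2 * dot n u) *: n - u) = dot n u.
      have -> : dot n ((2 * dot n u) *: n - u) = 2 * dot n u * dot n n - dot n u.
        by rewrite !dotE !mxE; ring.
      by rewrite d1; ring.
    by rewrite opprB addrC subrK.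
  have := key (delta_mx j 0); rewrite mulmxA -colE => /colP/(_ i).
  by rewrite mxE => ->; rewrite !mxE eqxx andbT.
have -> : half_turn n = \matrix_(i < 3, j < 3)
    (2 * ([:: n 0 0; n 1 0; n 2 0]`_i * [:: n 0 0; n 1 0; n 2 0]`_j) -
    (i == j)%:R).
  apply/matrixP; apply: forall3; apply: forall3;
    by rewrite /half_turn !mxE big_ord1 !mxE.
rewrite (det3 (fun i j => 2 * ([:: n 0 0; n 1 0; n 2 0]`_i *
  [:: n 0 0; n 1 0; n 2 0]`_j) - (i == j)%:R)) /=.
move/sphereP: n1; move: (n 0 0) (n 1 0) (n 2 0) => x y z xyz.
by transitivity (2 * (x ^+ 2 + y ^+ 2 + z ^+ 2) - 1); [ring|rewrite xyz; ring].
Qed.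

(* The half-turn about the bisector of [u] and [v] exchanges them; if
   [v = - u], any half-turn about an axis orthogonal to [u] does. *)
Lemma SO3_map u v : sphere R u -> sphere R v ->
  exists A, SO3 R A /\ A *m u = v.
Proof.
move=> u1 v1; have du := sphere_dot u1; have dv := sphere_dot v1.
have [uv|uv] := eqVneq (u + v) 0.
  have [n n1 nu] : exists2 n, sphere R n & dot n u = 0; last first.
    exists (half_turn n); split; first exact: SO3_half_turn.
    rewrite half_turnE nu mulr0 scale0r sub0r.
    by apply/eqP; rewrite eq_sym -addr_eq0 addrC uv.
  have [u01|u01] := eqVneq (u 0 0 ^+ 2 + u 1 0 ^+ 2) 0.
    move: u01 => /eqP; rewrite paddr_eq0 ?sqr_ge0// !sqrf_eq0 => /andP[/eqP u0 _].
    exists (col3 1 0 0); first by apply/sphereP; rewrite !col3E; ring.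
    by rewrite dotE !col3E u0; ring.
  pose r := Num.sqrt (u 0 0 ^+ 2 + u 1 0 ^+ 2).
  have r2 : r ^+ 2 = u 0 0 ^+ 2 + u 1 0 ^+ 2.
    by rewrite sqr_sqrtr// addr_ge0 ?sqr_ge0.
  have r0 : r != 0 by rewrite -sqrf_eq0 r2.
  exists (col3 (- u 1 0 / r) (u 0 0 / r) 0).
    apply/sphereP; rewrite !col3E !exprMn sqrrN.
    have -> : u 1 0 ^+ 2 * r^-1 ^+ 2 + u 0 0 ^+ 2 * r^-1 ^+ 2 + 0 ^+ 2 =
      r^-1 ^+ 2 * (u 0 0 ^+ 2 + u 1 0 ^+ 2) by ring.
    by rewrite -r2 -exprMn mulVf ?expr1n.
  by rewrite dotE !col3E; ring.
pose m := enorm (u + v).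
have m2 : m ^+ 2 = 2 * (1 + dot u v).
  rewrite sqr_enorm; have -> : dot (u + v) (u + v) = dot u u + dot v v + 2 * dot u v.
    by rewrite !dotE !mxE; ring.
  by rewrite du dv; ring.
have m0 : m != 0.
  apply: contra uv => /eqP m0; apply/eqP/colP => i.
  by have := coord_le_enorm (u + v) i; rewrite -/m m0 normr_le0 => /eqP ->; rewrite mxE.
have nS : sphere R (m^-1 *: (u + v)).
  rewrite /sphere /= /enorm.
  have -> : dot (m^-1 *: (u + v)) (m^-1 *: (u + v)) = m^-1 ^+ 2 * dot (u + v) (u + v).
    by rewrite !dotE !mxE; ring.
  by rewrite -sqr_enorm -/m -exprMn mulVf// expr1n sqrtr1.
exists (half_turn (m^-1 *: (u + v))); split; first exact: SO3_half_turn.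
rewrite half_turnE.
have -> : dot (m^-1 *: (u + v)) u = m^-1 * (1 + dot u v).
  rewrite -du !dotE !mxE; ring.
rewrite scalerA.
have -> : 2 * (m^-1 * (1 + dot u v)) * m^-1 = 1.
  have -> : 2 * (m^-1 * (1 + dot u v)) * m^-1 = m^-1 ^+ 2 * (2 * (1 + dot u v)) by ring.
  by rewrite -m2 -exprMn mulVf// expr1n.
by rewrite scale1r addrAC subrr add0r.
Qed.

Definition zrot (t : R) : 'M[R]_3 :=
  cols (col3 (cos t) (sin t) 0) (col3 (- sin t) (cos t) 0) (e3 R).

Lemma zrotE t p : zrot t *m p = col3 (cos t * p 0 0 - sin t * p 1 0)
  (sin t * p 0 0 + cos t * p 1 0) (p 2 0).
Proof.
by rewrite colsE; apply/colP; apply: forall3; rewrite !mxE /=; ring.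
Qed.

Lemma zrot_orth t : (zrot t)^T *m zrot t = 1%:M.
Proof.
apply: orth_cols; rewrite ?dotE ?col3E.
- by apply/sphereP; rewrite !col3E -[RHS](cos2Dsin2 t); ring.
- by apply/sphereP; rewrite !col3E -[RHS](cos2Dsin2 t); ring.
- exact: sphere_e3.
- by ring.
- by ring.
- by ring.
Qed.

Lemma zrot_circ t s : zrot t *m circ s = circ (t + s).
Proof. by rewrite zrotE !col3E /circ cosD sinD; congr col3; ring. Qed.

Lemma zrot_e3 t : zrot t *m e3 R = e3 R.
Proof. by rewrite zrotE !col3E; congr col3; ring. Qed.

End Rotations.

(** * Transport of admissibility and energy by orthogonal matrices *)

Section Transport.
Variable R : realType.
Implicit Types (f g : 'cV[R]_3 -> R) (A Q : 'M[R]_3).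
Local Notation S := (sphere R : set (space3 R 2)).
Local Notation mS := (@measurable_sphere R 2).

Lemma smeas_orth A f : A^T *m A = 1%:M -> smeas f -> smeas (fun p => f (A *m p)).
Proof.
by move=> A1; apply: (measurable_fun_orth A1 mS); exact: sphere_preimage.
Qed.

Lemma sL1_orth A f : A^T *m A = 1%:M -> sL1 f -> sL1 (fun p => f (A *m p)).
Proof.
move=> A1 lf; have mf := sL1_meas lf.
apply/integrableP; split.
  by apply/measurable_EFinP; exact: smeas_orth.
have h : measurable_fun S ((fun p => `|(f p)%:E|%E) : space3 R 2 -> _).
  exact: (measurableT_comp (@abse_measurable R setT) (measurable_int _ lf)).
move: lf => /integrableP[_]; apply: le_lt_trans.
rewrite le_eqVlt; apply/orP; left; apply/eqP.
rewrite -(integral_orth A1 mS h).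
by have -> : mulmx A @^-1` S = S by exact: sphere_preimage.
Qed.

Lemma ae_sphere_orth A f : A^T *m A = 1%:M ->
  {ae Hmeas R 2, forall p, sphere R p -> 0 <= f p} ->
  {ae Hmeas R 2, forall p, sphere R p -> 0 <= f (A *m p)}.
Proof.
move=> A1 /(ae_orth A1) h.
apply: (@filterS _ _ (ae_filter_ringOfSetsType (Hmeas R 2)) _ _ _ h) => p hp Sp.
by apply: hp; apply/sphere_orth.
Qed.

Lemma admissible_trace Q f : admissible Q f -> \tr Q = 0.
Proof.
move=> adm; have [f1 mom] := admissible_moment adm.
have [[lf _ _] _] := adm.
have : sint f = \sum_i sint (fun p => p i 0 * p i 0 * f p).
  rewrite -IS_sum; last first.
    by move=> i; exact: (sbm_int_mul (sbmM (sbm_coord i) (sbm_coord i)) lf).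
  apply: eq_IS => p /sphereP p1.
  by rewrite sum3 -!mulrDl -!expr2 p1 mul1r.
by rewrite f1 sum3 !mom /mxtrace sum3 /=; lra.
Qed.

(** Substituting q = A p turns the moments of f(A p) into those of f along A^T q, hence the
    conjugation by A^T. *)
Lemma admissible_orth A Q f : A^T *m A = 1%:M -> admissible Q f ->
  admissible (A^T *m Q *m A) (rotate A f).
Proof.
move=> A1 adm; have [f1 mom] := admissible_moment adm.
have [[lf f0 _] _] := adm.
have trQ := admissible_trace adm.
apply: admissible_intro.
- exact: sL1_orth.
- exact: ae_sphere_orth.
- by rewrite mxtrace_mulC mulmxA orth_trmx// mul1mx.
move=> i j; rewrite /rotate.
pose F q := (A^T *m q) i 0 * (A^T *m q) j 0 * f q.
have FE q : F q = \sum_k \sum_l A k i * A l j * (q k 0 * q l 0 * f q).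
  by rewrite /F !mxE !sum3 !mxE; ring.
have lkl k l : sL1 (fun q => q k 0 * q l 0 * f q).
  exact: (sbm_int_mul (sbmM (sbm_coord k) (sbm_coord l)) lf).
have lF : sL1 F.
  have -> : F = fun q => \sum_k \sum_l A k i * A l j * (q k 0 * q l 0 * f q).
    by apply/funext => q; exact: FE.
  by apply: sL1_sum => k; apply: sL1_sum => l; exact: sL1Z.
have -> : sint (fun p => p i 0 * p j 0 * f (A *m p)) = sint F.
  rewrite -(IS_orth A1 (sL1_meas lF)).
  by apply: eq_IS => p _; rewrite /F mulmx_orthK.
have -> : sint F = \sum_k \sum_l A k i * A l j * (Q k l + (k == l)%:R / 3).
  have -> : sint F = sint (fun q => \sum_k \sum_l
      A k i * A l j * (q k 0 * q l 0 * f q)) by apply: eq_IS => q _; exact: FE.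
  rewrite IS_sum; last by move=> k; apply: sL1_sum => l; exact: sL1Z.
  apply: eq_bigr => k _; rewrite IS_sum; last by move=> l; exact: sL1Z.
  by apply: eq_bigr => l _; rewrite ISZ// mom.
have -> : (i == j)%:R = (A^T *m A) i j by rewrite A1 mxE.
by rewrite !mxE !sum3 !mxE !sum3 !mxE /=; field.
Qed.

Lemma weight_orth A Q eta (p : 'cV[R]_3) :
  weight (A^T *m Q *m A) eta p = weight Q eta (A *m p).
Proof. by rewrite /weight dot_sym !mulmxA -!mulmxA -dot_trmx dot_sym. Qed.

Lemma energy_orth A Q eta f : A^T *m A = 1%:M -> smeas f ->
  energy (A^T *m Q *m A) eta (rotate A f) = energy Q eta f.
Proof.
move=> A1 mf; rewrite !energyE.
have h : measurable_fun S (energy_density (weight Q eta) f).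
  by apply: energy_density_measurable => //; exact: sbm_meas (sbm_weight _ _).
rewrite -(integral_orth A1 mS h).
have -> : mulmx A @^-1` S = S by exact: sphere_preimage.
by apply: eq_integral => p _; rewrite /energy_density weight_orth.
Qed.

Lemma deviator_orth A (e : 'cV[R]_3) : A^T *m A = 1%:M ->
  A^T *m deviator e *m A = deviator (A^T *m e).
Proof.
move=> A1; rewrite /deviator mulmxBr mulmxBl trmx_mul trmxK !mulmxA.
by congr (_ - _); rewrite mul_mx_scalar -scalemxAl A1 scalemx1.
Qed.

End Transport.

(** * Uniqueness of the minimizer *)

(** The minorant g controls the negative part; an infinite positive part would then make the
    integral +oo. *)
Lemma ge_integrable_ae d (T : measurableType d) (R : realType)
    (mu : {measure set T -> \bar R}) (D : set T) (f g : T -> \bar R) :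
  measurable D -> measurable_fun D f -> mu.-integrable D g ->
  {ae mu, forall x, D x -> (g x <= f x)%E} ->
  (\int[mu]_(x in D) f x < +oo)%E -> mu.-integrable D f.
Proof.
move=> mD mf ig gf; rewrite integralE => If.
have mfp := measurable_funepos mf; have mfn := measurable_funeneg mf.
have mg := measurable_int _ ig.
have fn : (\int[mu]_(x in D) f^\- x < +oo)%E.
  apply: (@le_lt_trans _ _ (\int[mu]_(x in D) g^\- x)%E).
    apply: le_integral_ae => //; first exact: measurable_funeneg.
    apply: filterS gf => x gf Dx; rewrite !funenegE.
    by rewrite ge_max le_max leeN2 gf//= le_max lexx orbT.
  by have /integrableP[_] := integrable_funeneg mD ig;
     under eq_integral do rewrite gee0_abs//.
have fn0 : (0 <= \int[mu]_(x in D) f^\- x)%E by exact: integral_ge0.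
have fp : (\int[mu]_(x in D) f^\+ x < +oo)%E.
  rewrite ltNge leye_eq; apply/negP => /eqP fpE; move: If fn fn0.
  by rewrite fpE; case: (\int[mu]_(x in D) f^\- x)%E.
rewrite (funeposneg f); apply: integrableB => //.
- apply/integrableP; split => //.
  by under eq_integral do rewrite gee0_abs//.
- apply/integrableP; split => //.
  by under eq_integral do rewrite gee0_abs//.
Qed.

Section Uniqueness.
Variable R : realType.
Implicit Types (f g w : 'cV[R]_3 -> R) (A Q : 'M[R]_3).
Local Notation S := (sphere R : set (space3 R 2)).
Local Notation mS := (@measurable_sphere R 2).

(** The value 0 for w <= 0 is the correct one for densities of finite energy, which vanish there. *)
Definition real_density w f (p : 'cV[R]_3) : R :=
  if 0 < w p then f p * ln (f p) - f p * ln (w p) else 0.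

Lemma ae_and (P P' : 'cV[R]_3 -> Prop) :
  {ae Hmeas R 2, forall p, P p} -> {ae Hmeas R 2, forall p, P' p} ->
  {ae Hmeas R 2, forall p, P p /\ P' p}.
Proof.
move=> a b.
exact: (@filterS2 _ _ (ae_filter_ringOfSetsType (Hmeas R 2)) _ _ _
  (fun p x y => conj x y) a b).
Qed.

Lemma ae_imp (P P' : 'cV[R]_3 -> Prop) : (forall p, P p -> P' p) ->
  {ae Hmeas R 2, forall p, P p} -> {ae Hmeas R 2, forall p, P' p}.
Proof.
move=> PP' a.
exact: (@filterS _ _ (ae_filter_ringOfSetsType (Hmeas R 2)) _ _ PP' a).
Qed.

Lemma energy_densityE w f p : 0 <= f p -> (w p <= 0 -> f p = 0) ->
  energy_density w f p = (real_density w f p)%:E.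
Proof.
move=> f0 wf; rewrite /energy_density /real_density /neg_ln.
have [w0|w0] := ltP 0 (w p); first by rewrite -EFinM -EFinD mulrN.
by rewrite wf// !mul0r mul0e adde0.
Qed.

Lemma real_density_measurable w f : smeas w -> smeas f ->
  smeas (real_density w f).
Proof.
move=> mw mf; apply: measurable_fun_if.
- exact: mS.
- by apply: measurable_fun_ltr => //; exact: measurable_cst.
- apply: (measurable_funS mS); first by move=> x [].
  by apply: measurable_funB; apply: smeasM => //; exact: smeas_ln.
- exact: measurable_cst.
Qed.

(** [gibbs] with k = 1 gives an integrable minorant, so finite energy makes the density integrable
    and almost everywhere finite; where w <= 0 this forces f = 0. *)
Lemma finite_energy Q eta f : sL1 f ->
  {ae Hmeas R 2, forall p, sphere R p -> 0 <= f p} ->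
  (energy Q eta f < +oo)%E ->
  let w := weight Q eta in
  [/\ {ae Hmeas R 2, forall p, sphere R p ->
        0 <= f p /\ (w p <= 0 -> f p = 0)},
      sL1 (real_density w f) & energy Q eta f = (sint (real_density w f))%:E].
Proof.
move=> lf f0 ef w; have mw : smeas w by exact: sbm_meas (sbm_weight _ _).
have mf := sL1_meas lf.
have me := energy_density_measurable mw mf.
have ie : (Hmeas R 2).-integrable (sphere R) (energy_density w f).
  apply: (@ge_integrable_ae _ (space3 R 2) R (Hmeas R 2) S _
    (fun p => (f p - Num.max (w p) 0)%:E) mS me _ _ ef).
    by apply: sL1D => //; apply: sL1N; exact: sbm_L1 (sbm_max0 (sbm_weight _ _)).
  apply: ae_imp f0 => p f0 Sp.
  by have := gibbs (w p) (f0 Sp) (@ltr01 R); rewrite mulr1 ln1 mulr0 addr0.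
have a1 := integrable_ae mS ie.
have a2 : {ae Hmeas R 2, forall p, sphere R p ->
    0 <= f p /\ (w p <= 0 -> f p = 0)}.
  apply: ae_imp (ae_and f0 a1) => p [fp ep] Sp; split; first exact: fp.
  move=> wp; have := ep Sp; rewrite /energy_density /neg_ln ltNge wp /=.
  have := fp Sp; rewrite le_eqVlt => /predU1P[<-//|f1].
  by rewrite gt0_muley ?lte_fin// addey.
have a3 : {ae Hmeas R 2, forall p, sphere R p ->
    energy_density w f p = (real_density w f p)%:E}.
  apply: ae_imp a2 => p h Sp; have [h1 h2] := h Sp.
  exact: energy_densityE.
have mr := real_density_measurable mw mf.
have mrE : measurable_fun S (fun p => (real_density w f p)%:E).
  exact/measurable_EFinP.
have lr : sL1 (real_density w f).
  apply/integrableP; split; first exact: mrE.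
  have /integrableP[_] := ie; apply: le_lt_trans.
  rewrite le_eqVlt; apply/orP; left; apply/eqP.
  apply: ge0_ae_eq_integral.
  - exact: mS.
  - exact: (measurableT_comp (@abse_measurable R setT) mrE).
  - exact: (measurableT_comp (@abse_measurable R setT) me).
  - by move=> p _; exact: abse_ge0.
  - by move=> p _; exact: abse_ge0.
  - by apply: ae_imp a3 => p h Sp; rewrite h.
split => //; rewrite -sint_EFin// energyE.
exact: (ae_eq_integral _ _ mS me mrE a3).
Qed.

(** This is ln t <= t - 1 at t = m / x, and its strictness for t != 1 gives the equality case. *)
Lemma relative_entropy_ge (x m : R) : 0 <= x -> 0 < m ->
  x - m <= x * ln x - x * ln m /\
  (x * ln x - x * ln m <= x - m -> x = m).
Proof.
move=> x0 m0; move: x0; rewrite le_eqVlt => /predU1P[<-|x0].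
  by rewrite !mul0r; split; lra.
have xm : 0 < m / x by rewrite divr_gt0.
have e : x * ln x - x * ln m = - x * ln (m / x) by rewrite ln_div ?posrE//; ring.
have mx : x * (m / x) = m by rewrite mulrC divfK// gt_eqF.
have l := ln_le_subr1 xm.
rewrite e; split; first nra.
move=> h; apply/eqP; rewrite -[_ == _]negbK; apply/negP => xm'.
have n1 : m / x - 1 != 0.
  by rewrite subr_eq0; apply: contra xm' => /eqP q; rewrite q mulr1 in mx; rewrite mx.
have := expR_gt1Dx n1; rewrite addrC subrK.
rewrite -(@ltr_ln _ (m / x)) ?posrE ?expR_gt0// expRK => lt; nra.
Qed.

(** Apply [relative_entropy_ge] to x and to y with m = h: the linear terms cancel because x + y = 2
    h, and equality forces x = h = y. *)
Lemma entropy_strictly_convex (x y : R) : 0 <= x -> 0 <= y ->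
  let h := 2^-1 * (x + y) in
  0 <= x * ln x + y * ln y - 2 * (h * ln h) /\
  (x * ln x + y * ln y - 2 * (h * ln h) = 0 -> x = y).
Proof.
move=> x0 y0 h; have h0 : 0 <= h by rewrite /h; lra.
move: h0; rewrite le_eqVlt => /predU1P[h0|h0].
  have [-> ->] : x = 0 /\ y = 0 by split; rewrite /h in h0; lra.
  by rewrite -h0 !mul0r; split; lra.
have [a1 a2] := relative_entropy_ge x0 h0.
have [b1 b2] := relative_entropy_ge y0 h0.
have e : x + y = 2 * h by rewrite /h; field.
have hl : 2 * (h * ln h) = x * ln h + y * ln h by rewrite mulrA -e mulrDl.
rewrite hl; clearbody h; clear hl.
move: (x * ln x) (y * ln y) (x * ln h) (y * ln h) a1 a2 b1 b2 => s t u v.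
move=> a1 a2 b1 b2; split; first by lra.
move=> q; have -> : x = h by apply: a2; lra.
by apply/esym/b2; lra.
Qed.

(* The midpoint of two minimizers is admissible, so the strict convexity of
   [x ln x] forces them to agree where the weight is positive; elsewhere both
   vanish. *)
Lemma optimal_unique Q eta f1 f2 : (J Q eta < +oo)%E ->
  optimal_energy_distribution Q eta f1 ->
  optimal_energy_distribution Q eta f2 ->
  {ae Hmeas R 2, forall p, sphere R p -> f1 p = f2 p}.
Proof.
move=> Joo [ad1 E1] [ad2 E2].
have [[l1 p1 _] _] := ad1; have [[l2 p2 _] _] := ad2.
have [_ mom1] := admissible_moment ad1; have [_ mom2] := admissible_moment ad2.
have e1 : (energy Q eta f1 < +oo)%E by rewrite E1.
have e2 : (energy Q eta f2 < +oo)%E by rewrite E2.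
have [s1 r1 q1] := finite_energy l1 p1 e1.
have [s2 r2 q2] := finite_energy l2 p2 e2.
set w := weight Q eta in s1 r1 q1 s2 r2 q2.
pose h p := 2^-1 * (f1 p + f2 p).
have lh : sL1 h by apply: sL1Z; exact: sL1D.
have h0 : {ae Hmeas R 2, forall p, sphere R p -> 0 <= h p}.
  apply: ae_imp (ae_and s1 s2) => p [a b] Sp.
  by have [a1 _] := a Sp; have [b1 _] := b Sp; rewrite /h; lra.
have adh : admissible Q h.
  apply: admissible_intro => //; first exact: admissible_trace ad1.
  move=> i j.
  have l (f : 'cV[R]_3 -> R) : sL1 f -> sL1 (fun p => p i 0 * p j 0 * f p).
    exact: (sbm_int_mul (sbmM (sbm_coord i) (sbm_coord j))).
  rewrite (_ : sint _ = sint (fun p => 2^-1 *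
    (p i 0 * p j 0 * f1 p + p i 0 * p j 0 * f2 p))); last first.
    by apply: eq_IS => p _; rewrite /h; ring.
  rewrite ISZ; last by apply: sL1D; exact: l.
  by rewrite ISD; [rewrite mom1 mom2; field|exact: l|exact: l].
pose g p := 2^-1 * (real_density w f1 p + real_density w f2 p).
have lg : sL1 g by apply: sL1Z; exact: sL1D.
have conv : {ae Hmeas R 2, forall p, sphere R p ->
    [/\ 0 <= real_density w f1 p + real_density w f2 p - 2 * real_density w h p,
        real_density w f1 p + real_density w f2 p - 2 * real_density w h p = 0 ->
        f1 p = f2 p, 0 <= h p & w p <= 0 -> h p = 0]}.
  apply: ae_imp (ae_and s1 s2) => p [a b] Sp.
  have [a1 a2] := a Sp; have [b1 b2] := b Sp.
  have [c1 c2] := entropy_strictly_convex a1 b1.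
  rewrite /real_density /h; case: ltP => w0.
    have e : f1 p * ln (f1 p) - f1 p * ln (w p) +
      (f2 p * ln (f2 p) - f2 p * ln (w p)) -
      2 * (2^-1 * (f1 p + f2 p) * ln (2^-1 * (f1 p + f2 p)) -
      2^-1 * (f1 p + f2 p) * ln (w p)) =
      f1 p * ln (f1 p) + f2 p * ln (f2 p) -
      2 * (2^-1 * (f1 p + f2 p) * ln (2^-1 * (f1 p + f2 p))) by field.
    by rewrite e; split => //; lra.
  by rewrite a2// b2//; split; rewrite ?addr0 ?mulr0 ?subr0.
have eh : (energy Q eta h <= (sint g)%:E)%E.
  apply: energy_le => //; first exact: sL1_meas.
  apply: ae_imp conv => p c Sp; have [c1 c2 c3 c4] := c Sp.
  by rewrite energy_densityE// lee_fin /g; lra.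
have [_ rh qh] := finite_energy lh h0 (le_lt_trans eh (ltry _)).
have Jh : (J Q eta <= energy Q eta h)%E by apply: ereal_inf_lbound; exists h.
pose d p := real_density w f1 p + real_density w f2 p - 2 * real_density w h p.
have ld : sL1 d by apply: sL1D; [exact: sL1D|apply: sL1N; exact: sL1Z].
(* Both minimal energies are at most that of the midpoint. *)
have d0 : sint d <= 0.
  rewrite ISB; [|exact: sL1D|exact: sL1Z].
  rewrite ISD// ISZ//.
  move: Jh; rewrite -{1}E1 q1 qh lee_fin => J1.
  have : (energy Q eta f2 <= energy Q eta h)%E by rewrite E2; apply: ereal_inf_lbound; exists h.
  by rewrite q2 qh lee_fin; lra.
(* The convexity defect is nonnegative only almost everywhere, while [int_eq0_ae] wants it on the
   whole sphere; hence the absolute value. *)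
have ldn : sL1 (fun p => `|d p|) by exact: integrable_norm.
have z := int_eq0_ae mS ldn (fun p _ => normr_ge0 (d p)).
have {}z : {ae Hmeas R 2, forall p, sphere R p -> `|d p| = 0}.
  apply: z; rewrite -[X in X <= 0]/(sint _) (_ : sint _ = sint d)//.
  apply: (ae_eq_int mS (sL1_meas ldn) (sL1_meas ld)).
  apply: ae_imp conv => p c Sp; have [c1 c2 c3 c4] := c Sp.
  exact: ger0_norm.
apply: ae_imp (ae_and conv z) => p [c zp] Sp; have [c1 c2 c3 c4] := c Sp.
by apply: c2; apply/normr0_eq0; exact: zp.
Qed.

Lemma optimal_orth A Q eta f : A^T *m A = 1%:M ->
  optimal_energy_distribution Q eta f ->
  optimal_energy_distribution (A^T *m Q *m A) eta (rotate A f).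
Proof.
move=> A1 [adf Ef]; have [[lf _ _] _] := adf.
split; first exact: admissible_orth.
apply: (eq_trans (energy_orth Q eta A1 (sL1_meas lf))); apply: (eq_trans Ef).
suff EE : [set energy Q eta g | g in admissible Q] =
    [set energy (A^T *m Q *m A) eta g | g in admissible (A^T *m Q *m A)].
  exact: (congr1 (@ereal_inf R) EE).
apply/seteqP; split => [_ [g ag <-]|_ [g ag <-]].
  exists (rotate A g); first exact: admissible_orth.
  by have [[lg _ _] _] := ag; exact: (energy_orth Q eta A1 (sL1_meas lg)).
have A1' := orthV A1.
have Q1 : A^T^T *m (A^T *m Q *m A) *m A^T = Q.
  by rewrite trmxK !mulmxA orth_trmx// mul1mx -mulmxA orth_trmx// mulmx1.
have [[lg _ _] _] := ag.
exists (rotate A^T g); first by rewrite -[X in admissible X]Q1; exact: admissible_orth.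
by rewrite -[X in energy X]Q1; exact: (energy_orth _ eta A1' (sL1_meas lg)).
Qed.

End Uniqueness.

(** * Concentration on the equator *)

Section UniformContinuity.
Variable R : realType.
Implicit Types (p q : 'cV[R]_3) (g : 'cV[R]_3 -> R).

(** Image of a square under the Lipschitz map [spherical]. *)
Lemma compact_sphere : compact (sphere R).
Proof.
have -> : sphere R = (fun x : R * R => spherical x.1 x.2) @`
    (`[0, 2 * pi]%classic `*` `[0, 2 * pi]%classic).
  apply/seteqP; split => [p Sp|_ [[a t] _ <-]].
    have [a [t [a0 t0 ->]]] := spherical_surj Sp.
    by exists (a, t) => //=; rewrite !in_itv /=.
  apply/sphereP; rewrite !col3E !exprMn -mulrDr cos2Dsin2 mulr1.
  exact: cos2Dsin2.
apply: continuous_compact; last by apply: compact_setX; exact: segment_compact.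
apply: continuous_subspaceT => -[a t]; apply/cvgrPdist_lt => e e0.
near=> x; apply: (le_lt_trans (norm_le_enorm _)).
apply: (le_lt_trans (spherical_lip _ _ _ _)).
have x1 : `|a - x.1| < e / 2.
  near: x; apply: (@cvgr_dist_lt _ R^o _ _ _ (fun x : R * R => x.1) a).
    exact: cvg_fst.
  by rewrite divr_gt0.
have x2 : `|t - x.2| < e / 2.
  near: x; apply: (@cvgr_dist_lt _ R^o _ _ _ (fun x : R * R => x.2) t).
    exact: cvg_snd.
  by rewrite divr_gt0.
by rewrite /=; lra.
Unshelve. all: by end_near. Qed.

Variable g : 'cV[R]_3 -> R.
Hypothesis cg : {within sphere R, continuous g}.

Lemma sphere_bounded : exists2 M, 0 <= M & forall p, sphere R p -> `|g p| <= M.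
Proof.
have /compact_bounded[N [_ hN]] : compact (g @` sphere R).
  exact: continuous_compact cg compact_sphere.
exists (`|N| + 1) => [|p Sp]; first by rewrite addr_ge0.
apply: hN; last by exists p.
by rewrite (le_lt_trans (ler_norm N))// ltrDl.
Qed.

Lemma sphere_unif_continuous eps : 0 < eps -> exists2 delta, 0 < delta &
  forall p q, sphere R p -> sphere R q -> enorm (p - q) < delta ->
  `|g p - g q| <= eps.
Proof.
move=> e0; have e20 : 0 < eps / 2 by rewrite divr_gt0.
pose P (d : R) p := sphere R p -> forall q, sphere R q -> enorm (p - q) < d ->
  `|g p - g q| <= eps.
have /compact_near_coveringP/near_covering_withinP cov := compact_sphere.
have H : \forall d \near 0^'+, sphere R `<=` P d.
  apply: cov => x Sx.
  have /subspace_continuousP/(_ x Sx)/(@cvgrPdist_lt _ R^o)/(_ _ e20) := cg.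
  rewrite near_withinE => /nbhs_ballP[r /= r0 rP].
  (* Half radii: p is within r / 2 of x and q within r / 2 of p, so both lie in the r-ball where g
     varies by less than eps / 2 from g x. *)
  exists (ball x (r / 2), [set d : R | d < r / 2]) => /=.
    split; first by apply: nbhsx_ballx; rewrite divr_gt0.
    by apply: nbhs_right_lt; rewrite divr_gt0.
  move=> [p d] /= [xp dr] Sp _ q Sq pq.
  have xp' : `|x - p| < r / 2 by move: xp; rewrite -ball_normE.
  have pq' : `|p - q| < r / 2 by exact: (le_lt_trans (norm_le_enorm _) (lt_trans pq dr)).
  have gp : `|g x - g p| < eps / 2.
    apply: rP => //; rewrite -ball_normE /=; lra.
  have gq : `|g x - g q| < eps / 2.
    apply: rP => //; rewrite -ball_normE /=.
    by have := ler_distD p x q; lra.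
  by have := ler_distD (g x) (g p) (g q); rewrite (distrC (g p) (g x)); lra.
have [d [d0 dP]] : exists d : R, 0 < d /\ sphere R `<=` P d.
  near (0 : R)^'+ => d; exists d; split; near: d => //.
  exact: nbhs_right_gt.
exists d => // p q Sp Sq pq; exact: (dP p Sp Sp q Sq pq).
Unshelve. all: by end_near. Qed.

End UniformContinuity.

(** * Averages over finitely many rotations about the axis *)

Section Averaging.
Variable R : realType.
Implicit Types (p q : 'cV[R]_3).
Variable g : 'cV[R]_3 -> R.
Hypothesis cg : {within sphere R, continuous g}.
Local Notation C := (great_circle (e3 R) : set (space3 R 1)).

Definition rot_average N p : R :=
  N.+1%:R^-1 * \sum_(k < N.+1) g (zrot (k%:R * (2 * pi / N.+1%:R)) *m p).

Lemma cyclic_shift (F : nat -> R) N m :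
  (forall k, F (k + N.+1)%N = F k) ->
  \sum_(k < N.+1) F (k + m)%N = \sum_(k < N.+1) F k.
Proof.
move=> per; elim: m => [|m ih]; first by apply: eq_bigr => k _; rewrite addn0.
rewrite -ih big_ord_recr [RHS]big_ord_recl /= addrC; congr (_ + _).
  by rewrite -[RHS]per; congr F; rewrite /=; lia.
by apply: eq_bigr => k _; congr F; rewrite /= /bump; lia.
Qed.

Lemma sphere_circ s : sphere R (circ s).
Proof. by apply/sphereP; rewrite !col3E -[RHS](cos2Dsin2 s); ring. Qed.

Lemma circ_lip s t : enorm (circ s - circ t : 'cV[R]_3) <= `|s - t|.
Proof.
by have := @chord_scaled R 1 0 s t ler01 (lexx 1); rewrite !mul1r.
Qed.

Lemma circ_period s : circ (s + 2 * pi) = circ s :> 'cV[R]_3.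
Proof. by rewrite /circ mulr_natl cosD2pi sinD2pi. Qed.

Lemma zrot_great_circle t : mulmx (zrot t) @^-1` great_circle (e3 R) =
  great_circle (e3 R).
Proof.
apply/seteqP; split => p /= [Sp zp]; (split; [exact/(sphere_orth _ (zrot_orth t))|]).
  by move: zp; rewrite !dot_e3 zrotE col3E.
by move: zp; rewrite !dot_e3 zrotE col3E.
Qed.

(** With r = sqrt (1 - z^2), the squared distance is (1 - r)^2 + z^2, and (1 - r)^2 <= 1 - r^2 =
    z^2. *)
Lemma near_circle p : sphere R p ->
  exists2 s, 0 <= s & enorm (p - circ s) <= 2 * `|p 2 0|.
Proof.
move=> Sp; have [s /andP[s0 _] pE] := latitude_surj Sp; exists s => //.
have z1 := sphere_le1 2 Sp.
rewrite -(@ler_pXn2r _ 2) ?nnegrE ?enorm_ge0 ?mulr_ge0// exprMn real_normK ?num_real//.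
rewrite sqr_enorm {1 2}pE; move: (p 2 0) z1 => z z1.
have z2 : 0 <= 1 - z ^+ 2 by rewrite subr_ge0 -real_normK ?num_real// expr_le1.
have r0 := sqrtr_ge0 (1 - z ^+ 2); have r2 := sqr_sqrtr z2.
rewrite dotE !colBE !col3E; move: (Num.sqrt _) r0 r2 => r r0 r2.
have -> : (r * cos s - cos s) * (r * cos s - cos s) +
  (r * sin s - sin s) * (r * sin s - sin s) + (z - 0) * (z - 0) =
  (r - 1) ^+ 2 * (cos s ^+ 2 + sin s ^+ 2) + z ^+ 2 by ring.
rewrite cos2Dsin2 mulr1.
have r1 : r <= 1 by rewrite -(@expr_le1 _ 2)// r2 gerBl sqr_ge0.
by nra.
Qed.

Lemma mean_le N (F G : nat -> R) eps : (forall k, `|F k - G k| <= eps) ->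
  `|N.+1%:R^-1 * (\sum_(k < N.+1) F k) - N.+1%:R^-1 * (\sum_(k < N.+1) G k)|
  <= eps.
Proof.
move=> FG; have n0 : (0 : R) < N.+1%:R by rewrite ltr0n.
rewrite -mulrBr -sumrB normrM gtr0_norm ?invr_gt0// ler_pdivrMl//.
apply: (le_trans (ler_norm_sum _ _ _)).
apply: (le_trans (ler_sum _ (fun (k : 'I_N.+1) _ => FG k))).
by rewrite sumr_const card_ord mulr_natl.
Qed.

Section Fixed.
Variables (eps delta : R) (N : nat).
Hypothesis unif : forall p q, sphere R p -> sphere R q ->
  enorm (p - q) < delta -> `|g p - g q| <= eps.
Hypothesis mesh : 2 * pi / N.+1%:R < delta.
Let c : R := 2 * pi / N.+1%:R.

(** Turning by a multiple of the mesh only permutes the sum, so s may be replaced by its remainder,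
    shorter than one mesh; uniform continuity handles the rest. *)
Lemma rot_average_circ s : 0 <= s ->
  `|rot_average N (circ s) - rot_average N (circ 0)| <= eps.
Proof.
move=> s0; have c0 : 0 < c by rewrite divr_gt0 ?pi2_gt0.
have sc0 : 0 <= s / c by rewrite divr_ge0// ltW.
have /andP[m1 m2] := truncn_itv sc0.
set m := Num.truncn (s / c) in m1 m2.
rewrite ler_pdivlMr// in m1; rewrite ltr_pdivrMr// in m2.
pose G k := g (circ (k%:R * c)).
have per k : G (k + N.+1)%N = G k.
  rewrite /G natrD mulrDl -(circ_period (k%:R * c)); congr (g (circ (_ + _))).
  by rewrite /c mulrC divfK// pnatr_eq0.
have -> : rot_average N (circ 0) = N.+1%:R^-1 * \sum_(k < N.+1) G (k + m)%N.
  rewrite (cyclic_shift _ per) /rot_average; congr (_ * _).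
  by apply: eq_bigr => k _; rewrite zrot_circ addr0.
rewrite /rot_average; under eq_bigr do rewrite zrot_circ.
apply: (@mean_le N (fun k => g (circ (k%:R * c + s))) (fun k => G (k + m)%N)).
move=> k; apply: unif; [exact: sphere_circ|exact: sphere_circ|].
apply: (le_lt_trans (circ_lip _ _)); apply: le_lt_trans mesh; rewrite -/c.
have -> : k%:R * c + s - (k + m)%:R * c = s - m%:R * c by rewrite natrD; ring.
rewrite -natr1 mulrDl mul1r in m2.
by rewrite ger0_norm; lra.
Qed.

Lemma rot_average_near p q : sphere R p -> sphere R q ->
  enorm (p - q) < delta -> `|rot_average N p - rot_average N q| <= eps.
Proof.
move=> Sp Sq pq.
apply: (@mean_le N (fun k => g (zrot (k%:R * c) *m p))
  (fun k => g (zrot (k%:R * c) *m q))) => k.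
apply: unif; [exact/(sphere_orth _ (zrot_orth _))|exact/(sphere_orth _ (zrot_orth _))|].
by rewrite -mulmxBr enorm_orth//; exact: zrot_orth.
Qed.

Lemma rot_average_dist p : sphere R p -> 2 * `|p 2 0| < delta ->
  `|rot_average N p - rot_average N (circ 0)| <= 2 * eps.
Proof.
move=> Sp zp; have [s s0 ps] := near_circle Sp.
have a := rot_average_near Sp (sphere_circ s) (le_lt_trans ps zp).
have b := rot_average_circ s0.
apply: (le_trans (ler_distD (rot_average N (circ s)) _ _)); lra.
Qed.

End Fixed.

Let mC : measurable C. Proof. exact: measurable_great_circle. Qed.
Let C_fin : (Hmeas R 1 C < +oo)%E.
Proof. by rewrite /Hmeas hausdorff_great_circle ltry. Qed.

Lemma great_circle_sphere (v : 'cV[R]_3) : great_circle v `<=` sphere R.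
Proof. by move=> p []. Qed.

Lemma bm_circle : bounded_measurable C g.
Proof.
split; last first.
  have [M _ gM] := sphere_bounded cg.
  by exists M => p [Sp _]; exact: gM.
apply: continuous_within_measurable_H => //.
exact: continuous_subspaceW (@great_circle_sphere (e3 R)) cg.
Qed.

Lemma sbm_sphere : sbm g.
Proof.
split; last first.
  by have [M _ gM] := sphere_bounded cg; exists M.
by apply: continuous_within_measurable_H => //; exact: measurable_sphere.
Qed.

Let bm_circle_rot t : bounded_measurable C (fun p => g (zrot t *m p)).
Proof.
have [mg [M gM]] := bm_circle; split.
  exact: (measurable_fun_orth (zrot_orth t) mC (zrot_great_circle t) mg).
exists M => p Cp; apply: gM.
by have : (mulmx (zrot t) @^-1` C) p by rewrite zrot_great_circle.
Qed.

Let bm_circle_average N : bounded_measurable C (rot_average N).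
Proof. by apply: bmM; [exact: bm_cst|apply: bm_sum => k; exact: bm_circle_rot]. Qed.

Lemma circle_functional_average N :
  circle_functional (e3 R) (rot_average N) = circle_functional (e3 R) g.
Proof.
rewrite /circle_functional; congr (_ * _).
have lk t := bm_int mC C_fin (bm_circle_rot t).
rewrite (intZ mC); last by apply: (L1_sum mC C_fin) => k; exact: lk.
rewrite (int_sum mC C_fin); last by move=> k; exact: lk.
have [mg _] := bm_circle.
have e t : \int[Hmeas R 1]_(p in C) g (zrot t *m p) = \int[Hmeas R 1]_(p in C) g p.
  by rewrite -(Rintegral_orth (zrot_orth t) mC mg) zrot_great_circle.
under eq_bigr do rewrite e.
by rewrite sumr_const card_ord -[X in _ * X = _]mulr_natl mulKf// pnatr_eq0.
Qed.

Lemma circle_functional_close (f : 'cV[R]_3 -> R) (a eps : R) :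
  bounded_measurable C f -> (forall p, C p -> `|f p - a| <= eps) ->
  `|circle_functional (e3 R) f - a| <= eps.
Proof.
move=> bf fa; have lf := bm_int mC C_fin bf.
have la b : (Hmeas R 1).-integrable C (fun=> b%:E).
  exact: (bm_int mC C_fin (bm_cst _ _)).
have p0 : 0 < (2 * pi : R) by exact: pi2_gt0.
have cst b : (\int[Hmeas R 1]_(p in C) b) = b * (2 * pi).
  rewrite (int_cst _ mC); congr (_ * _).
  exact: (congr1 fine (hausdorff_great_circle R)).
have := int_abs_le mC (L1D mC lf (la (- a))) (la eps) fa.
rewrite (intD mC lf (la (- a))) !cst => h.
have -> : circle_functional (e3 R) f - a =
    (2 * pi)^-1 * (\int[Hmeas R 1]_(p in C) f p + - a * (2 * pi)).
  rewrite /circle_functional [RHS]mulrDr; congr (_ + _).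
  by rewrite mulrC mulfK// gt_eqF.
by rewrite normrM gtr0_norm ?invr_gt0// ler_pdivrMl// [leRHS]mulrC.
Qed.

(** The exceptional null set of the invariance depends on the rotation; a finite average uses each
    rotation separately and needs nothing uniform in t. *)
Lemma sint_average (f : 'cV[R]_3 -> R) N : sL1 f ->
  (forall t, {ae Hmeas R 2, forall p, sphere R p -> f (zrot t *m p) = f p}) ->
  sint (fun p => rot_average N p * f p) = sint (fun p => g p * f p).
Proof.
move=> lf inv.
have mg := sbm_meas sbm_sphere.
have bg t : sbm (fun p => g (zrot t *m p)).
  split; first by apply: smeas_orth => //; exact: zrot_orth.
  have [_ [M gM]] := sbm_sphere; exists M => p Sp; apply: gM.
  exact/(sphere_orth _ (zrot_orth _)).
have lk t : sL1 (fun p => g (zrot t *m p) * f p) by exact: sbm_int_mul.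
have e t : sint (fun p => g (zrot t *m p) * f p) = sint (fun p => g p * f p).
  have lgf : sL1 (fun p => g p * f p) by apply: sbm_int_mul => //; exact: sbm_sphere.
  rewrite -(IS_orth (zrot_orth t) (sL1_meas lgf)).
  apply: (ae_eq_int (@measurable_sphere R 2)).
  - exact: sL1_meas.
  - exact: (smeas_orth (zrot_orth t) (sL1_meas lgf)).
  - by apply: ae_imp (inv t) => p h Sp; rewrite h.
rewrite (_ : sint _ = sint (fun p => N.+1%:R^-1 * \sum_(k < N.+1)
    g (zrot (k%:R * (2 * pi / N.+1%:R)) *m p) * f p)); last first.
  by apply: eq_IS => p _; rewrite /rot_average -[LHS]mulrA mulr_suml.
rewrite ISZ; last by apply: sL1_sum => k; exact: lk.
rewrite IS_sum; last by move=> k; exact: lk.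
under eq_bigr do rewrite e.
by rewrite sumr_const card_ord -[X in _ * X = _]mulr_natl mulKf// pnatr_eq0.
Qed.

(* Off the strip |z| < d / 2 the average is only bounded, and Chebyshev's
   inequality turns the mass of [f] there into its second moment. *)
Lemma concentration (eps : R) : 0 < eps -> exists K, forall f : 'cV[R]_3 -> R,
  sL1 f -> {ae Hmeas R 2, forall p, sphere R p -> 0 <= f p} -> sint f = 1 ->
  (forall t, {ae Hmeas R 2, forall p, sphere R p -> f (zrot t *m p) = f p}) ->
  `|sint (fun p => g p * f p) - circle_functional (e3 R) g| <=
  4 * eps + K * sint (fun p => p 2 0 ^+ 2 * f p).
Proof.
move=> eps0; have [M M0 gM] := sphere_bounded cg.
have [d d0 unif] := sphere_unif_continuous cg eps0.
have [N0 hN0] := mesh_le (divr_gt0 d0 (ltr0n R 2)).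
have mesh : 2 * pi / N0.+1%:R < d by apply: (le_lt_trans (hN0 N0 (leqnn _))); lra.
set a := circle_functional (e3 R) g.
pose b := rot_average N0 (circ 0).
have ha : `|a - b| <= 2 * eps.
  rewrite /a -(circle_functional_average N0).
  apply: circle_functional_close => // p [Sp p0].
  by apply: (rot_average_dist unif mesh) => //; rewrite -dot_e3 p0 normr0 mulr0.
(* Where 2 |z| >= d, K z^2 dominates the trivial bound 2 M on the oscillation. *)
pose K := 2 * M * (2 / d) ^+ 2; exists K => f lf f0 f1 inv.
have K0 : 0 <= K by rewrite /K (mulr_ge0 _ (sqr_ge0 _))// mulr_ge0.
have pw p : sphere R p -> `|rot_average N0 p - a| <= 4 * eps + K * p 2 0 ^+ 2.
  move=> Sp; apply: (le_trans (ler_distD b _ _)); rewrite (distrC b).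
  have [zp|zp] := ltP (2 * `|p 2 0|) d.
    have h := rot_average_dist unif mesh Sp zp; rewrite -/b in h.
    by have := mulr_ge0 K0 (sqr_ge0 (p 2 0)); lra.
  have h : `|rot_average N0 p - b| <= 2 * M.
    apply: (@mean_le N0 (fun k => g (zrot (k%:R * (2 * pi / N0.+1%:R)) *m p))
      (fun k => g (zrot (k%:R * (2 * pi / N0.+1%:R)) *m circ 0))) => k.
    apply: (le_trans (ler_normB _ _)); have -> : 2 * M = M + M by ring.
    by apply: lerD; apply: gM; apply/(sphere_orth _ (zrot_orth _)) => //;
       exact: sphere_circ.
  suff : 2 * M <= K * p 2 0 ^+ 2 by lra.
  rewrite /K -mulrA -exprMn ler_peMr ?mulr_ge0//.
  have d2 : 0 <= 2 / d by rewrite divr_ge0// ltW.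
  rewrite -real_normK ?num_real// exprn_ege1// normrM (ger0_norm d2).
  by rewrite mulrAC ler_pdivlMr// mul1r.
have bg : sbm (rot_average N0).
  apply: sbmM; first exact: sbm_cst.
  apply: sbm_sum => k; split.
    by apply: smeas_orth (sbm_meas sbm_sphere); exact: zrot_orth.
  by exists M => p Sp; apply: gM; exact/(sphere_orth _ (zrot_orth _)).
pose h p := (rot_average N0 p - a) * f p.
pose k p := 4 * eps * f p + K * (p 2 0 ^+ 2 * f p).
have lh : sL1 h by exact: (sbm_int_mul (sbmD bg (sbm_cst (- a))) lf).
have lz : sL1 (fun p => p 2 0 ^+ 2 * f p).
  exact: (sbm_int_mul (sbmX 2 (sbm_coord 2)) lf).
have lk : sL1 k by exact: (sL1D (sL1Z _ lf) (sL1Z _ lz)).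
have lhn : sL1 (fun p => `|h p|) by exact: (integrable_norm lh).
have -> : sint (fun p => g p * f p) - a = sint h.
  rewrite -(sint_average N0 lf inv) -[a in LHS]mulr1 -f1 -ISZ// -ISB.
  - by apply: eq_IS => p _; rewrite /h mulrBl.
  - exact: (sbm_int_mul bg lf).
  - exact: (sL1Z _ lf).
have -> : 4 * eps + K * sint (fun p => p 2 0 ^+ 2 * f p) = sint k.
  by rewrite (ISD (sL1Z _ lf) (sL1Z _ lz)) (ISZ _ lf) (ISZ _ lz) f1 mulr1.
apply: (@le_trans _ _ (sint (fun p => `|h p|))); first exact: (IS_abs_le lh lhn).
rewrite -subr_ge0 -(ISB lk lhn); apply: (ae_int_ge0 (@measurable_sphere R 2)).
  exact: (sL1D lk (sL1N lhn)).
apply: ae_imp f0 => p f0 Sp.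
rewrite subr_ge0 /h normrM (ger0_norm (f0 Sp)).
apply: (le_trans (ler_wpM2r (f0 Sp) (pw p Sp))).
by rewrite mulrDl /k -(mulrA K).
Qed.

End Averaging.

(** * Reduction to the vertical axis *)

Section Concentration.
Variable R : realType.
Implicit Types (g f : 'cV[R]_3 -> R) (Q A B : 'M[R]_3).

Lemma within_sphere_orth B g : B^T *m B = 1%:M ->
  {within sphere R, continuous g} ->
  {within sphere R, continuous (fun p => g (B *m p))}.
Proof.
move=> B1 /subspace_continuousP cg; apply/subspace_continuousP => x Sx.
apply/(@cvgrPdist_lt _ R^o) => eps e0.
have SBx : sphere R (B *m x) by exact/(sphere_orth _ B1).
have /(@cvgrPdist_lt _ R^o)/(_ _ e0) := cg _ SBx.
rewrite near_withinE => /nbhs_ballP[r /= r0 rP].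
(* B is an isometry for the Euclidean norm only; passing from the sup norm costs a factor 3. *)
rewrite near_withinE; apply/nbhs_ballP; exists (r / 3) => /=.
  by rewrite divr_gt0.
move=> p; rewrite -ball_normE /= => xp Sp; apply: rP; last first.
  exact/(sphere_orth _ B1).
rewrite -ball_normE /=; apply: (le_lt_trans (norm_le_enorm _)).
rewrite -mulmxBr enorm_orth//; apply: (le_lt_trans (enorm_le_norm _)).
by rewrite mulrC -ltr_pdivlMr.
Qed.

Lemma circle_functional_orth B g : B^T *m B = 1%:M ->
  {within sphere R, continuous g} ->
  circle_functional (B *m e3 R) g =
  circle_functional (e3 R) (fun p => g (B *m p)).
Proof.
move=> B1 cg; congr (_ * _).
have mg : measurable_fun (great_circle (B *m e3 R) : set (space3 R 1)) g.
  apply: continuous_within_measurable_H; first exact: measurable_great_circle.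
  exact: continuous_subspaceW (@great_circle_sphere R _) cg.
rewrite -(Rintegral_orth B1 (measurable_great_circle _ _) mg).
congr (\int[_]_(p in _) _); apply/seteqP; split => p [Sp ep]; split.
- exact/(sphere_orth _ B1).
- by move: ep; rewrite dot_mul B1 mul1mx.
- exact/(sphere_orth _ B1).
- by rewrite dot_mul B1 mul1mx.
Qed.

Lemma density_functional_orth A B f g : A^T *m A = 1%:M -> B^T *m B = 1%:M ->
  smeas f -> smeas g ->
  density_functional (rotate (A *m B^T) f) g =
  sint (fun q => g (B *m q) * rotate A f q).
Proof.
move=> A1 B1 mf mg.
have mh : smeas (fun q => g (B *m q) * rotate A f q).
  by apply: smeasM; exact: smeas_orth.
rewrite -(IS_orth (orthV B1) mh); apply: eq_IS => p _.
by rewrite /rotate !mulmxA orth_trmx// mul1mx.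
Qed.

Definition uniaxial (S : R) : 'M[R]_3 := S *: deviator (e3 R).

Lemma uniaxial_orth A S : A^T *m A = 1%:M ->
  A^T *m (S *: deviator (A *m e3 R)) *m A = uniaxial S.
Proof.
move=> A1; rewrite -scalemxAr -scalemxAl deviator_orth//.
by rewrite mulmxA A1 mul1mx.
Qed.

(* Finite energy makes the weight nonnegative where [f] is positive, so its mean
   2 S^2 / 3 - eta is nonnegative; since S > - 1/2 this gives S <= - 3 eta. *)
Lemma uniaxial_second_moment S eta f : - (2^-1) < S < 0 -> eta < 6^-1 ->
  admissible (uniaxial S) f -> (energy (uniaxial S) eta f < +oo)%E ->
  sint (fun p => p 2 0 ^+ 2 * f p) <= (1 - 6 * eta) / 3.
Proof.
move=> /andP[S1 S0] eta6 adf ef.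
have [f1 mom] := admissible_moment adf; have [[lf f0 _] _] := adf.
have [pos _ _] := finite_energy lf f0 ef.
pose w := weight (uniaxial S) eta.
have lwf : sL1 (fun p => w p * f p).
  exact: (sbm_int_mul (sbm_weight _ _) lf).
have lz : sL1 (fun p => p 2 0 ^+ 2 * f p).
  exact: (sbm_int_mul (sbmX 2 (sbm_coord 2)) lf).
have : 0 <= sint (fun p => w p * f p).
  apply: (ae_int_ge0 (@measurable_sphere R 2) lwf).
  apply: ae_imp pos => p h Sp; have [fp wp] := h Sp.
  have [wn|wn] := leP (w p) 0; first by rewrite (wp wn) mulr0.
  by rewrite mulr_ge0// ltW.
have zE : sint (fun p => p 2 0 ^+ 2 * f p) = (1 + 2 * S) / 3.
  have := mom 2 2; rewrite /uniaxial /deviator !mxE big_ord1 !mxE /= => zz.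
  transitivity (sint (fun p => p 2 0 * p 2 0 * f p)).
    by apply: eq_IS => p _; rewrite expr2.
  by rewrite zz !mulr1n; field.
have -> : sint (fun p => w p * f p) =
    S * sint (fun p => p 2 0 ^+ 2 * f p) - (S / 3 + eta) * sint f.
  rewrite -(ISZ S lz) -(ISZ _ lf) -(ISB (sL1Z _ lz) (sL1Z _ lf)).
  apply: eq_IS => p /sphereP Sp; rewrite /w /weight.
  have -> : dot (uniaxial S *m p) p = S * (p 2 0 ^+ 2 -
      (p 0 0 ^+ 2 + p 1 0 ^+ 2 + p 2 0 ^+ 2) / 3).
    by rewrite dotE !mxE !sum3 !mxE !big_ord1 !mxE /=; field.
  by rewrite Sp; field.
by rewrite f1 zE; nra.
Qed.

Lemma optimal_axisymmetric S eta f : (J (uniaxial S) eta < +oo)%E ->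
  optimal_energy_distribution (uniaxial S) eta f ->
  forall t, {ae Hmeas R 2, forall p, sphere R p -> f (zrot t *m p) = f p}.
Proof.
move=> Joo opt t; have r1 := zrot_orth t.
apply: (optimal_unique Joo _ opt).
have QS : (zrot t)^T *m uniaxial S *m zrot t = uniaxial S.
  by have := uniaxial_orth S r1; rewrite zrot_e3.
by have := optimal_orth r1 opt; rewrite QS.
Qed.

(** A sends the vertical axis to that of Q, so the rotated minimizer is the minimizer of a vertical
    problem, where axisymmetry and the moment bound apply. Criticality enters through the finiteness
    of J. *)
Lemma oblate_optimal Q eta f : oblate_uniaxial Q -> critical_point eta Q ->
  optimal_energy_distribution Q eta f -> eta < 6^-1 ->
  exists A, SO3 R A /\ [/\ sL1 (rotate A f),
    {ae Hmeas R 2, forall p, sphere R p -> 0 <= rotate A f p},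
    sint (rotate A f) = 1,
    (forall t, {ae Hmeas R 2, forall p, sphere R p ->
      rotate A f (zrot t *m p) = rotate A f p}) &
    sint (fun p => p 2 0 ^+ 2 * rotate A f p) <= (1 - 6 * eta) / 3].
Proof.
move=> [u [S [Su S12 QE]]] [[_ Joo] _] opt eta6.
have [A [SA Ae]] := SO3_map (@sphere_e3 R) Su.
have [A1 _] := SA.
have opt' := optimal_orth A1 opt.
have QS : A^T *m Q *m A = uniaxial S by rewrite QE -Ae uniaxial_orth.
rewrite QS in opt'.
have [ad Ef] := opt; have [[lf _ _] _] := ad.
have eE := energy_orth Q eta A1 (sL1_meas lf); rewrite QS in eE.
have eoo : (energy (uniaxial S) eta (rotate A f) < +oo)%E.
  by rewrite eE; exact: (eq_ind_r (fun x => (x < +oo)%E) Joo Ef).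
have [ad' Ef'] := opt'; have [[lf' f0' f1'] _] := ad'.
exists A; split; first exact: SA.
split; [exact: lf'|exact: f0'|exact: f1'| |].
- apply: optimal_axisymmetric opt'.
  exact: (eq_ind _ (fun x => (x < +oo)%E) eoo _ Ef').
- exact: (uniaxial_second_moment S12 eta6 ad' eoo).
Qed.

End Concentration.

(** * Existence and concentration *)

Theorem corollary5p10 (R : realType) :
  (forall eta : R, 0 <= eta < 6^-1 ->
     exists Q : 'M[R]_3, oblate_uniaxial Q /\ critical_point eta Q)
  /\
  (forall (eta : nat -> R) (Q : nat -> 'M[R]_3) (f : nat -> 'cV[R]_3 -> R),
     (forall j, eta j < 6^-1) ->
     eta @ \oo --> (6^-1 : R) ->
     (forall j, oblate_uniaxial (Q j) /\ critical_point (eta j) (Q j)) ->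
     (forall j, optimal_energy_distribution (Q j) (eta j) (f j)) ->
     forall e : 'cV[R]_3, sphere R e ->
       exists A : nat -> 'M[R]_3,
         (forall j, SO3 R (A j)) /\
         weak_star_cvg (fun j => density_functional (rotate (A j) (f j)))
                       (circle_functional e)).
Proof.
split; first exact: exists_oblate_critical.
move=> eta Q f eta6 eta_cvg crit opt e Se.
have [B [SB Be]] := SO3_map (@sphere_e3 R) Se; have [B1 _] := SB.
have /choice[A hA] : forall j, exists A, SO3 R A /\
    [/\ sL1 (rotate A (f j)),
    {ae Hmeas R 2, forall p, sphere R p -> 0 <= rotate A (f j) p},
    sint (rotate A (f j)) = 1,
    (forall t, {ae Hmeas R 2, forall p, sphere R p ->
      rotate A (f j) (zrot t *m p) = rotate A (f j) p}) &
    sint (fun p => p 2 0 ^+ 2 * rotate A (f j) p) <= (1 - 6 * eta j) / 3].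
  by move=> j; have [obl cr] := crit j; exact: (oblate_optimal obl cr (opt j) (eta6 j)).
(* B sends the vertical axis to e and A j sends it to the axis of Q j, so this rotation sends e to
   the axis of Q j. *)
exists (fun j => A j *m B^T); split => [j|g cg].
  by apply: SO3_mul; [exact: (hA j).1|exact: SO3_tr].
have cgB := within_sphere_orth B1 cg.
apply/(@cvgrPdist_le _ R^o) => eps e0.
(* [concentration] returns four times this, that is eps / 2. *)
have e80 : 0 < eps / 8 by rewrite divr_gt0.
have [K hK] := concentration cgB e80.
(* The second moment is at most 2 (1/6 - eta j), so this threshold makes K times it at most eps / 2;
   adding 1 covers K = 0. *)
have d0 : 0 < eps / (4 * (`|K| + 1)) by rewrite divr_gt0// mulr_gt0// ltr_wpDl.
move/(@cvgrPdist_le _ R^o)/(_ _ d0): eta_cvg.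
apply: filterS => j etaj.
have [SA [lf f0 f1 inv zf]] := hA j; have [A1 _] := SA.
have [[[lfj _ _] _] _] := opt j.
rewrite (density_functional_orth A1 B1 (sL1_meas lfj) (sbm_meas (sbm_sphere cg))).
rewrite -Be (circle_functional_orth B1 cg) distrC.
apply: (le_trans (hK _ lf f0 f1 inv)).
set tau := sint _ in zf *.
have tau0 : 0 <= tau.
  apply: (ae_int_ge0 (@measurable_sphere R 2)).
    exact: (sbm_int_mul (sbmX 2 (sbm_coord 2)) lf).
  by apply: ae_imp f0 => p f0 Sp; rewrite mulr_ge0 ?sqr_ge0 ?f0.
have etaj' : 6^-1 - eta j <= eps / (4 * (`|K| + 1)).
  by rewrite (le_trans (ler_norm _)).
have KD : 0 < `|K| + 1 by rewrite ltr_wpDl.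
have Ktau : (`|K| + 1) * tau <= eps / 2.
  have -> : eps / 2 = (`|K| + 1) * (2 * (eps / (4 * (`|K| + 1)))).
    by field; rewrite gt_eqF.
  by rewrite ler_pM2l//; lra.
have KK : K * tau <= (`|K| + 1) * tau.
  by rewrite ler_wpM2r// (le_trans (ler_norm K))// lerDl.
by lra.
Qed.
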